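(* Let $L_1$ and $L_2$ be oriented free links, and let $\beta_1\in fB_n$ and $\beta_2\in fB_m$ be free braids whose closures are $L_1$ and $L_2$, respectively. Then $L_1$ and $L_2$ are isotopic as oriented free links if and only if $\beta_1$ and $\beta_2$ differ by a finite sequence of free braid isotopies and the following moves and their inverses: (1) flat conjugation; (2) right virtual $L$-moves; (3) right flat $L$-moves; (4) right and left threaded $L$-moves.
   Context: **Framed 4-graphs.** A framed 4-graph is a finite graph (loops and multiple edges allowed) all of whose vertices have degree 4, such that at every vertex the four emanating half-edges are split into two pairs of formally opposite half-edges. Circle components without vertices are also allowed, and there is at least one component. Passing at each vertex from a half-edge to its opposite one decomposes the graph into closed curves, called unicursal components. No embedding in a surface is given. An orientation is a choice of direction on each unicursal component. **Free links.** An (oriented) free link is an equivalence class of (oriented) framed 4-graphs modulo isomorphism (preserving the framing and orientation) and the following three Reidemeister moves and their inverses, orientations being carried along. Equivalent graphs are called isotopic. (1) First move: addition/removal of a vertex at which a loop edge is attached along two non-opposite half-edges. That is, a unicursal component passes twice consecutively through that vertex, and the vertex together with the loop is erased from the strand. (2) Second move: addition/removal of two vertices $a,b$ forming a bigon, i.e. joined by two edges which are non-opposite at $a$ and non-opposite at $b$. That is, each of two arcs of unicursal components passes consecutively through $a$ and $b$, and both vertices are erased from both arcs. (3) Third move: for a triangle formed by three vertices and three edges, where two triangle edges meeting at a vertex are non-opposite, so that three arcs of unicursal components pairwise meet in the three vertices, each arc passing consecutively through two of them, the order of the two vertices is reversed along each of the three arcs. **Free braids.** The $n$-strand free braid group $fB_n$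 is the group with generators $\sigma_1,\dots,\sigma_{n-1},\zeta_1,\dots,\zeta_{n-1}$ and relations - $\sigma_i\sigma_j=\sigma_j\sigma_i$, $\zeta_i\zeta_j=\zeta_j\zeta_i$, $\zeta_i\sigma_j=\sigma_j\zeta_i$ for $|i-j|>1$; - $\sigma_i\sigma_{i+1}\sigma_i=\sigma_{i+1}\sigma_i\sigma_{i+1}$, $\zeta_i\zeta_{i+1}\zeta_i=\zeta_{i+1}\zeta_i\zeta_{i+1}$, $\sigma_i\zeta_{i+1}\zeta_i=\zeta_{i+1}\zeta_i\sigma_{i+1}$ for $1\le i\le n-2$; - $\zeta_i^2=1$, $\sigma_i^2=1$, $\sigma_i\zeta_i=\zeta_i\sigma_i$ for $1\le i\le n-1$. A word in the generators is drawn, from top to bottom, as a flat virtual braid diagram with $n$ descending strands: $\sigma_i$ is a flat crossing, and $\zeta_i$ a virtual crossing, of the strands in positions $i$ and $i+1$. Free braid isotopy means passing between diagrams (words) representing the same element of $fB_n$. **Closure.** The closure of $\beta\in fB_n$ is obtained by joining, for each $i=1,\dots,n$, the $i$-th lower endpoint of the diagram to the $i$-th upper endpoint by simple disjoint arcs. It is regarded as a framed 4-graph whose vertices are the flat crossings, with opposite half-edges those belonging to the same strand (virtual crossings are not vertices), oriented so that the braid strands run downwards. Its class as an oriented free link depends only on $\beta$. **Flat conjugation.** Replacing $\beta\in fB_n$ by $\sigma_i\beta\sigma_i^{-1}$ ($=\sigma_i\beta\sigma_i$) for some $1\le i\le n-1$. **$L$-moves.** An $L$-move on a free braid is performed on a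 flat virtual braid diagram representing it. An arc is cut open at a point $p$ that is not a crossing, and the two ends of the gap are pulled so as to create a new pair of vertically aligned braid strands: the end of the upper part of the cut arc is continued downwards to a new lower endpoint, and the end of the lower part is continued upwards to a new upper endpoint. The closure of the resulting diagram is isotopic to the closure of the original one. The new strands cross the other parts of the diagram only virtually, except as specified below. The new lower and upper endpoints occupy the same position, so an $n$-strand diagram becomes an $(n+1)$-strand diagram. - Right virtual, respectively right flat, $L$-move: the new pair of strands is to the right of the cutpoint, with no other strand between the cutpoint and the new strands. The two ends of the cut arc, on their way from near $p$ to the new vertical position, cross each other exactly once, and this new crossing is virtual, respectively flat. - Right, respectively left, threaded $L$-move: the new pair of strands is to the right, respectively to the left, of the cutpoint. The two ends of the cut arc cross each other exactly once, in a virtual crossing, and exactly one other strand of the diagram (the thread) lies between the cutpoint and the new pair of strands. Each of the two ends crosses the thread exactly once on the way to the new vertical position, and these two crossings are flat. The virtual crossing of the two ends with each other lies on the cutpoint side of the thread. (Thus, in the right case with cut arc, thread and new strands in consecutive positions $j,j+1,j+2$, the local picture inserted is $\sigma_{j+1}\zeta_j\sigma_{j+1}$; in the left case, with new strands, thread and cut arc in consecutive positions $j,j+1,j+2$, it is $\sigma_j\zeta_{j+1}\sigma_j$.) *)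

(* Defs.v *)
From HB Require Import structures.
From mathcomp Require Import all_boot.
From mathcomp Require Import zify.
From Stdlib Require Export Relation_Operators.

Set Implicit Arguments.
Unset Strict Implicit.
Unset Printing Implicit Defensive.

(** * Framed 4-graphs *)

(* [ed h] is the other half of the edge containing [h], and [opp h] is the
   half-edge opposite to [h].  Loops and multiple edges are allowed.
   [ncirc] is the number of circle components without vertices. *)
Record framed4 := Framed4 {
  vert : finType;
  half : finType;
  atv : half -> vert;
  ed : half -> half;
  opp : half -> half;
  ncirc : nat;
  edK : involutive ed;
  ed_neq : forall h, ed h != h;
  oppK : involutive opp;
  opp_neq : forall h, opp h != h;
  atv_opp : forall h, atv (opp h) = atv h;
  deg4 : forall v, #|[set h | atv h == v]| = 4;
  comp_gt0 : 0 < #|vert| + ncirc }.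

Arguments atv {f} : rename.
Arguments ed {f} : rename.
Arguments opp {f} : rename.

(* [out h] says that the component runs along [h] away from the vertex.  A
   circle without vertices needs no such datum: its two directions are
   exchanged by an isomorphism. *)
Record ograph := OGraph {
  ugraph :> framed4;
  out : pred (half ugraph);
  out_opp : forall h, out (opp h) = ~~ out h;
  out_ed : forall h, out (ed h) = ~~ out h }.

Arguments out {o} : rename.

Definition ograph_iso (G G' : ograph) : Prop :=
  exists (f : half G -> half G') (g : vert G -> vert G'),
  [/\ bijective f, bijective g,
      [/\ forall h, atv (f h) = g (atv h), forall h, ed (f h) = f (ed h),
          forall h, opp (f h) = f (opp h) & forall h, out (f h) = out h]
    & ncirc G' = ncirc G].

(** * Reidemeister moves *)

(* From [h], run along its edge and pass through the vertex at its end; on the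
   half-edges [h] with [out h], this follows the orientation. *)
Definition nxt (G : framed4) (h : half G) : half G := opp (ed h).

(* [erased S G'] : G' is obtained from G by erasing the vertices in S from the
   curves passing through them.  An edge of G' is a run of edges of G that
   passes through vertices of S only, and a unicursal component all of whose
   vertices are in S (an orbit of [nxt] on outgoing half-edges) becomes a
   circle. *)
Definition erased (G : ograph) (S : {set vert G}) (G' : ograph) : Prop :=
  exists (f : half G' -> half G) (g : vert G' -> vert G),
  [/\ [/\ injective f, injective g, codom f =i [pred h | atv h \notin S]
        & codom g =i [pred v | v \notin S]],
      [/\ forall h, g (atv h) = atv (f h), forall h, f (opp h) = opp (f h)
        & forall h, out (f h) = out h],
      forall h, exists k, f (ed h) = ed (iter k (@nxt G) (f h)) /\
        forall i, i < k -> atv (ed (iter i (@nxt G) (f h))) \in S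
    & ncirc G' = ncirc G +
        fcard (@nxt G) [pred h | out h &&
          [forall h', fconnect (@nxt G) h h' ==> (atv h' \in S)]]].

Definition reid1 (G G' : ograph) : Prop :=
  exists h : half G,
  [/\ atv (ed h) = atv h, ed h != opp h & erased [set atv h] G'].

Definition reid2 (G G' : ograph) : Prop :=
  exists h1 h2 : half G,
  [/\ atv h2 = atv h1, atv (ed h2) = atv (ed h1), atv (ed h1) != atv h1,
      [/\ h2 != h1, h2 != opp h1 & ed h2 != opp (ed h1)]
    & erased [set atv h1; atv (ed h1)] G'].

(* [T] consists of the six half-edges of the edges of a triangle.  Reversing
   the order of the two vertices along an arc keeps the half-edges and their
   two pairings, and moves the four half-edges of the arc at its two vertices
   to the vertex at the other end of the triangle edge of this arc. *)
Definition flip_atv (G : framed4) (T : {set half G}) (h : half G) : vert G :=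
  if h \in T then atv (ed h)
  else if opp h \in T then atv (ed (opp h)) else atv h.

Definition reid3 (G G' : ograph) : Prop :=
  exists h1 h2 h3 : half G,
  [/\ [/\ atv (ed h1) = atv h2, atv (ed h2) = atv h3 & atv (ed h3) = atv h1],
      [/\ atv h1 != atv h2, atv h2 != atv h3 & atv h3 != atv h1],
      [/\ h2 != opp (ed h1), h3 != opp (ed h2) & h1 != opp (ed h3)]
    & exists (f : half G -> half G') (g : vert G -> vert G'),
      let T := [set h1; h2; h3; ed h1; ed h2; ed h3] in
      [/\ bijective f, bijective g,
          [/\ forall h, atv (f h) = g (flip_atv T h),
              forall h, ed (f h) = f (ed h), forall h, opp (f h) = f (opp h)
            & forall h, out (f h) = out h]
        & ncirc G' = ncirc G]].

Inductive free_step (G G' : ograph) : Prop :=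
| FreeIso of ograph_iso G G'
| FreeR1 of reid1 G G'
| FreeR2 of reid2 G G'
| FreeR3 of reid3 G G'.

(* Oriented free links are the classes of this relation. *)
Definition isotopic : ograph -> ograph -> Prop :=
  clos_refl_sym_trans ograph free_step.

(** * Free braids *)

(* Strand positions and generator indices are counted from 0 : [Sig i] and
   [Zet i] are the flat and the virtual crossing of the strands in positions
   [i] and [i.+1]. *)
Inductive gen := Sig of nat | Zet of nat.

Definition idx (g : gen) : nat := match g with Sig i | Zet i => i end.

Definition far (i j : nat) : bool := (i.+1 < j) || (j.+1 < i).

Inductive fB_rel (n : nat) : seq gen -> seq gen -> Prop :=
| RelSS i j : i.+1 < n -> j.+1 < n -> far i j ->
    fB_rel n [:: Sig i; Sig j] [:: Sig j; Sig i]
| RelZZ i j : i.+1 < n -> j.+1 < n -> far i j ->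
    fB_rel n [:: Zet i; Zet j] [:: Zet j; Zet i]
| RelZS i j : i.+1 < n -> j.+1 < n -> far i j ->
    fB_rel n [:: Zet i; Sig j] [:: Sig j; Zet i]
| RelSSS i : i.+2 < n ->
    fB_rel n [:: Sig i; Sig i.+1; Sig i] [:: Sig i.+1; Sig i; Sig i.+1]
| RelZZZ i : i.+2 < n ->
    fB_rel n [:: Zet i; Zet i.+1; Zet i] [:: Zet i.+1; Zet i; Zet i.+1]
| RelSZZ i : i.+2 < n ->
    fB_rel n [:: Sig i; Zet i.+1; Zet i] [:: Zet i.+1; Zet i; Sig i.+1]
| RelZ2 i : i.+1 < n -> fB_rel n [:: Zet i; Zet i] [::]
| RelS2 i : i.+1 < n -> fB_rel n [:: Sig i; Sig i] [::]
| RelSZ i : i.+1 < n -> fB_rel n [:: Sig i; Zet i] [:: Zet i; Sig i].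

Inductive fB_step (n : nat) : seq gen -> seq gen -> Prop :=
| FBStep u v l r : fB_rel n l r -> fB_step n (u ++ l ++ v) (u ++ r ++ v).

(* Equality in fB_n of the elements represented by two words.  The generators
   are involutions, so words without inverse letters represent all elements,
   and the congruence classes of words form the group (see [fB_eqVr]). *)
Definition fB_eq (n : nat) : seq gen -> seq gen -> Prop :=
  clos_refl_sym_trans (seq gen) (fB_step n).

(* A word in the generators of fB_n, i.e. a diagram of a free braid.  The
   closure of a braid on no strands would be empty, so [0 < n] is required. *)
Record braid (n : nat) := Braid {
  bword :> seq gen;
  bwordP : (0 < n) && all (fun g => (idx g).+1 < n) bword }.

Lemma fB_eqVr n (w : seq gen) :
  all (fun g => (idx g).+1 < n) w -> fB_eq n (w ++ rev w) [::].
Proof.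
elim/last_ind: w => [|w g IHw] /=; first by move=> _; apply: rst_refl.
rewrite all_rcons => /andP[lt_g /IHw eq_w]; apply: rst_trans eq_w.
rewrite rev_rcons cat_rcons; apply: rst_step.
by apply: (FBStep w (rev w) (l := [:: g; g]) (r := [::])); case: g lt_g => i; constructor.
Qed.

(** * Closure *)

Definition swap_pos (i j : nat) : nat :=
  if j == i then i.+1 else if j == i.+1 then i else j.

Lemma swap_posK i : involutive (swap_pos i).
Proof.
move=> j; rewrite /swap_pos; case: (eqVneq j i) => [->|nji].
  by rewrite eqxx; case: eqP => //; lia.
by case: (eqVneq j i.+1) => [->|nji1]; rewrite ?eqxx // !ifN.
Qed.

Section FirstHit.
Variables (T : finType) (f : T -> T) (A : pred T).

(* The first point of the orbit of x after x itself that lies in A. *)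
Definition first_hit (x : T) : T :=
  iter (find A (traject f (f x) #|T|)) f (f x).

Hypothesis f_inj : injective f.

Lemma first_hitP x : A x ->
  exists k, [/\ first_hit x = iter k.+1 f x, A (iter k.+1 f x)
             & forall i, i < k -> ~~ A (iter i.+1 f x)].
Proof.
move=> Ax; set s := traject f (f x) #|T|.
have has_s : has A s.
  apply/hasP; exists x => //; apply/trajectP; exists (order f x).-1.
    by rewrite orderSpred max_card.
  by rewrite -iterSr orderSpred iter_order.
have lt_s : find A s < #|T| by move: has_s; rewrite has_find size_traject.
have nth_s i : i < #|T| -> nth x s i = iter i.+1 f x.
  by move=> lt_i; rewrite (set_nth_default (f x)) ?size_traject // nth_traject // -iterSr.
exists (find A s); split; first by rewrite /first_hit -iterSr.
  by have := nth_find x has_s; rewrite nth_s.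
move=> i lt_i; have := before_find x lt_i.
by rewrite nth_s ?(ltn_trans lt_i) // => ->.
Qed.

Lemma first_hit_in x : A x -> A (first_hit x).
Proof. by case/first_hitP=> k [-> ? _]. Qed.

Lemma first_hit_min x k : A (iter k.+1 f x) ->
  (forall i, i < k -> ~~ A (iter i.+1 f x)) -> A x -> first_hit x = iter k.+1 f x.
Proof.
move=> Ak min_k /first_hitP[l [-> Al min_l]].
have [lt_kl|lt_lk|-> //] := ltngtP k l.
  by have := min_l _ lt_kl; rewrite Ak.
by have := min_k _ lt_lk; rewrite Al.
Qed.

End FirstHit.

Lemma first_hitK (T : finType) (f f' : T -> T) (A : pred T) (x : T) :
  cancel f f' -> A x -> first_hit f' A (first_hit f A x) = x.
Proof.
move=> fK Ax; have f_inj := can_inj fK.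
have f'_inj : injective f'.
  by apply: bij_inj (bij_can_bij _ fK); apply: injF_bij.
have back j k : j <= k -> iter j f' (iter k f x) = iter (k - j) f x.
  elim: j => [|j IHj] lt_jk; first by rewrite subn0.
  by rewrite iterS IHj 1?ltnW // -[k - j]prednK ?subn_gt0 // iterS fK subnS.
have [k [-> Ak min_k]] := first_hitP f_inj Ax.
rewrite (@first_hit_min _ f' A f'_inj _ k) //; first by rewrite back // subnn.
  by rewrite back // subnn.
move=> i lt_i; rewrite back; last lia.
by have := min_k (k - i.+1) ltac:(lia); rewrite subSn //; lia.
Qed.

Section Closure.
Variables (n : nat) (b : braid n).

Let w : seq gen := b.

(* The point (p, j) of the closure is on the strand in position j, just above
   the p-th crossing of the word, or just above the closing arcs if p is the
   length of the word. *)
Definition cpoint : finType := ('I_(size w).+1 * 'I_n)%type.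

Definition cross (p : nat) (j : 'I_n) : 'I_n :=
  if onth w p is Some g then insubd j (swap_pos (idx g) j) else j.

Definition down (x : cpoint) : cpoint := (ordS x.1, cross x.1 x.2).

Definition up (x : cpoint) : cpoint :=
  (ord_pred x.1, cross (ord_pred x.1) x.2).

Definition flat_level (p : nat) : bool :=
  if onth w p is Some (Sig _) then true else false.

(* The strand through (p, j) goes through the p-th crossing, and this crossing
   is flat. *)
Definition flat_point (x : cpoint) : bool :=
  if onth w x.1 is Some (Sig i) then (x.2 == i :> nat) || (x.2 == i.+1 :> nat)
  else false.

Lemma flat_point_level x : flat_point x -> flat_level x.1.
Proof. by rewrite /flat_point /flat_level; case: onth => [[]|]. Qed.

Lemma crossK p : involutive (cross p).
Proof.
rewrite /cross => j; case: onth => [g|] //.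
apply: val_inj; rewrite !val_insubd.
have [lt|ge] := ifP (swap_pos (idx g) j < n); first by rewrite swap_posK ltn_ord.
by rewrite ge.
Qed.

Lemma downK : cancel down up.
Proof. by case=> p j; rewrite /up [(down _).1]/= ordSK crossK. Qed.

Lemma upK : cancel up down.
Proof. by case=> p j; rewrite /down [(up _).1]/= ord_predK crossK. Qed.

Definition cvert : finType := {p : 'I_(size w).+1 | flat_level p}.

(* (x, true) is the half-edge leaving downwards, and (x, false) the half-edge
   entering from above, the flat crossing just below the point x. *)
Definition chalf : finType := ({x : cpoint | flat_point x} * bool)%type.

Definition catv (h : chalf) : cvert :=
  exist _ (val h.1).1 (flat_point_level (valP h.1)).

Definition copp (h : chalf) : chalf := (h.1, ~~ h.2).

Definition ced (h : chalf) : chalf :=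
  (insubd h.1 (first_hit (if h.2 then down else up) flat_point (val h.1)),
   ~~ h.2).

Definition ccirc : nat :=
  fcard down [pred x | [forall y, fconnect down x y ==> ~~ flat_point y]].

Lemma cedK : involutive ced.
Proof.
have hit f f' x : cancel f f' -> cancel f' f ->
    insubd (insubd x (first_hit f flat_point (val x)))
      (first_hit f' flat_point
        (val (insubd x (first_hit f flat_point (val x))))) =
    x :> {x : cpoint | flat_point x}.
  move=> fK f'K; have flat_x := valP x.
  have flat_y : flat_point (first_hit f flat_point (val x)).
    by apply: first_hit_in flat_x; apply: can_inj fK.
  by apply: val_inj; rewrite [in X in first_hit f' _ X]insubdK // first_hitK // insubdK.
case=> x []; rewrite /ced /=; congr (_, _); apply: hit; [|exact: upK| |exact: downK].
  exact: downK.
exact: upK.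
Qed.

Lemma ced_neq h : ced h != h.
Proof. by case: h => x []; rewrite /ced /= xpair_eqE /= andbF. Qed.

Lemma coppK : involutive copp.
Proof. by case=> x a; rewrite /copp /= negbK. Qed.

Lemma copp_neq h : copp h != h.
Proof. by case: h => x []; rewrite /copp /= xpair_eqE /= andbF. Qed.

Lemma catv_opp h : catv (copp h) = catv h.
Proof. by []. Qed.

Lemma cdeg4 v : #|[set h | catv h == v]| = 4.
Proof.
case: v => p lev_p; have := lev_p; rewrite /flat_level.
case def_p: (onth w p) => [[i|]|] // _.
have lt_i : i.+1 < n.
  have /andP[_ /(all_nthP (Sig i)) lt_w] := bwordP b.
  have lt_p : p < size w by rewrite -onthTE def_p.
  by have := lt_w p lt_p; have -> : nth (Sig i) b p = Sig i by apply: onth_nth def_p.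
have flat0 : flat_point (p, Ordinal (ltnW lt_i)) by rewrite /flat_point /= def_p eqxx.
have flat1 : flat_point (p, Ordinal lt_i) by rewrite /flat_point /= def_p eqxx orbT.
pose x0 : {x | flat_point x} := Sub (_, _) flat0.
pose x1 : {x | flat_point x} := Sub (_, _) flat1.
rewrite (_ : [set h | _] = setX [set x0; x1] setT).
  rewrite cardsX cardsT card_bool cards2; case: eqP => // /(congr1 val) [] /eqP.
  by rewrite eqn_leq ltnn andbF.
apply/setP=> -[x a]; rewrite !inE /= andbT -!val_eqE /=.
case: x => -[q j] /= flat_x; rewrite !xpair_eqE -!val_eqE /=.
have [eq_q|] //= := eqVneq (q : nat) p.
by move: flat_x; rewrite /flat_point /= eq_q def_p => ->.
Qed.

Lemma ccomp_gt0 : 0 < #|cvert| + ccirc.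
Proof.
have /andP[n_gt0 _] := bwordP b.
pose x0 : cpoint := (ord0, Ordinal n_gt0).
have [flat0|] := boolP [exists y, fconnect down x0 y && flat_point y].
  case/existsP: flat0 => y /andP[_ /flat_point_level lev_y].
  by rewrite addn_gt0; apply/orP; left; apply/card_gt0P; exists (Sub y.1 lev_y).
rewrite negb_exists => free0; rewrite addn_gt0; apply/orP; right.
have down_inj : injective down by apply: can_inj downK.
apply/fcard_gt0P => //.
  move=> x y /eqP <-; apply: eq_forallb => z.
  by rewrite -(same_fconnect1 down_inj).
exists x0; apply/forallP=> y; apply/implyP=> x0y.
by have := forallP free0 y; rewrite x0y.
Qed.

Definition closure_graph : framed4 :=
  @Framed4 cvert chalf catv ced copp ccirc cedK ced_neq coppK copp_neq catv_opp
    cdeg4 ccomp_gt0.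

Definition braid_closure : ograph :=
  @OGraph closure_graph (fun h : chalf => h.2) (fun=> erefl) (fun=> erefl).

End Closure.

(** * Moves on braids *)

Definition shift_gen (g : gen) : gen :=
  match g with Sig i => Sig i.+1 | Zet i => Zet i.+1 end.

(* [virtual_strand w k w' k'] : w' is w with a new strand that runs from
   position k at the top to position k' at the bottom and crosses the other
   strands only virtually. *)
Inductive virtual_strand : seq gen -> nat -> seq gen -> nat -> Prop :=
| VSNil k : virtual_strand [::] k [::] k
| VSRight w k w' k' : virtual_strand w k.+1 w' k' ->
    virtual_strand w k (Zet k :: w') k'
| VSLeft w k w' k' : virtual_strand w k w' k' ->
    virtual_strand w k.+1 (Zet k :: w') k'
| VSGenLeft g w k w' k' : (idx g).+1 < k -> virtual_strand w k w' k' ->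
    virtual_strand (g :: w) k (g :: w') k'
| VSGenRight g w k w' k' : k <= idx g -> virtual_strand w k w' k' ->
    virtual_strand (g :: w) k (shift_gen g :: w') k'.

(* The arc is cut at the level between w1 and w2.  There the new strands are in
   position q and the local picture [loc] is inserted; k is the position of
   the new upper and lower endpoints.  In all uses, [loc] exchanges the cut
   arc and the new strands: from above it receives the upper part of the cut
   arc and the new strand that comes from the new upper endpoint, which leave
   it below as the new strand that runs to the new lower endpoint and as the
   lower part of the cut arc, respectively. *)
Definition L_move (loc : seq gen) (q n : nat) (b : braid n) (b' : braid n.+1) :
    Prop :=
  exists (w1 w2 w1' w2' : seq gen) (k : nat),
  [/\ bword b = w1 ++ w2, virtual_strand w1 k w1' q,
      virtual_strand w2 q w2' k & bword b' = w1' ++ loc ++ w2'].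

(* In L-moves the cut arc is in position j before the move, except in the left
   threaded one, where it is in position j.+1. *)
Inductive braid_move : {n : nat & braid n} -> {n : nat & braid n} -> Prop :=
| FreeBraidIsotopy n (b b' : braid n) : fB_eq n b b' ->
    braid_move (existT _ n b) (existT _ n b')
| FlatConjugation n (b b' : braid n) i : i.+1 < n ->
    bword b' = Sig i :: rcons b (Sig i) ->
    braid_move (existT _ n b) (existT _ n b')
| RightVirtualL n (b : braid n) (b' : braid n.+1) j : j < n ->
    L_move [:: Zet j] j.+1 b b' ->
    braid_move (existT _ n b) (existT _ n.+1 b')
| RightFlatL n (b : braid n) (b' : braid n.+1) j : j < n ->
    L_move [:: Sig j] j.+1 b b' ->
    braid_move (existT _ n b) (existT _ n.+1 b')
| RightThreadedL n (b : braid n) (b' : braid n.+1) j : j.+1 < n ->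
    L_move [:: Sig j.+1; Zet j; Sig j.+1] j.+2 b b' ->
    braid_move (existT _ n b) (existT _ n.+1 b')
| LeftThreadedL n (b : braid n) (b' : braid n.+1) j : j.+1 < n ->
    L_move [:: Sig j; Zet j.+1; Sig j] j b b' ->
    braid_move (existT _ n b) (existT _ n.+1 b').

Definition L_equiv (n m : nat) (b : braid n) (b' : braid m) : Prop :=
  clos_refl_sym_trans {n : nat & braid n} braid_move
    (existT _ n b) (existT _ m b').

(* Main.v *)
(* A braid is determined in fB_n by its flat crossings, recorded in order as
   pairs of strands ("chords"), together with the permutation of its strands:
   the virtual crossings can be moved and recombined at will.  Forgetting the
   positions of the strands, a braid becomes a chord word on a set of labels with
   a map [nx] giving the strand that follows a strand in the closure.  The moves
   of L-equivalence become the relations among the sigma_i, rotation of the word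
   (conjugation), and cutting a strand in two, with no, one or two new chords (the
   L-moves).  Renumbering the strands, i.e. conjugation by zeta_i, is obtained by
   inserting an empty strand with a virtual L-move and merging it into another.

   Each of these moves changes the closure by at most one Reidemeister move.
   Conversely, cut every strand between any two consecutive crossings.  Then the
   strands are the edges of the closure and all chords commute, so that the chord
   word depends only on the framed graph.  Moreover any set of chords can be
   gathered at the beginning of the word, where a Reidemeister move is realized
   by merging the strands of the loop, bigon or triangle: a loop is removed by a
   flat L-move, bigons by the relation sigma_i^2 = 1 and by threaded L-moves, and
   the coherently oriented triangle is reduced to the braid relation by means of
   bigons. *)

From mathcomp Require Import all_boot zify.
Require Import Defs.

Set Implicit Arguments.
Unset Strict Implicit.
Unset Printing Implicit Defensive.

(** Closures are built with [first_hit] and are hard to compare directly. A graph is therefore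
    related to a permutation of a finite set with marked points and a vertex number for each mark.
    These data determine the graph up to isomorphism, and unmarked points may be dropped as long as
    every cycle is still met, the permutation being replaced by its first-return map. Every
    comparison of two closures becomes a choice of such points. On the side of chord words the
    obstacle is order. A strand [s] and its successor [p s] can be merged only if all chords of [s]
    precede all chords of [p s]. Each arc of a bigon or of a triangle orders two of its vertices,
    and these orders decide which braid relation is available. Parallel arcs of a bigon can both be
    merged; of antiparallel arcs only one can, and the other has to be removed by a threaded move.
    The three arcs of a triangle agree with a linear order of its vertices unless the triangle is
    coherently oriented; in that case no order of the chords allows all three arcs to be merged, and
    the braid relation does not apply directly. *)

(** * Strand permutations and chord words of braid words *)

Definition pairmap2 (A B : Type) (f : A -> B) (c : A * A) : B * B := (f c.1, f c.2).

Definition in_fB (n : nat) (w : seq gen) := all (fun g => (idx g).+1 < n) w.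

(* [track w j] is the position at the top of the strand of [w] that ends in
   position [j] at the bottom. *)
Definition track (w : seq gen) (j : nat) : nat :=
  foldr (fun g k => swap_pos (idx g) k) j w.

(* A virtual crossing contributes a chord joining a strand to itself; keeping
   it makes chords and letters correspond one to one. *)
Definition gen_chord (g : gen) : nat * nat :=
  match g with Sig i => (i, i.+1) | Zet i => (i, i) end.

(* The crossings of [w] in order, strands being named by their top position. *)
Fixpoint chords (w : seq gen) : seq (nat * nat) :=
  if w is g :: w' then gen_chord g :: map (pairmap2 (swap_pos (idx g))) (chords w')
  else [::].

Definition nontriv (T : eqType) (l : seq (T * T)) := [seq c <- l | c.1 != c.2].

Lemma track_cat u v j : track (u ++ v) j = track u (track v j).
Proof. by rewrite /track foldr_cat. Qed.

Lemma map_pairmap2_comp (A B C : Type) (f : B -> C) (g : A -> B) l :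
  map (pairmap2 f) (map (pairmap2 g) l) = map (pairmap2 (f \o g)) l.
Proof. by rewrite -map_comp; apply: eq_map. Qed.

Lemma eq_pairmap2 (A B : Type) (f g : A -> B) : f =1 g -> pairmap2 f =1 pairmap2 g.
Proof. by move=> e c; rewrite /pairmap2 !e. Qed.

Lemma chords_cat u v : chords (u ++ v) = chords u ++ map (pairmap2 (track u)) (chords v).
Proof.
elim: u => [|g u IHu] /=; first by rewrite -[LHS]map_id; apply: eq_map; case.
by rewrite IHu map_cat map_pairmap2_comp.
Qed.

Lemma size_chords w : size (chords w) = size w.
Proof. by elim: w => //= g w IHw; rewrite size_map IHw. Qed.

Lemma nontriv_cat (T : eqType) (l l' : seq (T * T)) : nontriv (l ++ l') = nontriv l ++ nontriv l'.
Proof. exact: filter_cat. Qed.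

Lemma nontriv_map (T T' : eqType) (f : T -> T') l :
  injective f -> nontriv (map (pairmap2 f) l) = map (pairmap2 f) (nontriv l).
Proof.
move=> f_inj; rewrite /nontriv filter_map; congr map; apply: eq_filter => c /=.
by rewrite inj_eq.
Qed.

Lemma nontriv_id (T : eqType) (l : seq (T * T)) : nontriv (nontriv l) = nontriv l.
Proof. exact: filter_id. Qed.

Lemma swap_pos_inj i : injective (swap_pos i).
Proof. exact: can_inj (swap_posK i). Qed.

Lemma track_inj w : injective (track w).
Proof. by elim: w => //= g w IHw x y /swap_pos_inj /IHw. Qed.

Lemma track_revK w : cancel (track w) (track (rev w)).
Proof.
elim: w => //= g w IHw j; rewrite rev_cons -cats1 track_cat /= swap_posK.
exact: IHw.
Qed.

Lemma track_revVK w : cancel (track (rev w)) (track w).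
Proof. by rewrite -{2}[w]revK; apply: track_revK. Qed.

Lemma swap_pos_lt n i j : i.+1 < n -> (swap_pos i j < n) = (j < n).
Proof. by rewrite /swap_pos; do 2?case: eqP => [->|?]; lia. Qed.

Lemma track_lt n w j : in_fB n w -> (track w j < n) = (j < n).
Proof. by elim: w => //= g w IHw /andP[lt_g /IHw <-]; apply: swap_pos_lt. Qed.

Lemma swap_pos_id i j : i.+1 < j -> swap_pos i j = j.
Proof. by rewrite /swap_pos; do 2?case: eqP => [->|?]; lia. Qed.

Lemma track_id n w j : in_fB n w -> n <= j -> track w j = j.
Proof.
elim: w => //= g w IHw /andP[lt_g /IHw{}IHw] le_nj.
by rewrite IHw // swap_pos_id // (leq_trans lt_g).
Qed.

Lemma in_fB_cat n u v : in_fB n (u ++ v) = in_fB n u && in_fB n v.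
Proof. exact: all_cat. Qed.

Lemma in_fB_rev n w : in_fB n (rev w) = in_fB n w.
Proof. exact: all_rev. Qed.

(** * The word problem of the free braid group *)

Lemma fB_refl n w : fB_eq n w w.
Proof. exact: rst_refl. Qed.

Lemma fB_sym n w w' : fB_eq n w w' -> fB_eq n w' w.
Proof. exact: rst_sym. Qed.

Lemma fB_trans n w2 w1 w3 : fB_eq n w1 w2 -> fB_eq n w2 w3 -> fB_eq n w1 w3.
Proof. exact: rst_trans. Qed.

Lemma fB_ctx n u v w w' : fB_eq n w w' -> fB_eq n (u ++ w ++ v) (u ++ w' ++ v).
Proof.
elim=> [x y [u' v' l r lr]|x|x y _ IH|x y z _ IH1 _ IH2].
- by apply: rst_step; have := FBStep (u ++ u') (v' ++ v) lr; rewrite -!catA.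
- exact: rst_refl.
- exact: rst_sym.
exact: rst_trans IH2.
Qed.

Lemma fB_rel_eq n l r : fB_rel n l r -> fB_eq n l r.
Proof. by move=> lr; apply: rst_step; have := FBStep [::] [::] lr; rewrite !cats0. Qed.

Lemma fB_catl n u w w' : fB_eq n w w' -> fB_eq n (u ++ w) (u ++ w').
Proof. by move/(@fB_ctx n u [::]); rewrite !cats0. Qed.

Lemma fB_catr n v w w' : fB_eq n w w' -> fB_eq n (w ++ v) (w' ++ v).
Proof. exact: (@fB_ctx n [::] v). Qed.

Lemma fB_cons n g w w' : fB_eq n w w' -> fB_eq n (g :: w) (g :: w').
Proof. exact: (@fB_catl n [:: g]). Qed.

Lemma fB_revV n w : in_fB n w -> fB_eq n (rev w ++ w) [::].
Proof. by move=> ww; rewrite -{2}[w]revK; apply: fB_eqVr; rewrite all_rev. Qed.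

Lemma fB_revVK n w v : in_fB n w -> fB_eq n (rev w ++ w ++ v) v.
Proof. by move=> /fB_revV /(fB_catr v); rewrite -catA. Qed.

Lemma fB_revK n w v : in_fB n w -> fB_eq n (w ++ rev w ++ v) v.
Proof. by move=> /fB_eqVr /(fB_catr v); rewrite -catA. Qed.

Lemma fB_cancel n u w w' : in_fB n u -> fB_eq n (u ++ w) (u ++ w') -> fB_eq n w w'.
Proof.
move=> fu /(fB_catl (rev u)) h.
by apply: fB_trans (fB_sym (fB_revVK w fu)) (fB_trans h (fB_revVK w' fu)).
Qed.

(** * Words in the virtual crossings and the symmetric group *)

Definition zetas (s : seq nat) := map Zet s.

(** The letters [m.-1], ..., [k] in this order: the cycle that brings the strand from position [m]
    at the top to position [k] at the bottom. *)
Definition descent (m k : nat) : seq nat := rev (iota k (m - k)).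

Lemma descent_nil m : descent m m = [::].
Proof. by rewrite /descent subnn. Qed.

Lemma descent_cat m k l : l <= k <= m -> descent m l = descent m k ++ descent k l.
Proof.
case/andP=> lk km; rewrite /descent -rev_cat; congr rev.
by have -> : m - l = (k - l) + (m - k) by [lia]; rewrite iotaD subnKC.
Qed.

Lemma descent1 k : descent k.+1 k = [:: k].
Proof. by rewrite /descent subSnn. Qed.

Lemma mem_descent m k i : (i \in descent m k) = (k <= i < m).
Proof. by rewrite mem_rev mem_iota; case: (leqP k i) => //= ki; lia. Qed.

Lemma in_fB_zetas n s : in_fB n (zetas s) = all (fun i => i.+1 < n) s.
Proof. by rewrite /in_fB all_map. Qed.

Lemma zetas_cat s s' : zetas (s ++ s') = zetas s ++ zetas s'.
Proof. exact: map_cat. Qed.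

Lemma zetas_rev s : zetas (rev s) = rev (zetas s).
Proof. exact: map_rev. Qed.

Lemma swap_far i j k : far i j -> swap_pos i (swap_pos j k) = swap_pos j (swap_pos i k).
Proof. by rewrite /far /swap_pos; do 8?case: eqP; lia. Qed.

Lemma gen_far_eq n g h : far (idx g) (idx h) -> (idx g).+1 < n -> (idx h).+1 < n ->
  fB_eq n [:: g; h] [:: h; g].
Proof.
case: g h => i [] j /= far_ij hi hj; try by apply: fB_rel_eq; constructor.
by apply/fB_sym/fB_rel_eq; constructor => //; move: far_ij; rewrite /far orbC.
Qed.

Lemma gen_far_cat n g w : (idx g).+1 < n -> in_fB n w ->
  all (fun h => far (idx g) (idx h)) w -> fB_eq n (w ++ [:: g]) (g :: w).
Proof.
move=> hg; elim: w => [|h w IHw] /=; first by move=> _ _; apply: fB_refl.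
case/andP=> hh hw /andP[fgh fw]; apply: (fB_trans (fB_cons h (IHw hw fw))).
by apply: fB_sym; apply: (fB_ctx [::] w (gen_far_eq fgh hg hh)).
Qed.

Lemma descent_far n m k j : m < n -> j < m -> j.+1 < k ->
  fB_eq n (zetas (descent m k) ++ [:: Zet j]) (Zet j :: zetas (descent m k)).
Proof.
move=> mn jm jk; apply: gen_far_cat => /=; first by lia.
  by rewrite in_fB_zetas; apply/allP => i; rewrite mem_descent; lia.
by rewrite all_map; apply/allP => i; rewrite mem_descent /= /far; lia.
Qed.

Lemma descent_far_gt n k j : j.+2 < n -> k <= j ->
  fB_eq n (zetas (descent j k) ++ [:: Zet j.+1]) (Zet j.+1 :: zetas (descent j k)).
Proof.
move=> mn jm; apply: gen_far_cat => //=.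
  by rewrite in_fB_zetas; apply/allP => i; rewrite mem_descent; lia.
by rewrite all_map; apply/allP => i; rewrite mem_descent /= /far; lia.
Qed.

(* Coset representatives of the symmetric group on m points in the one on m.+1
   points. *)
Lemma zetas_nf n m s : m < n -> all (fun i => i < m) s ->
  exists s0 k, [/\ all (fun i => i.+1 < m) s0, k <= m &
    fB_eq n (zetas s) (zetas (s0 ++ descent m k))].
Proof.
move=> mn; elim/last_ind: s => [_|s j IHs].
  by exists [::], m; rewrite descent_nil; split=> //; apply: fB_refl.
rewrite all_rcons => /andP[jm /IHs[s0 [k [h0 km eqs]]]].
have {eqs}: fB_eq n (zetas (rcons s j)) (zetas s0 ++ zetas (descent m k) ++ [:: Zet j]).
  by rewrite -cats1 zetas_cat catA -(zetas_cat s0); apply: fB_catr.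
have [jk1|kj1|ek] := ltngtP j.+1 k.
- exists (rcons s0 j), k; split=> //; first by rewrite all_rcons h0 (leq_trans jk1).
  apply: (fB_trans H); rewrite -cats1 -catA !zetas_cat; apply: fB_catl.
  exact: descent_far.
- have [kj|jk|ekj] := ltngtP k j; last 1 first.
  + exists s0, j.+1; split=> //; apply: (fB_trans H); rewrite ekj zetas_cat; apply: fB_catl.
    rewrite (@descent_cat m j.+1 j) ?descent1; last lia.
    rewrite zetas_cat -catA /= -[X in fB_eq _ _ X]cats0; apply: fB_catl.
    by apply: fB_rel_eq; constructor; lia.
  (* The descent contains the letters [j] and [j.-1]; a braid relation carries the new letter
     through them, and it leaves the descent on the left as [j.-1]. *)
  + have [i ej] : exists i, j = i.+1 by exists j.-1; lia.
    exists (rcons s0 i), k; split=> //; first by rewrite all_rcons h0; lia.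
    apply: (fB_trans H); rewrite -cats1 -catA !zetas_cat; apply: fB_catl.
    rewrite (@descent_cat m j.+1 k) ?(@descent_cat j.+1 j k) ?(@descent_cat j i k); try lia.
    subst j.
    rewrite !descent1 !zetas_cat /= -!catA /=.
    apply: (@fB_trans _ (zetas (descent m i.+2) ++ [:: Zet i.+1; Zet i; Zet i.+1] ++ zetas (descent i k))).
      by apply: fB_catl; do 2 apply: fB_cons; apply: descent_far_gt; lia.
    apply: (@fB_trans _ (zetas (descent m i.+2) ++ [:: Zet i; Zet i.+1; Zet i] ++ zetas (descent i k))).
      by apply/fB_ctx/fB_sym/fB_rel_eq; constructor; lia.
    have := @descent_far n m i.+2 i mn; move/(_ ltac:(lia) ltac:(lia)).
    by move/(fB_catr ([:: Zet i.+1; Zet i] ++ zetas (descent i k))); rewrite -catA.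
  + by lia.
exists s0, j; split=> //; first by lia.
apply: (fB_trans H); rewrite (@descent_cat m k j) -?ek ?descent1 ?zetas_cat; last lia.
exact: fB_refl.
Qed.

Lemma swap_swap i j : swap_pos i (swap_pos i j) = j.
Proof. exact: swap_posK. Qed.

Variant swap_pos_spec i j : nat -> Prop :=
| SwapLeft of j = i : swap_pos_spec i j i.+1
| SwapRight of j = i.+1 : swap_pos_spec i j i
| SwapOut of j <> i & j <> i.+1 : swap_pos_spec i j j.

Lemma swap_posP i j : swap_pos_spec i j (swap_pos i j).
Proof. by rewrite /swap_pos; do 2?case: eqP => ?; constructor. Qed.

Lemma swap_braid i k : swap_pos i (swap_pos i.+1 (swap_pos i k)) =
  swap_pos i.+1 (swap_pos i (swap_pos i.+1 k)).
Proof. by do 6!case: swap_posP; lia. Qed.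

Lemma fB_track n w w' : fB_eq n w w' -> track w =1 track w'.
Proof.
elim=> [x y [u v l r lr] j|//|x y _ e j|x y z _ e1 _ e2 j]; last by rewrite e1.
  rewrite !track_cat; congr track; move: (track v j) => {u v}k.
  case: lr => [i h|i h|i h|i|i|i|i|i|i] //=; try (by move=> *; rewrite swap_far);
    by move=> _; rewrite ?swap_swap ?swap_braid.
by rewrite e.
Qed.

Lemma track_descent m k : k <= m -> track (zetas (descent m k)) k = m.
Proof.
move/subnK <-; elim: (m - k) => [|d IHd]; first by rewrite descent_nil.
rewrite (@descent_cat (d.+1 + k) (d + k) k); last lia.
by rewrite addSn descent1 zetas_cat track_cat IHd /= /swap_pos eqxx.
Qed.

Lemma in_fB_bound m s : all (fun i => i.+1 < m) s -> in_fB m (zetas s).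
Proof. by rewrite in_fB_zetas. Qed.

Lemma zetas_eq n s s' : in_fB n (zetas s) -> in_fB n (zetas s') ->
  track (zetas s) =1 track (zetas s') -> fB_eq n (zetas s) (zetas s').
Proof.
suff gen m : m <= n -> forall s s', in_fB m (zetas s) -> in_fB m (zetas s') ->
  track (zetas s) =1 track (zetas s') -> fB_eq n (zetas s) (zetas s') by apply: gen.
elim: m => [|m IHm] mn {}s {}s'; rewrite !in_fB_zetas.
  by case: s => //; case: s' => // *; apply: fB_refl.
move=> fs fs' ess'.
have nf u : all (fun i => i.+1 < m.+1) u -> exists u0 k, [/\ all (fun i => i.+1 < m) u0, k <= m,
    fB_eq n (zetas u) (zetas (u0 ++ descent m k)) & 
    track (zetas u) =1 track (zetas (u0 ++ descent m k))].
  move=> fu; have [u0 [k [h0 km e]]] := zetas_nf mn fu; exists u0, k; split=> // j.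
  exact: fB_track e j.
have [s0 [k [fs0 km es ts]]] := nf s fs.
have [s0' [k' [fs0' km' es' ts']]] := nf s' fs'.
have top u l : all (fun i => i.+1 < m) u -> l <= m ->
    track (zetas (u ++ descent m l)) l = m.
  by move=> fu lm; rewrite zetas_cat track_cat track_descent // (track_id (in_fB_bound fu)).
(* The coset is determined by the permutation: [k] is the bottom position of the strand that starts
   in position [m]. *)
have ek : k' = k.
  by apply: (@track_inj (zetas s)); rewrite {1}ess' ts ts' !top.
subst k'; apply: (fB_trans es); apply: fB_trans (fB_sym es').
rewrite !zetas_cat; apply: fB_catr; apply: IHm; rewrite ?in_fB_zetas //; first lia.
move=> j; have := ess' (track (rev (zetas (descent m k))) j).
by rewrite ts ts' !zetas_cat !track_cat !track_revVK.
Qed.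

(** A descent takes care of the position [k] with [p k = m], and induction applies to the rest. The
    lower bound on the letters serves [zetas_sig], where [lo = 2] makes all of them far from
    [Sig 0]. *)
Lemma zetas_gen lo m (p : nat -> nat) :
  injective p -> (forall j, m <= j -> p j = j) -> (forall j, j < lo -> p j = j) ->
  exists2 s, all (fun i => (lo <= i) && (i.+1 < m)) s & track (zetas s) =1 p.
Proof.
elim: m p => [|m IHm] p p_inj pm plo; first by exists [::] => // j; rewrite pm.
have [ml|lm] := ltnP m lo.
  by exists [::] => // j; case: (leqP lo j) => lj; rewrite ?(plo _ lj) ?(pm _ (leq_trans ml lj)).
have p_lt j : j < m.+1 -> p j < m.+1.
  move=> jm; rewrite ltnNge; apply/negP => mj.
  by have /p_inj e := pm _ mj; move: mj; rewrite e leqNgt jm.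
have [k km pk] : exists2 k, k <= m & p k = m.
  pose q (j : 'I_m.+1) := Ordinal (p_lt j (ltn_ord j)).
  have q_inj : injective q by move=> i j /(congr1 val) /p_inj /val_inj.
  exists (invF q_inj ord_max); first by rewrite -ltnS.
  by have /(congr1 val) := f_invF q_inj ord_max.
have lk : lo <= k by rewrite leqNgt; apply/negP => kl; have := plo _ kl; lia.
have [||j jlo|s fs es] := IHm (p \o track (rev (zetas (descent m k)))).
- by apply: inj_comp p_inj (@track_inj _).
- move=> j mj; have [->|nj] := eqVneq j m.
    by rewrite /= (canLR (@track_revK _) (esym (track_descent km))).
  have fd : in_fB m.+1 (rev (zetas (descent m k))).
    by rewrite in_fB_rev in_fB_zetas; apply/allP => i; rewrite mem_descent; lia.
  by rewrite /= (track_id fd) ?pm //; lia.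
- rewrite /= -zetas_rev; suff -> : track (zetas (rev (descent m k))) j = j by apply: plo.
  have : all (fun i => j < i) (rev (descent m k)).
    by rewrite all_rev; apply/allP => i; rewrite mem_descent; lia.
  by elim: (rev _) => //= i s IHs /andP[ji /IHs ->]; rewrite /swap_pos !ifN //; lia.
exists (s ++ descent m k); last first.
  by move=> j; rewrite zetas_cat track_cat es /= track_revK.
rewrite all_cat; apply/andP; split; first by apply: sub_all fs => i; lia.
by apply/allP => i; rewrite mem_descent; lia.
Qed.

(* Conjugating [Sig k] to [Sig 0] reduces the claim to a permutation that fixes
   0 and 1, which is a product of virtual crossings far from [Sig 0]. *)
Lemma zetas_sig n r k k' : in_fB n (zetas r) -> k.+1 < n -> k'.+1 < n ->
  track (zetas r) k' = k -> track (zetas r) k'.+1 = k.+1 ->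
  fB_eq n (zetas r ++ [:: Sig k']) (Sig k :: zetas r).
Proof.
have down l : l.+1 < n -> exists m, [/\ in_fB n (zetas m), track (zetas m) 0 = l,
    track (zetas m) 1 = l.+1 & fB_eq n (zetas m ++ [:: Sig 0]) (Sig l :: zetas m)].
  elim: l => [|l IHl] ln; first by exists [::]; split => //=; apply: fB_refl.
  have [m [fm m0 m1 em]] := IHl (ltnW ln).
  exists ([:: l; l.+1] ++ m); split.
  - by rewrite zetas_cat in_fB_cat fm /= andbT; lia.
  - by rewrite zetas_cat track_cat m0 /=; do 2!case: swap_posP; lia.
  - by rewrite zetas_cat track_cat m1 /=; do 2!case: swap_posP; lia.
  rewrite zetas_cat -catA; apply: fB_trans (fB_catl _ em) _.
  (* After multiplication by virtual letters on both sides this is the mixed relation [RelSZZ]. *)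
  suff e : fB_eq n [:: Zet l; Zet l.+1; Sig l] [:: Sig l.+1; Zet l; Zet l.+1].
    exact: (fB_catr (zetas m) e).
  have fz : in_fB n [:: Zet l.+1; Zet l] by rewrite /= andbT; lia.
  apply: (fB_cancel fz) => /=; apply: (@fB_trans _ [:: Sig l]).
    exact: (fB_revK [:: Sig l] fz).
  have := fB_ctx [::] [:: Zet l; Zet l.+1] (fB_rel_eq (RelSZZ ln)) => /= {}e.
  apply: fB_trans e; apply: fB_sym; rewrite -[X in fB_eq _ _ X]cats0.
  exact: (fB_catl [:: Sig l] (fB_revK [::] fz)).
move=> fr kn kn' rk rk1.
have [m [fm m0 m1 em]] := down k kn; have [m' [fm' m0' m1' em']] := down k' kn'.
have [||j j2|s fs es] := @zetas_gen 2 n (track (rev (zetas m) ++ zetas r ++ zetas m')).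
- exact: track_inj.
- by move=> j nj; rewrite (@track_id n) // !in_fB_cat in_fB_rev fm fr.
- have [->|->] : j = 0 \/ j = 1 by lia.
    by rewrite !track_cat m0' rk -m0 track_revK.
  by rewrite !track_cat m1' rk1 -m1 track_revK.
have fzs : in_fB n (zetas s) by rewrite in_fB_zetas; apply: sub_all fs => i; lia.
have er : fB_eq n (zetas r) (zetas (m ++ s ++ rev m')).
  apply: zetas_eq => //; first by rewrite !zetas_cat !in_fB_cat zetas_rev in_fB_rev fm fzs.
  by move=> j; rewrite !zetas_cat !track_cat es !track_cat zetas_rev !track_revVK.
apply: fB_trans (fB_catr _ er) _; apply: fB_trans (fB_cons _ (fB_sym er)).
rewrite !zetas_cat zetas_rev -!catA.
apply: (@fB_trans _ (zetas m ++ zetas s ++ [:: Sig 0] ++ rev (zetas m'))).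
  do 2!apply: fB_catl; apply: (fB_cancel fm').
  apply: fB_trans (fB_revK _ fm') _; rewrite catA.
  apply: fB_trans (fB_sym (fB_catr _ em')); apply: fB_sym.
  by rewrite -[X in fB_eq _ _ X]cats0; apply: (fB_catl [:: Sig k'] (fB_eqVr fm')).
rewrite -[Sig k :: _]/([:: Sig k] ++ _).
apply: (@fB_trans _ (zetas m ++ [:: Sig 0] ++ zetas s ++ rev (zetas m'))).
  apply: fB_catl; rewrite !catA; apply: fB_catr; apply: gen_far_cat; rewrite //=; first lia.
  by rewrite all_map; apply: sub_all fs => i /=; rewrite /far; lia.
by rewrite catA; have := fB_catr (zetas s ++ rev (zetas m')) em; rewrite -!catA.
Qed.

Lemma nontriv_zetas s : nontriv (chords (zetas s)) = [::].
Proof.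
elim: s => //= i s IHs; rewrite /nontriv /= eqxx /=.
by rewrite -/(nontriv _) nontriv_map ?IHs //; apply: swap_pos_inj.
Qed.

Lemma zetas_prefix w : (exists s, w = zetas s) \/ exists s k w', w = zetas s ++ Sig k :: w'.
Proof.
elim: w => [|[k|k] w [[s ->]|[s [l [w' ->]]]]]; first by left; exists [::].
- by right; exists [::], k, (zetas s).
- by right; exists [::], k, (zetas s ++ Sig l :: w').
- by left; exists (k :: s).
by right; exists (k :: s), l, w'.
Qed.

Lemma nontriv_zetas_sig s k w : nontriv (chords (zetas s ++ Sig k :: w)) =
  (track (zetas s) k, track (zetas s) k.+1) ::
  map (pairmap2 (track (zetas s ++ [:: Sig k]))) (nontriv (chords w)).
Proof.
rewrite chords_cat nontriv_cat nontriv_zetas /= nontriv_map; last exact: track_inj.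
rewrite /nontriv /= -/(nontriv _) ifT; last by rewrite (inj_eq (@track_inj _)) ltn_eqF.
rewrite /= -/(nontriv _) nontriv_map; last exact: swap_pos_inj.
by rewrite map_pairmap2_comp; congr cons; apply: eq_map; apply: eq_pairmap2 => j; rewrite track_cat.
Qed.

Lemma map_pairmap2_inj (A B : eqType) (f : A -> B) :
  injective f -> injective (map (pairmap2 f)).
Proof. by move=> f_inj; apply: inj_map => -[a b] [c d] [/f_inj -> /f_inj ->]. Qed.

(** Induction on the number of flat crossings. The first flat crossings of the two words join the
    same strands, so by [zetas_sig] the virtual word between their prefixes carries one to the
    other; the second word then gets the prefix of the first, which is cancelled. *)
Lemma fB_complete n w w' : in_fB n w -> in_fB n w' ->
  nontriv (chords w) = nontriv (chords w') -> track w =1 track w' -> fB_eq n w w'.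
Proof.
have [d] := ubnP (size (nontriv (chords w))); elim: d w w' => // d IHd w w' /ltnSE ltd fw fw' ec et.
case: (zetas_prefix w) => [[s ew]|[s [k [w1 ew]]]]; case: (zetas_prefix w') => [[s' ew']|[s' [k' [w1' ew']]]]; subst w w'.
- exact: zetas_eq.
- by move: ec; rewrite nontriv_zetas_sig nontriv_zetas.
- by move: ec; rewrite nontriv_zetas_sig nontriv_zetas.
move: (ec); rewrite !nontriv_zetas_sig => -[ek ek1 ech].
move: fw fw'; rewrite !in_fB_cat => /andP[fs /andP[/= kn fw1]] /andP[fs' /andP[/= kn' fw1']].
have fr : in_fB n (zetas (rev s ++ s')) by rewrite zetas_cat in_fB_cat zetas_rev in_fB_rev fs fs'.
have ers : fB_eq n (zetas s') (zetas s ++ zetas (rev s ++ s')).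
  by apply: fB_sym; rewrite zetas_cat zetas_rev; apply: fB_revK.
have eY : fB_eq n (zetas (rev s ++ s') ++ [:: Sig k']) (Sig k :: zetas (rev s ++ s')).
  by apply: zetas_sig => //; rewrite zetas_cat track_cat zetas_rev -?ek -?ek1 track_revK.
have eZ : fB_eq n (zetas s' ++ Sig k' :: w1') (zetas s ++ Sig k :: zetas (rev s ++ s') ++ w1').
  apply: fB_trans (fB_catr _ ers) _; rewrite -catA; apply: fB_catl.
  by have := fB_catr w1' eY; rewrite -catA.
apply: fB_trans (fB_sym eZ); apply: fB_catl; apply: fB_cons.
apply: IHd => //; last 1 first.
- move=> j; apply: (@track_inj (zetas s ++ [:: Sig k])); rewrite -!track_cat -!catA /=.
  by rewrite et; apply: (fB_track eZ).
- by move: ltd; rewrite nontriv_zetas_sig /= size_map.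
- by rewrite in_fB_cat fr.
apply: (@map_pairmap2_inj _ _ (track (zetas s ++ [:: Sig k]))); first exact: track_inj.
rewrite ech chords_cat nontriv_cat nontriv_zetas /= nontriv_map; last exact: track_inj.
rewrite map_pairmap2_comp; apply: eq_map; apply: eq_pairmap2 => j /=.
have /= := fB_track (fB_catl (zetas s) eY) j; rewrite -!track_cat -!catA /= => <-.
by rewrite !track_cat (fB_track ers) track_cat.
Qed.
(** * Chord words on a set of labels *)

Definition labeling (n : nat) (T : finType) (e : T -> nat) : Prop :=
  [/\ injective e, forall t, e t < n & #|T| = n].

(* The strands of [w] carry labels, [t] being at position [e t] at the top and
   at position [f t] at the bottom, and [l] lists the crossings. *)
Definition realizes (n : nat) (T : finType) (e : T -> nat) (l : seq (T * T))
    (f : T -> nat) (w : seq gen) : Prop :=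
  [/\ in_fB n w, nontriv (chords w) = map (pairmap2 e) (nontriv l)
    & forall t, track w (f t) = e t].

Lemma labeling_surj n (T : finType) (e : T -> nat) j :
  labeling n e -> j < n -> exists t, e t = j.
Proof.
case=> e_inj e_lt cardT jn.
pose g t := Ordinal (e_lt t).
have g_inj : injective g by move=> x y /(congr1 val) /e_inj.
have [|h gh hg] := inj_card_bij g_inj; first by rewrite card_ord cardT.
by exists (h (Ordinal jn)); have /(congr1 val) := hg (Ordinal jn).
Qed.

Lemma labeling_track n (T : finType) (e : T -> nat) w :
  in_fB n w -> labeling n e -> labeling n (track w \o e).
Proof.
move=> fw [e_inj e_lt cardT]; split=> //; first by apply: inj_comp e_inj; apply: track_inj.
by move=> t; rewrite /= track_lt.
Qed.

Lemma labeling_comp n (T T' : finType) (e : T -> nat) (f : T' -> T) :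
  bijective f -> labeling n e -> labeling n (e \o f).
Proof.
move=> f_bij [e_inj e_lt cardT]; split=> [|t|]; first exact: inj_comp e_inj (bij_inj f_bij).
  exact: e_lt.
by rewrite -cardT; apply: bij_eq_card f_bij.
Qed.

Lemma labeling_inj n (T : finType) (e : T -> nat) (p : T -> T) :
  injective p -> labeling n e -> labeling n (e \o p).
Proof. by move=> p_inj; apply: labeling_comp; apply: injF_bij. Qed.

(** The strands of a local picture are put in the first positions, so that relations and L-moves
    need to be performed only there. *)
Lemma labeling_ex (T : finType) (s : seq T) : uniq s ->
  exists2 e, labeling #|T| e & forall t, t \in s -> e t = index t s.
Proof.
move=> us; pose r := s ++ [seq t <- enum T | t \notin s].
have mr t : t \in r by rewrite mem_cat mem_filter mem_enum; case: (t \in s).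
have ur : uniq r.
  rewrite cat_uniq us filter_uniq ?enum_uniq // andbT /=.
  by apply/hasPn => t; rewrite mem_filter => /andP[].
have sr : size r = #|T|.
  by rewrite cardE; apply/perm_size/uniq_perm; rewrite ?enum_uniq // => t; rewrite mr mem_enum.
exists (index^~ r); last by move=> t ts; rewrite index_cat ts.
split=> //; last by move=> t; rewrite -sr index_mem.
by move=> x y exy; rewrite -(nth_index x (mr x)) exy nth_index.
Qed.

Lemma realizes_cat n (T : finType) (e f g : T -> nat) l l' w w' :
  realizes n e l f w -> realizes n f l' g w' -> realizes n e (l ++ l') g (w ++ w').
Proof.
move=> [fw cw tw] [fw' cw' tw']; split; first by rewrite in_fB_cat fw.
  rewrite chords_cat !nontriv_cat map_cat cw nontriv_map; last exact: track_inj.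
  by rewrite cw' map_pairmap2_comp; congr cat; apply: eq_map; apply: eq_pairmap2.
by move=> t; rewrite track_cat tw' tw.
Qed.

Lemma realizes_nontriv n (T : finType) (e f : T -> nat) l l' w :
  nontriv l = nontriv l' -> realizes n e l f w -> realizes n e l' f w.
Proof. by rewrite /realizes => ->. Qed.

Lemma realizes_comp n (T T' : finType) (e f : T -> nat) (h : T' -> T) l w :
  injective h -> realizes n e (map (pairmap2 h) l) f w -> realizes n (e \o h) l (f \o h) w.
Proof.
move=> h_inj [fw cw tw]; split=> //=.
by rewrite cw nontriv_map // map_pairmap2_comp.
Qed.

Lemma realizes_ext n (T : finType) (e e' f f' : T -> nat) l w :
  e =1 e' -> f =1 f' -> realizes n e l f w -> realizes n e' l f' w.
Proof.
move=> ee ef [fw cw tw]; split=> //; first by rewrite cw; apply: eq_map; apply: eq_pairmap2.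
by move=> t; rewrite -ef -ee.
Qed.

Lemma realizes_eq n (T : finType) (e f : T -> nat) l w w' : labeling n f ->
  realizes n e l f w -> realizes n e l f w' -> fB_eq n w w'.
Proof.
move=> lf [fw cw tw] [fw' cw' tw']; apply: fB_complete => //; first by rewrite cw cw'.
move=> j; have [nj|jn] := leqP n j; first by rewrite !(@track_id n).
by have [t <-] := labeling_surj lf jn; rewrite tw tw'.
Qed.

Lemma realizes_zetas n (T : finType) (e f : T -> nat) : labeling n e -> labeling n f ->
  exists s, realizes n e [::] f (zetas s).
Proof.
move=> [e_inj e_lt cardT] [f_inj f_lt _].
pose p j := if [pick t | f t == j] is Some t then e t else j.
have pf t : p (f t) = e t.
  by rewrite /p; case: pickP => [u /eqP /f_inj -> //|/(_ t)]; rewrite eqxx.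
have [||j //|s fs es] := @zetas_gen 0 n p.
- have le : labeling n e by []; have lf : labeling n f by [].
  have out j : ~~ (j < n) -> p j = j.
    by rewrite /p; case: pickP => // t /eqP <-; rewrite f_lt.
  move=> i j; have [/(labeling_surj lf)[t <-]|ni] := boolP (i < n);
    have [/(labeling_surj lf)[u <-]|nj] := boolP (j < n); rewrite ?pf ?(out _ ni) ?(out _ nj) //.
  + by move/e_inj ->.
  + by move=> eij; rewrite -eij e_lt in nj.
  + by move=> eij; rewrite eij e_lt in ni.
- by move=> j nj; rewrite /p; case: pickP => // t /eqP et; have := f_lt t; rewrite et ltnNge nj.
exists s; split; last by move=> t; rewrite es pf.
  by rewrite in_fB_zetas; apply: sub_all fs => i.
exact: nontriv_zetas.
Qed.

Lemma realizes_frag n (T : finType) (f : T -> nat) l w : in_fB n w ->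
  nontriv (chords w) = map (pairmap2 f) (nontriv l) -> realizes n f l (track (rev w) \o f) w.
Proof. by move=> fw cw; split=> // t /=; rewrite track_revVK. Qed.

Lemma labeling_frag n (T : finType) (f : T -> nat) w : in_fB n w ->
  labeling n f -> labeling n (track (rev w) \o f).
Proof. by move=> fw; apply: labeling_track; rewrite in_fB_rev. Qed.

(** Before each chord a virtual word brings its two strands to positions 0 and 1, where [Sig 0]
    realizes it. *)
Lemma realizes_ex n (T : finType) (e f : T -> nat) l : labeling n e -> labeling n f ->
  exists w, realizes n e l f w.
Proof.
move=> le lf; elim: l e le => [|[a b] l IHl] e le.
  by have [s rs] := realizes_zetas le lf; exists (zetas s).
have [eab|nab] := eqVneq a b.
  have [w rw] := IHl e le; exists w; apply: realizes_nontriv rw.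
  by rewrite /nontriv /= eab eqxx.
have [|g lg eg] := @labeling_ex T [:: a; b]; first by rewrite /= inE nab.
have {}lg : labeling n g by case: le lg => _ _ <-.
have ga : g a = 0 by rewrite eg ?inE ?eqxx //= eqxx.
have gb : g b = 1 by rewrite eg ?inE ?eqxx ?orbT //= (negPf nab) eqxx.
have n2 : 1 < n by case: lg => _ /(_ b); rewrite gb.
have [s rs] := realizes_zetas le lg.
have fS : in_fB n [:: Sig 0] by rewrite /= n2.
have [|w rw] := IHl (track (rev [:: Sig 0]) \o g); first exact: labeling_frag.
exists (zetas s ++ [:: Sig 0] ++ w).
apply: (realizes_cat rs); apply: (@realizes_cat _ _ _ _ _ [:: (a, b)]) rw.
by apply: realizes_frag => //; rewrite /nontriv /= nab /= /pairmap2 /= ga gb.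
Qed.

Lemma nontriv_cons (T : eqType) c (l : seq (T * T)) :
  nontriv (c :: l) = nontriv [:: c] ++ nontriv l.
Proof. by rewrite -nontriv_cat. Qed.

(** The new strand has only virtual crossings, so it adds no chord and merely renumbers the other
    strands; [bump k] is the numbering that leaves out position [k]. *)
Lemma virtual_strandP w k w' k' : virtual_strand w k w' k' ->
  [/\ track w' k' = k, forall j, track w' (bump k' j) = bump k (track w j)
    & nontriv (chords w') = map (pairmap2 (bump k)) (nontriv (chords w))].
Proof.
have binj k0 : injective (bump k0) by apply: can_inj (bumpK k0).
elim=> {w k w' k'} [k|w k w' k' _ [IH1 IH2 IH3]|w k w' k' _ [IH1 IH2 IH3]|g w k w' k' gk _ [IH1 IH2 IH3]|g w k w' k' gk _ [IH1 IH2 IH3]].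
- by split.
- split=> /= [|j|]; first by rewrite IH1; case: swap_posP; lia.
    by rewrite IH2; case: swap_posP; rewrite /bump; lia.
  rewrite eqxx /= nontriv_map ?IH3; last exact: swap_pos_inj.
  rewrite map_pairmap2_comp; apply: eq_map; apply: eq_pairmap2 => j /=.
  by case: swap_posP; rewrite /bump; lia.
- split=> /= [|j|]; first by rewrite IH1; case: swap_posP; lia.
    by rewrite IH2; case: swap_posP; rewrite /bump; lia.
  rewrite eqxx /= nontriv_map ?IH3; last exact: swap_pos_inj.
  rewrite map_pairmap2_comp; apply: eq_map; apply: eq_pairmap2 => j /=.
  by case: swap_posP; rewrite /bump; lia.
- have sb j : swap_pos (idx g) (bump k j) = bump k (swap_pos (idx g) j).
    by do 2!case: swap_posP; rewrite /bump; lia.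
  split=> [|j|]; [by rewrite /= IH1 swap_pos_id | by rewrite /= IH2 sb |].
  have eg : gen_chord g = pairmap2 (bump k) (gen_chord g).
    by case: g gk {sb} => i /= gk; rewrite /pairmap2 /= /bump; congr (_, _); lia.
  rewrite [chords _ in LHS]/= [chords _ in RHS]/= {1}eg.
  rewrite nontriv_cons [in RHS]nontriv_cons map_cat; congr cat.
    by rewrite -[[:: pairmap2 _ _]]/(map (pairmap2 (bump k)) [:: gen_chord g]) nontriv_map.
  rewrite !nontriv_map ?IH3; try exact: swap_pos_inj.
  by rewrite !map_pairmap2_comp; apply: eq_map; apply: eq_pairmap2.
have eidx : idx (shift_gen g) = (idx g).+1 by case: (g).
have sb j : swap_pos (idx g).+1 (bump k j) = bump k (swap_pos (idx g) j).
  by do 2!case: swap_posP; rewrite /bump; lia.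
split=> [|j|]; [by rewrite /= eidx IH1; case: swap_posP; lia | by rewrite /= eidx IH2 sb |].
have eg : gen_chord (shift_gen g) = pairmap2 (bump k) (gen_chord g).
  by case: g gk {sb eidx} => i /= gk; rewrite /pairmap2 /= /bump; congr (_, _); lia.
rewrite [chords _ in LHS]/= [chords _ in RHS]/= eg eidx nontriv_cons [in RHS]nontriv_cons map_cat; congr cat.
  by rewrite -[[:: pairmap2 _ _]]/(map (pairmap2 (bump k)) [:: gen_chord g]) nontriv_map.
rewrite !nontriv_map ?IH3; try exact: swap_pos_inj.
by rewrite !map_pairmap2_comp; apply: eq_map; apply: eq_pairmap2.
Qed.

Lemma virtual_strand_ex n w k q : in_fB n w -> k <= n -> q <= n ->
  exists2 w', virtual_strand w k w' q & in_fB n.+1 w'.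
Proof.
elim: w k => [|g w IHw] k.
  move=> _ kn qn; case: (leqP k q) => [kq|qk].
    have [d ed] : exists d, q = k + d by exists (q - k); lia.
    elim: d k ed {kq kn} => [|d IHd] k ed.
      by exists [::]; rewrite // ed addn0; constructor.
    have [|w' vw fw] := IHd k.+1; first lia.
    by exists (Zet k :: w'); [constructor | rewrite /= fw andbT; lia].
  have [d ed] : exists d, k = q + d by exists (k - q); lia.
  elim: d k ed kn {qk} => [|d IHd] k ed kn.
    by exists [::]; rewrite // ed addn0; constructor.
  rewrite addnS in ed; subst k; have [||w' vw fw] := IHd (q + d) => //; first lia.
  by exists (Zet (q + d) :: w'); [constructor | rewrite /= fw andbT; lia].
case/andP=> gn fw kn qn; have [gk|kg] := ltnP (idx g).+1 k.
  have [w' vw fw'] := IHw k fw kn qn.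
  by exists (g :: w'); [constructor | rewrite /= fw' andbT; lia].
have [kg'|gk] := leqP k (idx g).
  have [w' vw fw'] := IHw k fw kn qn.
  by exists (shift_gen g :: w'); [constructor | rewrite /= fw' andbT; case: g gn {kg kg'}].
(* The new strand stands between the two strands that cross, so it has to step to the left of both
   before the crossing. *)
have ek : k = (idx g).+1 by lia.
subst k; have [|w' vw fw'] := IHw (idx g) fw _ qn; first lia.
exists (Zet (idx g) :: shift_gen g :: w'); first by do 2!constructor.
by rewrite /= fw' andbT; case: g gn {kn kg gk vw} => i /=; lia.
Qed.

(* A braid up to renumbering of its strands: the strand [t] runs from top to
   bottom and continues, after the closing arc, as the strand [nx t].  Virtual
   crossings are not recorded. *)
Record data := Data {
  lab : finType;
  dchords : seq (lab * lab);
  nx : lab -> lab;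
  nx_inj : injective nx;
  lab_gt0 : 0 < #|lab| }.

Arguments nx : clear implicits.

(** * Braid moves realizing moves of chord words *)

Section Cut.
Variables (T : finType) (s : T).

(** The upper part of the cut strand keeps the name [Some s] and the lower part is called [None];
    hence the chords below the cut, and only these, are renamed. *)
Definition cut_lab (u : T) : option T := if u == s then None else Some u.

Definition cut_chords (l1 : seq (T * T)) (lc : seq (option T * option T)) (l2 : seq (T * T)) :=
  map (pairmap2 Some) l1 ++ lc ++ map (pairmap2 cut_lab) l2.

Definition cut_nx (p : T -> T) (x : option T) : option T :=
  if x is Some u then (if u == s then None else Some (p u)) else Some (p s).

Lemma cut_nx_inj p : injective p -> injective (cut_nx p).
Proof.
move=> p_inj [x|] [y|] //=; first case: (eqVneq x s) => [->|nx].
- by case: (eqVneq y s) => [->|].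
- by case: (eqVneq y s) => // _ [/p_inj ->].
- by case: (eqVneq x s) => // nx [/p_inj ex]; rewrite ex eqxx in nx.
by case: (eqVneq y s) => // ny [/p_inj ey]; rewrite ey eqxx in ny.
Qed.

Lemma cut_gt0 : 0 < #|{: option T}|.
Proof. by rewrite card_option. Qed.

(** Below the local picture of an L-move each part of the cut arc stands where the other part stood
    above it. *)
Definition cut_swap (x : option T) : option T :=
  if x is Some u then (if u == s then None else Some u) else Some s.

Lemma cut_swapK : involutive cut_swap.
Proof. by case=> [u|] /=; [case: (eqVneq u s) => [->|ns] //=; rewrite (negPf ns) | rewrite eqxx]. Qed.

(* The crossings that an L-move inserts, [Some s] and [None] being the upper
   and the lower part of the cut arc. *)
Inductive cut_local : seq (option T * option T) -> Prop :=
| CutVirtual : cut_local [::]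
| CutFlat : cut_local [:: (Some s, None)]
| CutThreaded t : t != s -> cut_local [:: (Some t, None); (Some s, Some t)].

Definition cut_top (k : nat) (e : T -> nat) (x : option T) : nat :=
  if x is Some u then bump k (e u) else k.

Lemma cut_top_labeling n k e : labeling n e -> k <= n -> labeling n.+1 (cut_top k e).
Proof.
move=> [e_inj e_lt cardT] kn; split; last by rewrite card_option cardT.
  move=> [x|] [y|] //=; [|by move: (neq_bump k (e x)) => /eqP nb eb; case: nb|by move=> eb; have := neq_bump k (e y); rewrite -eb eqxx].
  by move/(can_inj (bumpK k))/e_inj => ->.
by case=> [x|] /=; rewrite /bump; have := e_lt; [move/(_ x)|]; lia.
Qed.

(** The positions [f] at the level of the cut can be prescribed, so the local picture may be drawn
    wherever it is convenient; [realizes_ex] supplies the words above and below it. *)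
Lemma realizes_cut n k l1 lc l2 p e f loc :
  labeling n e -> injective p -> k <= n -> labeling n.+1 f ->
  realizes n.+1 f lc (f \o cut_swap) loc ->
  exists w1 w2 w1' w2', [/\ realizes n e (l1 ++ l2) (e \o p) (w1 ++ w2),
    virtual_strand w1 k w1' (f None), virtual_strand w2 (f None) w2' k &
    realizes n.+1 (cut_top k e) (cut_chords l1 lc l2)
       (cut_top k e \o cut_nx p) (w1' ++ loc ++ w2')].
Proof.
move=> le p_inj kn lf rloc; set q := f None.
have [e_inj e_lt cardT] := le; have [f_inj f_lt cardT'] := lf.
have qn : q <= n by have := f_lt None; rewrite -/q; lia.
(* The positions at the level of the cut before the new strand, which takes position [q], is
   inserted. *)
pose g u := unbump q (f (Some u)).
have gK u : bump q (g u) = f (Some u).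
  by rewrite unbumpKcond; case: eqVneq => // /f_inj.
have lg : labeling n g.
  split=> // [x y exy|x]; first by have /f_inj [] : f (Some x) = f (Some y) by rewrite -!gK exy.
  by have := f_lt (Some x); rewrite -gK /bump; have := gK x; rewrite /bump; lia.
have [w1 rw1] := realizes_ex l1 le lg.
have lep : labeling n (e \o p) by apply: labeling_inj.
have [w2 rw2] := realizes_ex l2 lg lep.
have [fw1 cw1 tw1] := rw1; have [fw2 cw2 tw2] := rw2.
have [w1' v1 fw1'] := virtual_strand_ex fw1 kn qn.
have [w2' v2 fw2'] := virtual_strand_ex fw2 qn kn.
exists w1, w2, w1', w2'; split=> //; first exact: realizes_cat rw1 rw2.
have [t1 t1' c1] := virtual_strandP v1; have [t2 t2' c2] := virtual_strandP v2.
apply: (@realizes_cat _ _ _ f); last apply: (realizes_cat rloc).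
- split=> // [|[u|]] //=.
    rewrite c1 cw1 nontriv_map; last by move=> x y [].
    by rewrite !map_pairmap2_comp.
  by rewrite -gK t1' tw1.
split=> // [|x].
  have cut_inj : injective cut_lab.
    by move=> x y; rewrite /cut_lab; case: (eqVneq x s) => [->|_]; case: (eqVneq y s) => [->|_] // [].
  rewrite c2 cw2 nontriv_map // !map_pairmap2_comp; apply: eq_map; apply: eq_pairmap2 => u /=.
  by rewrite gK /cut_lab; case: (eqVneq u s) => [->|ns] //=; rewrite (negPf ns).
case: x => [u|] /=; last by rewrite t2' (tw2 s) gK.
by case: (eqVneq u s) => [_|ns] /=; rewrite ?t2 // t2' (tw2 u) gK.
Qed.

(** The cut arc, the thread if there is one, and the new strand are put side by side from position 0
    on, and a right L-move is made there; any other strand [t] can serve as the thread. *)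
Lemma cut_local_word n lc : n = #|T| -> cut_local lc -> 
  exists f loc, [/\ labeling n.+1 f, realizes n.+1 f lc (f \o cut_swap) loc &
    forall (b : braid n) (b' : braid n.+1), L_move loc (f None) b b' ->
    braid_move (existT _ n b) (existT _ n.+1 b')].
Proof.
move=> -> [||t ts].
- have [|f] := @labeling_ex (option T) [:: Some s; None]; first by [].
  rewrite card_option => lf ef; have fs : f (Some s) = 0 by rewrite ef ?inE ?eqxx //= eqxx.
  have fN : f None = 1 by rewrite ef.
  have n0 : 0 < #|T| by apply/card_gt0P; exists s.
  exists f, [:: Zet 0]; split=> //; last by rewrite fN => b b'; apply: RightVirtualL.
  split=> //=; first by rewrite ltnS n0.
  move=> [u|] /=; last by rewrite fs fN.
  case: (eqVneq u s) => [->|ns]; first by rewrite fs fN.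
  have [f_inj _ _] := lf; case: swap_posP => //.
    by rewrite -fs => /f_inj [] /eqP; rewrite (negPf ns).
  by rewrite -fN => /f_inj.
- have [|f] := @labeling_ex (option T) [:: Some s; None]; first by [].
  rewrite card_option => lf ef; have fs : f (Some s) = 0 by rewrite ef ?inE ?eqxx //= eqxx.
  have fN : f None = 1 by rewrite ef.
  have n0 : 0 < #|T| by apply/card_gt0P; exists s.
  exists f, [:: Sig 0]; split=> //; last by rewrite fN => b b'; apply: RightFlatL.
  split=> //=; first by rewrite ltnS n0.
    by rewrite /nontriv /= /pairmap2 /= fs fN.
  move=> [u|] /=; last by rewrite fs fN.
  case: (eqVneq u s) => [->|ns]; first by rewrite fs fN.
  have [f_inj _ _] := lf; case: swap_posP => //.
    by rewrite -fs => /f_inj [] /eqP; rewrite (negPf ns).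
  by rewrite -fN => /f_inj.
have st : Some s != Some t by apply: contra ts => /eqP [->].
have [|f] := @labeling_ex (option T) [:: Some s; Some t; None].
  by rewrite /= !inE (negPf st).
rewrite card_option => lf ef; have fs : f (Some s) = 0 by rewrite ef ?inE ?eqxx //= eqxx.
have ft : f (Some t) = 1.
  by rewrite ef ?inE ?eqxx ?orbT //= (negPf st) eqxx.
have fN : f None = 2 by rewrite ef.
have n1 : 1 < #|T| by apply/card_gt1P; exists t, s.
exists f, [:: Sig 1; Zet 0; Sig 1]; split=> //; last by rewrite fN => b b'; apply: RightThreadedL.
split=> //=; first by rewrite !ltnS n1 ltnW.
  by rewrite /nontriv /= st /pairmap2 /= fs fN ft.
have [f_inj _ _] := lf.
move=> [u|] /=; last by rewrite fs fN.
case: (eqVneq u s) => [->|ns]; first by rewrite fs fN.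
case: (eqVneq u t) => [->|nt]; first by rewrite ft.
have u0 : f (Some u) <> 0 by rewrite -fs => /f_inj [] /eqP; rewrite (negPf ns).
have u1 : f (Some u) <> 1 by rewrite -ft => /f_inj [] /eqP; rewrite (negPf nt).
have u2 : f (Some u) <> 2 by rewrite -fN => /f_inj.
by rewrite !swap_pos_id //; lia.
Qed.

End Cut.

(** The closing arcs appear in the bottom positions: [t] ends where [nx D t] begins. *)
Definition braid_rep (n : nat) (b : braid n) (D : data) : Prop :=
  exists2 e : lab D -> nat, labeling n e & realizes n e (dchords D) (e \o nx D) b.

Definition cut_data (T : finType) (l1 l2 : seq (T * T)) (p : T -> T) (p_inj : injective p)
    (s : T) (lc : seq (option T * option T)) : data :=
  Data (cut_chords s l1 lc l2) (cut_nx_inj (s := s) p_inj) (cut_gt0 T).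

(** The traces of the relations of the free braid group on chords. Trivial chords are virtual
    crossings. A chord lists its left strand first, so [ChordFlip] is the relation between [Sig i]
    and [Zet i] at the same place. *)
Inductive chord_rel (T : eqType) : seq (T * T) -> seq (T * T) -> Prop :=
| ChordTriv a : chord_rel [:: (a, a)] [::]
| ChordFlip a b : chord_rel [:: (a, b)] [:: (b, a)]
| ChordSquare a b : chord_rel [:: (a, b); (a, b)] [::]
| ChordComm a b c d : uniq [:: a; b; c; d] ->
    chord_rel [:: (a, b); (c, d)] [:: (c, d); (a, b)]
| ChordTriangle a b c : uniq [:: a; b; c] ->
    chord_rel [:: (a, b); (a, c); (b, c)] [:: (b, c); (a, c); (a, b)].

(** In [DRot] the top chord passes backwards through the closing arcs, so that it joins [a] and [b]
    instead of their successors. *)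
Inductive dstep : data -> data -> Prop :=
| DIso (D D' : data) (f : lab D -> lab D') : bijective f ->
    dchords D' = map (pairmap2 f) (dchords D) -> (forall t, nx D' (f t) = f (nx D t)) ->
    dstep D D'
| DLocal (T : finType) u l l' v (p : T -> T) (p_inj : injective p) T0 : chord_rel l l' ->
    dstep (@Data T (u ++ l ++ v) p p_inj T0) (@Data T (u ++ l' ++ v) p p_inj T0)
| DRot (T : finType) a b l (p : T -> T) (p_inj : injective p) T0 :
    dstep (@Data T ((p a, p b) :: l) p p_inj T0) (@Data T (l ++ [:: (a, b)]) p p_inj T0)
| DCut (T : finType) l1 l2 (p : T -> T) (p_inj : injective p) T0 s lc : cut_local s lc ->
    dstep (@Data T (l1 ++ l2) p p_inj T0) (cut_data l1 l2 p_inj s lc).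

Definition deq : data -> data -> Prop := clos_refl_sym_trans data dstep.

Lemma L_sym n m (b : braid n) (b' : braid m) : L_equiv b b' -> L_equiv b' b.
Proof. exact: rst_sym. Qed.

Lemma L_trans n m k (b : braid m) (b1 : braid n) (b2 : braid k) :
  L_equiv b1 b -> L_equiv b b2 -> L_equiv b1 b2.
Proof. exact: rst_trans. Qed.

Lemma braid_ex n w : 0 < n -> in_fB n w -> exists b : braid n, bword b = w.
Proof. by move=> n0 fw; exists (@Braid n w (introT andP (conj n0 fw))). Qed.

Lemma L_iso n (b b' : braid n) : fB_eq n b b' -> L_equiv b b'.
Proof. by move=> e; apply: rst_step; apply: FreeBraidIsotopy. Qed.

Lemma L_realizes n (T : finType) (e f : T -> nat) l (b b' : braid n) : labeling n f ->
  realizes n e l f b -> realizes n e l f b' -> L_equiv b b'.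
Proof. by move=> lf rb rb'; apply: L_iso; apply: realizes_eq rb'. Qed.

Lemma labeling_n0 n (T : finType) (e : T -> nat) : labeling n e -> 0 < #|T| -> 0 < n.
Proof. by case=> _ _ ->. Qed.

Lemma L_cut n (T : finType) (s : T) k l1 lc l2 p e :
  injective p -> labeling n e -> k <= n -> cut_local s lc ->
  exists (b : braid n) (b' : braid n.+1), [/\ realizes n e (l1 ++ l2) (e \o p) b,
    realizes n.+1 (cut_top k e) (cut_chords s l1 lc l2) (cut_top k e \o cut_nx s p) b' &
    L_equiv b b'].
Proof.
move=> p_inj le kn hlc; have [_ _ cardT] := le.
have [f [loc [lf rloc mv]]] := cut_local_word (esym cardT) hlc.
have [w1 [w2 [w1' [w2' [rw v1 v2 rw']]]]] := realizes_cut l1 l2 le p_inj kn lf rloc.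
have [fw _ _] := rw; have [fw' _ _] := rw'.
have n0 : 0 < n by apply: (labeling_n0 le); apply/card_gt0P; exists s.
have [b eb] := braid_ex n0 fw; have [b' eb'] := braid_ex (ltn0Sn n) fw'.
exists b, b'; rewrite eb eb'; split=> //; apply: rst_step; apply: mv.
by exists w1, w2, w1', w2', k; rewrite -eb -eb'.
Qed.

(* A new empty strand is inserted just before the strand in position [i], which
   is then merged into it; this exchanges positions [i] and [i.+1]. *)
Lemma L_swap n i (T : finType) l p (e : T -> nat) (b b' : braid n) :
  injective p -> labeling n e -> i.+1 < n ->
  realizes n e l (e \o p) b ->
  realizes n (swap_pos i \o e) l ((swap_pos i \o e) \o p) b' -> L_equiv b b'.
Proof.
move=> p_inj le ni rb rb'.
have [q eq] := labeling_surj le (ltnW ni).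
have [s ps] : exists s, p s = q by exists (invF p_inj q); apply: f_invF.
have le' : labeling n (swap_pos i \o e).
  by apply: (@labeling_track _ _ e [:: Zet i]) => //=; rewrite ni.
(* The two cuts give the same picture. The first makes the lower part of [s] empty, in position
   [i.+2], with [q] in position [i]. The second makes the upper part of [q] empty, again in position
   [i.+2], and the lower part of [q] is in position [i]. *)
have [b1 [b2 [r1 r2 L12]]] := L_cut l [::] p_inj le (ni : i.+2 <= n) (CutVirtual s).
have [b1' [b2' [r1' r2' L12']]] := L_cut [::] l p_inj le' (ltnW (ltnW ni) : i <= n) (CutVirtual q).
rewrite cats0 in r1; have {r1} L1 := L_realizes (labeling_inj p_inj le) rb r1.
have {r1'} L1' := L_realizes (labeling_inj p_inj le') rb' r1'.
apply: (L_trans L1); apply: (L_trans L12); apply: L_sym; apply: (L_trans L1'); apply: (L_trans L12').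
pose h := cut_swap q.
have h_inj : injective h by apply: can_inj (@cut_swapK _ q).
have eh : cut_top i (swap_pos i \o e) \o h =1 cut_top i.+2 e.
  case=> [u|] /=; last by rewrite /= eq; case: swap_posP; rewrite /bump; lia.
  case: (eqVneq u q) => [->|nq] /=; first by rewrite eq /bump; lia.
  have ne : e u <> i by rewrite -eq; case: le => e_inj _ _ /e_inj euq; rewrite euq eqxx in nq.
  by case: swap_posP; rewrite /bump; lia.
have hp u : h (cut_nx s p u) = cut_nx q p (h u).
  rewrite /h; case: u => [u|] /=.
    case: (eqVneq u s) => [->|ns] /=.
      case: (eqVneq s q) => [esq|nsq] /=; first by rewrite -{2}esq ps.
      by rewrite (negPf nsq) ps.
    have npq : p u != q by rewrite -ps (inj_eq p_inj).
    rewrite (negPf npq); case: (eqVneq u q) => [->|nq] //=.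
    by rewrite (negPf nq).
  by rewrite ps !eqxx.
have lf : labeling n.+1 (cut_top i.+2 e) by apply: cut_top_labeling.
have {}r2' : realizes n.+1 (cut_top i.+2 e) (cut_chords s l [::] [::])
    (cut_top i.+2 e \o cut_nx s p) b2'.
  have ec : map (pairmap2 h) (cut_chords s l [::] [::]) = cut_chords q [::] [::] l.
    by rewrite /cut_chords /= cats0 map_pairmap2_comp; apply: eq_map; apply: eq_pairmap2.
  rewrite -ec in r2'; apply: realizes_ext (realizes_comp h_inj r2') => u; first exact: eh.
  by rewrite /= -hp; apply: eh.
apply: L_realizes r2' r2; apply: labeling_inj lf; exact: cut_nx_inj.
Qed.

(** Two labelings differ by a permutation of positions, and [L_swap] applies to the letters of a
    virtual word for it. *)
Lemma L_relabel n (T : finType) l p (e e' : T -> nat) (b b' : braid n) :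
  0 < #|T| -> injective p -> labeling n e -> labeling n e' ->
  realizes n e l (e \o p) b -> realizes n e' l (e' \o p) b' -> L_equiv b b'.
Proof.
move=> T0 p_inj le le'; have [s [fs _ es]] := realizes_zetas le' le.
elim: s e' b' le' fs es => [|i s IHs] e' b' le' fs es rb rb'.
  apply: (L_realizes (labeling_inj p_inj le) rb).
  by apply: realizes_ext rb' => t /=; rewrite -es.
move: fs => /andP[/= ni fs].
have lt : labeling n (track (zetas s) \o e) by apply: labeling_track.
have [w rw] := realizes_ex l lt (labeling_inj p_inj lt); have [fw _ _] := rw.
have [b1 eb1] := braid_ex (labeling_n0 le T0) fw.
rewrite -eb1 in rw.
apply: L_trans (IHs _ b1 lt fs _ rb rw) _ => //.
apply: (L_swap p_inj lt ni rw); apply: realizes_ext rb' => t /=; exact/esym/es.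
Qed.

Lemma L_rep D n m (b : braid n) (b' : braid m) :
  braid_rep b D -> braid_rep b' D -> L_equiv b b'.
Proof.
move=> [e le rb] [e' le' rb']; have [_ _ cardT] := le; have [_ _ cardT'] := le'.
have enm : n = m by [rewrite -cardT]; clear cardT cardT'; subst m.
exact: (L_relabel (lab_gt0 D) (@nx_inj D) le le' rb rb').
Qed.

Lemma braid_rep_ex D : exists n, exists b : braid n, braid_rep b D.
Proof.
have [e le _] := @labeling_ex (lab D) [::] isT.
have [w rw] := realizes_ex (dchords D) le (labeling_inj (@nx_inj D) le).
have [fw _ _] := rw; have [b eb] := braid_ex (lab_gt0 D) fw.
by exists _, b, e => //; rewrite eb.
Qed.

Lemma index_nth_eq (T : eqType) (f : T -> nat) (s : seq T) : uniq s ->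
  (forall t, t \in s -> f t = index t s) -> map f s = iota 0 (size s).
Proof.
move=> us es; case: s us es => // x s us es; apply: (@eq_from_nth _ 0); first by rewrite size_map size_iota.
move=> i; rewrite size_map => iz; rewrite (nth_map x) // nth_iota // es ?mem_nth //.
by rewrite index_uniq.
Qed.

Lemma chord_rel_words (T : finType) (l l' : seq (T * T)) : 0 < #|T| -> chord_rel l l' ->
  exists f f' w w', [/\ labeling #|T| f, labeling #|T| f', realizes #|T| f l f' w,
    realizes #|T| f l' f' w' & fB_eq #|T| w w'].
Proof.
move=> T0 ll'; set n := #|T|.
have trivial : nontriv l = nontriv l' -> exists f f' w w', [/\ labeling n f, labeling n f',
    realizes n f l f' w, realizes n f l' f' w' & fB_eq n w w'].
  move=> ell'; have [f lf _] := @labeling_ex T [::] isT.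
  have [w rw] := realizes_ex l lf lf; exists f, f, w, w; split=> //; last exact: fB_refl.
  exact: realizes_nontriv rw.
have main s w w' : uniq s -> in_fB (size s) w -> in_fB (size s) w' ->
    (forall m, size s <= m -> fB_eq m w w') ->
    (forall f, map f s = iota 0 (size s) -> nontriv (chords w) = map (pairmap2 f) (nontriv l)
      /\ nontriv (chords w') = map (pairmap2 f) (nontriv l')) ->
    exists f f' w w', [/\ labeling n f, labeling n f',
    realizes n f l f' w, realizes n f l' f' w' & fB_eq n w w'].
  move=> us fw fw' eww' cww'.
  have [f lf /(index_nth_eq us) /cww' [cw cw']] := labeling_ex us.
  have sn : size s <= n by rewrite -(card_uniqP us) max_card.
  have widen v : in_fB (size s) v -> in_fB n v by apply: sub_all => g gs; apply: leq_trans sn.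
  have [{}fw {}fw'] := (widen _ fw, widen _ fw').
  exists f, (track (rev w) \o f), w, w'; split=> //; first exact: labeling_frag.
  - exact: realizes_frag.
  - split=> // t; rewrite /= -(fB_track (eww' n sn)) track_revVK //.
  exact: eww'.
case: ll' trivial main => [a|a b|a b|a b c d uabcd|a b c uabc] trivial main.
- by apply: trivial; rewrite /nontriv /= eqxx.
- have [eab|nab] := eqVneq a b; first by apply: trivial; rewrite eab.
  (* A virtual crossing placed before [Sig 0] exchanges the left and the right strand of its
     chord. *)
  apply: (main [:: a; b] [:: Sig 0; Zet 0] [:: Zet 0; Sig 0]); rewrite //= ?inE ?nab //.
    by move=> m m2; apply: fB_rel_eq; constructor.
  by move=> f [fa fb]; rewrite /nontriv /= (eq_sym b a) nab /pairmap2 /= fa fb.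
- have [eab|nab] := eqVneq a b; first by apply: trivial; rewrite /nontriv /= eab eqxx.
  (* The word [Sig 0], [Sig 0] would have [(b, a)] as its second chord; the virtual crossings
     restore the order. *)
  apply: (main [:: a; b] [:: Sig 0; Zet 0; Sig 0; Zet 0] [::]); rewrite //= ?inE ?nab //.
    move=> m m2; apply: (@fB_trans _ [:: Sig 0; Sig 0]).
      have /(fB_ctx [:: Sig 0] [:: Zet 0]) := fB_rel_eq (RelSZ m2).
      move/fB_sym/fB_trans => /=; apply.
      by have /(fB_ctx [:: Sig 0; Sig 0] [::]) := fB_rel_eq (RelZ2 m2).
    exact: fB_rel_eq (RelS2 m2).
  by move=> f [fa fb]; rewrite /nontriv /= /pairmap2 /= fa fb.
- apply: (main [:: a; b; c; d] [:: Sig 0; Sig 2] [:: Sig 2; Sig 0]) => //.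
    by move=> m m4; apply: fB_rel_eq; apply: RelSS => //; apply: leq_trans m4.
  move=> f [fa fb fc fd]; move: uabcd; rewrite /= !inE !negb_or => /and4P[/and3P[ab _ _] _ cd _].
  by rewrite /nontriv /= ab cd /pairmap2 /= fa fb fc fd.
apply: (main [:: a; b; c] [:: Sig 0; Sig 1; Sig 0] [:: Sig 1; Sig 0; Sig 1]) => //.
  by move=> m m4; apply: fB_rel_eq; constructor.
move=> f [fa fb fc]; move: uabc; rewrite /= !inE !negb_or => /and3P[/andP[ab ac] bc _].
by rewrite /nontriv /= ab ac bc /pairmap2 /= fa fb fc.
Qed.

Lemma dstep_L D D' n m (b : braid n) (b' : braid m) :
  dstep D D' -> braid_rep b D -> braid_rep b' D' -> L_equiv b b'.
Proof.
move=> DD'; case: DD' b b' => {D D'}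
  [D D' f f_bij ec ep|T u l l' v p p_inj T0 ll'|T a b0 l p p_inj T0|T l1 l2 p p_inj T0 s lc hlc] b b' rb rb'.
- apply: L_rep rb _; case: rb' => e le rb'; exists (e \o f); first exact: labeling_comp.
  rewrite ec in rb'; apply: realizes_ext (realizes_comp (bij_inj f_bij) rb') => t //=.
  by rewrite ep.
- have [f [f' [w [w' [lf lf' rw rw' ww']]]]] := chord_rel_words T0 ll'.
  have lfp := labeling_inj p_inj lf.
  have [e le _] := @labeling_ex T [::] isT; have lep := labeling_inj p_inj le.
  have [w1 rw1] := realizes_ex u le lf; have [w2 rw2] := realizes_ex v lf' lep.
  have r1 := realizes_cat rw1 (realizes_cat rw rw2).
  have r1' := realizes_cat rw1 (realizes_cat rw' rw2).
  have [fw _ _] := r1; have [fw' _ _] := r1'.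
  have [b1 eb1] := braid_ex T0 fw; have [b1' eb1'] := braid_ex T0 fw'.
  apply: (@L_trans _ _ _ b1); first by apply: L_rep rb _; exists e; rewrite // eb1.
  apply: (@L_trans _ _ _ b1'); last by apply: L_rep rb'; exists e; rewrite // eb1'.
  by apply: L_iso; rewrite eb1 eb1'; apply: fB_ctx.
- have [eab|nab] := eqVneq a b0.
    apply: L_rep rb _; case: rb' => e le rb'; exists e => //; apply: realizes_nontriv rb'.
    by rewrite /= eab /nontriv /= !eqxx filter_cat /= eqxx cats0.
  (* With these strands in positions 0 and 1 at the top the chord is the first letter [Sig 0], and
     its strands [a] and [b0] end in the same positions at the bottom. *)
  have [|e le ee] := @labeling_ex T [:: p a; p b0]; first by rewrite /= inE (inj_eq p_inj) nab.
  have ea : e (p a) = 0 by rewrite ee ?inE ?eqxx //= eqxx.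
  have eb : e (p b0) = 1 by rewrite ee ?inE ?eqxx ?orbT //= (inj_eq p_inj) (negPf nab) eqxx.
  have n2 : 1 < #|T| by case: le => _ /(_ (p b0)); rewrite eb.
  have fS : in_fB #|T| [:: Sig 0] by rewrite /= n2.
  have le' : labeling #|T| (swap_pos 0 \o e) by apply: (labeling_track fS).
  have [w rw] := realizes_ex l le' (labeling_inj p_inj le).
  have rS : realizes #|T| e [:: (p a, p b0)] (swap_pos 0 \o e) [:: Sig 0].
    apply: (@realizes_frag _ _ e [:: (p a, p b0)] [:: Sig 0]) => //.
    by rewrite /nontriv /= (inj_eq p_inj) nab /= /pairmap2 /= ea eb.
  have rS' : realizes #|T| (e \o p) [:: (a, b0)] (swap_pos 0 \o (e \o p)) [:: Sig 0].
    apply: (@realizes_frag _ _ (e \o p) [:: (a, b0)] [:: Sig 0]) => //.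
    by rewrite /nontriv /= nab /= /pairmap2 /= ea eb.
  have r1 := realizes_cat rS rw; have r1' := realizes_cat rw rS'.
  have [fw _ _] := r1; have [fw' _ _] := r1'.
  have [b1 eb1] := braid_ex T0 fw; have [b1' eb1'] := braid_ex T0 fw'.
  apply: (@L_trans _ _ _ b1); first by apply: L_rep rb _; exists e; rewrite // eb1.
  apply: (@L_trans _ _ _ b1'); last first.
    by apply: L_rep rb'; exists (swap_pos 0 \o e); rewrite // eb1'.
  have fS1 : in_fB #|T| (Sig 0 :: rcons b1 (Sig 0)) by rewrite -cats1 /= in_fB_cat eb1 fw /= n2.
  have [b2 eb2] := braid_ex T0 fS1.
  (* Conjugation puts one more [Sig 0] before the first letter of [b1], and the two cancel. *)
  apply: (@L_trans _ _ _ b2); first by apply: rst_step; apply: (FlatConjugation n2).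
  apply: L_iso; rewrite eb2 eb1 eb1' -cats1.
  exact: (fB_catr (w ++ [:: Sig 0]) (fB_rel_eq (RelS2 n2))).
have [e le _] := @labeling_ex T [::] isT.
have [b1 [b1' [r1 r1' L1]]] := L_cut l1 l2 p_inj le (leqnn _) hlc.
apply: (@L_trans _ _ _ b1); first by apply: L_rep rb _; exists e.
apply: (L_trans L1); apply: L_rep rb'; exists (cut_top #|T| e) => //.
exact: cut_top_labeling.
Qed.

Lemma deq_L D D' n m (b : braid n) (b' : braid m) :
  deq D D' -> braid_rep b D -> braid_rep b' D' -> L_equiv b b'.
Proof.
move=> DD'; elim: DD' n m b b' => {D D'} [D D' s|D|D D' _ IH|D1 D2 D3 _ IH1 _ IH2] n m b b' rb rb'.
- exact: dstep_L s rb rb'.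
- exact: L_rep rb rb'.
- by apply: L_sym; apply: IH.
by have [k [b2 r2]] := braid_rep_ex D2; apply: L_trans (IH1 _ _ _ _ rb r2) (IH2 _ _ _ _ r2 rb').
Qed.
(** * Graphs of marked permutations *)

(** Cycles are matched rather than points: [psi] sends equal cycles to equal ones, distinct cycles
    to distinct ones, and meets each cycle of [a]. It is used to compare numbers of circles. *)
Lemma fcard_corr (X Z : finType) (f : X -> X) (g : Z -> Z) (a : pred X) (b : pred Z)
    (psi : Z -> X) : injective f -> injective g ->
  (forall x y, fconnect f x y -> a x -> a y) ->
  (forall x y, fconnect g x y -> b x -> b y) ->
  (forall z, b z -> a (psi z)) ->
  (forall x, a x -> exists2 z, b z & fconnect f x (psi z)) ->
  (forall z z', b z -> b z' -> fconnect g z z' = fconnect f (psi z) (psi z')) ->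
  fcard f a = fcard g b.
Proof.
move=> f_inj g_inj cla clb ab sur con; rewrite /n_comp_mem.
have symf := fconnect_sym f_inj; have symg := fconnect_sym g_inj.
pose h z := froot f (psi z).
have rootE x : x \in froots f -> froot f x = x by move/eqP.
have rootE' x : x \in froots g -> froot g x = x by move/eqP.
rewrite -(@card_in_image _ _ h [predI froots g & b]); last first.
  move=> z z' /andP[/rootE' rz bz] /andP[/rootE' rz' bz'] /(rootP symf).
  by rewrite -con // => /(rootP symg); rewrite rz rz'.
apply: eq_card => x; apply/idP/imageP => [|[z /andP[_ bz] ->]].
  case/andP=> /rootE rx ax; have [z bz xz] := sur x ax.
  exists (froot g z); first by apply/andP; split; [apply: roots_root | apply: clb bz; apply: connect_root].
  rewrite /h -rx; apply/(rootP symf); apply: connect_trans xz _.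
  by rewrite -con ?connect_root //; apply: clb bz; apply: connect_root.
apply/andP; split; first exact: roots_root.
by apply: (cla (psi z)); [apply: connect_root | apply: ab].
Qed.

Lemma fcard_split (X : finType) (f : X -> X) (a b : pred X) :
  (forall x, a x -> b x) -> fcard f b = fcard f a + fcard f [pred x | b x && ~~ a x].
Proof.
move=> ab; rewrite /n_comp_mem -(cardID a); congr (_ + _); apply: eq_card => x.
  by apply/andP/andP => -[]; [move=> /andP[? _] | move=> ? ax; split=> //; apply/andP; split=> //; apply: ab].
apply/andP/andP => -[]; first by move=> nax /andP[rx bx]; split=> //; apply/andP.
by move=> rx /andP[bx nax]; split=> //; apply/andP.
Qed.

(* [m] counts the points strictly between [x] and [y], all outside of [A]. *)
Definition reach (X : Type) (f : X -> X) (A : pred X) (x : X) (m : nat) (y : X) : Prop :=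
  iter m.+1 f x = y /\ forall i, i < m -> ~~ A (iter i.+1 f x).

Lemma iterSD (X : Type) (f : X -> X) i k x : iter i f (iter k.+1 f x) = iter (i + k).+1 f x.
Proof. by rewrite -iterD addnS. Qed.

Lemma reach_cat (X : Type) (f : X -> X) A x m y n z :
  reach f A x m y -> ~~ A y -> reach f A y n z -> reach f A x (m + n).+1 z.
Proof.
move=> [ey Ay] nAy [ez Az]; split.
  by rewrite -ez -ey -iterD; congr (iter _ f _); lia.
move=> i im; have [lt|gt|->] := ltngtP i m; [exact: Ay | | by rewrite ey].
have -> : i.+1 = (i - m.+1).+1 + m.+1 by lia.
by rewrite iterD ey; apply: Az; lia.
Qed.

Lemma reach_uniq (X : Type) (f : X -> X) (A : pred X) x m y n z :
  reach f A x m y -> reach f A x n z -> A y -> A z -> y = z.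
Proof.
move=> [ey Ay] [ez Az] hy hz; have [lt|gt|e] := ltngtP m n.
- by have := Az _ lt; rewrite ey hy.
- by have := Ay _ gt; rewrite ez hz.
by rewrite -ey e.
Qed.

(** * First-return maps and their cycles *)

Section Reduction.
Variables (X Y : finType) (f : X -> X) (g : Y -> Y) (h : Y -> X) (P : pred Y).
Hypothesis P_g : forall y, P y -> P (g y).
Hypothesis h_inj : {in P &, injective h}.
Hypothesis h_step : forall y, P y -> exists k, reach f [pred x | [exists z, P z && (h z == x)]] (h y) k (h (g y)).

(** Through [h], [g] is the first-return map of [f] to the image of [P]. All marks lie in this
    image, so a run of [f] between two of its points splits into steps of [g]. *)
Lemma reach_down (A : pred X) y m z : P y -> P z ->
  (forall x, A x -> exists2 z, P z & h z = x) ->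
  reach f A (h y) m (h z) -> exists j, reach g (fun z => A (h z)) y j z.
Proof.
move=> Py Pz HA; elim/ltn_ind: m y Py => m IHm y Py [ez Az].
have [k [ek Ak]] := h_step Py; have Pgy := P_g Py.
have [lt|gt|emk] := ltngtP m k.
- by have /existsP[] := Ak _ lt; exists z; rewrite Pz ez eqxx.
- have [||j [ej Aj]] := IHm (m - k.+1) _ (g y) Pgy; first by lia.
    split; first by rewrite -ek iterSD -ez; congr (iter _ f _); lia.
    by move=> i im; rewrite -ek iterSD; apply: Az; lia.
  exists j.+1; split; first by rewrite iterSr.
  case=> [|i] ij; last by rewrite iterSr; apply: Aj.
  by rewrite /= -ek; apply: Az.
exists 0; split=> //=; apply: h_inj => //; by rewrite -ek -emk.
Qed.

Lemma reach_up (A : pred X) y m : P y ->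
  (forall x, A x -> exists2 z, P z & h z = x) ->
  (forall i, i < m -> ~~ A (h (iter i.+1 g y))) ->
  exists j, reach f A (h y) j (h (iter m.+1 g y)).
Proof.
move=> Py HA; elim: m y Py => [|m IHm] y Py Am; have [k [ek Ak]] := h_step Py;
  have Ak' i : i < k -> ~~ A (iter i.+1 f (h y)) by
    [move/Ak; apply: contra => /HA[z Pz ez]; apply/existsP; exists z; rewrite Pz ez /=].
  by exists k.
have [|j rj] := IHm (g y) (P_g Py).
  by move=> i im; rewrite -iterSr; apply: Am.
exists (k + j).+1; rewrite iterSr; apply: reach_cat rj => //.
exact: (Am 0).
Qed.

Lemma h_connect y z : P y -> P z -> fconnect g y z = fconnect f (h y) (h z).
Proof.
move=> Py Pz; apply/idP/idP.
  case/connectP=> p; elim: p y Py => [|u p IHp] y Py /=; first by move=> _ ->.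
  case/andP=> /eqP eu pu ez; subst u.
  apply: connect_trans (IHp (g y) (P_g Py) pu ez).
  by have [k [<- _]] := h_step Py; apply: fconnect_iter.
move/iter_findex; case: findex => [|m] em.
  by rewrite (h_inj Py Pz em).
have [||j [<- _]] := @reach_down pred0 y m z Py Pz => //.
exact: fconnect_iter.
Qed.

End Reduction.

Definition no_mark (X : finType) (f : X -> X) (A : pred X) : pred X :=
  [pred x | [forall y, fconnect f x y ==> ~~ A y]].

Lemma no_mark_closed (X : finType) (f : X -> X) (A : pred X) x y : 
  fconnect f x y -> no_mark f A x -> no_mark f A y.
Proof.
move=> xy /forallP nx; apply/forallP => z; apply/implyP => yz.
by have := nx z; rewrite (connect_trans xy yz).
Qed.

(* [G] is obtained from the cycles of [f] by taking as vertices the levels [vx]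
   of the marked points; [psi h] is the point where the half-edge [h] starts. *)
Record graph_via (G : ograph) (X : finType) (f : X -> X) (A : pred X) (vx : X -> nat)
    (psi : half G -> X) : Prop := GraphVia {
  via_inj : {in out &, injective psi};
  via_mark : forall h, out h -> A (psi h);
  via_sur : forall x, A x -> exists2 h, out h & psi h = x;
  via_at : {in out &, forall h h', (atv h == atv h') = (vx (psi h) == vx (psi h'))};
  via_nxt : forall h, out h -> exists k, reach f A (psi h) k (psi (nxt h));
  via_circ : ncirc G = fcard f (no_mark f A) }.

Definition graph_sys (G : ograph) (X : finType) (f : X -> X) (A : pred X) (vx : X -> nat) :=
  exists psi : half G -> X, graph_via f A vx psi.

Lemma out_nxt (G : ograph) (h : half G) : out (nxt h) = out h.
Proof. by rewrite /nxt out_opp out_ed negbK. Qed.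

Lemma nxt_inj (G : ograph) : injective (@nxt G).
Proof. by apply: inj_comp; apply: can_inj; [apply: oppK | apply: edK]. Qed.

Lemma graph_sys_ext G (X : finType) (f : X -> X) (A A' : pred X) (vx vx' : X -> nat) :
  A =1 A' -> (forall x y, A x -> A y -> (vx x == vx y) = (vx' x == vx' y)) ->
  graph_sys G f A vx -> graph_sys G f A' vx'.
Proof.
move=> eA ev [psi [v1 v2 v3 v4 v5 v6]]; exists psi; split=> //.
- by move=> h /v2; rewrite eA.
- by move=> x; rewrite -eA; apply: v3.
- by move=> h h' oh oh'; rewrite v4 // ev // v2.
- move=> h /v5[k [ek Ak]]; exists k; split=> // i ik.
  by rewrite -eA Ak.
by rewrite v6; apply: eq_n_comp_r => x; apply: eq_forallb => y; rewrite eA.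
Qed.

Section ReduceSys.
Variables (X Y : finType) (f : X -> X) (g : Y -> Y) (h : Y -> X) (A : pred X) (vx : X -> nat).
Hypothesis f_inj : injective f.
Hypothesis g_inj : injective g.
Hypothesis h_inj : injective h.
Hypothesis h_mark : forall x, A x -> exists y, h y = x.
Hypothesis h_sur : forall x, exists y, fconnect f x (h y).
Hypothesis h_step : forall y, exists k, reach f [pred x | x \in codom h] (h y) k (h (g y)).

Let h_stepP y : predT y ->
  exists k, reach f [pred x | [exists z, predT z && (h z == x)]] (h y) k (h (g y)).
Proof.
move=> _; have [k [ek Ak]] := h_step y; exists k; split=> // i /Ak.
by apply: contra => /existsP[z /eqP <-]; apply: codom_f.
Qed.

Let h_markP x : A x -> exists2 z, predT z & h z = x.
Proof. by case/h_mark => y <-; exists y. Qed.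

Let h_con y z : fconnect g y z = fconnect f (h y) (h z).
Proof. by apply: (@h_connect _ _ f g h predT) => // x y' _ _ /h_inj. Qed.

Lemma reduce_circ : fcard f (no_mark f A) = fcard g (no_mark g (fun y => A (h y))).
Proof.
have eq_nm y : no_mark f A (h y) = no_mark g (fun y => A (h y)) y.
  apply/forallP/forallP => /= H z; apply/implyP.
    by rewrite h_con => yz; have := H (h z); rewrite yz.
  move=> yz; apply/negP => Az; have [u eu] := h_mark Az; subst z.
  by have := H u; rewrite h_con yz Az.
apply: (@fcard_corr _ _ f g _ _ h) => //.
- exact: no_mark_closed.
- exact: no_mark_closed.
- by move=> y; rewrite eq_nm.
move=> x nx; have [y xy] := h_sur x; exists y => //; rewrite -eq_nm.
exact: no_mark_closed xy nx.
Qed.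

(** The points may be thinned out to any set that contains all marks and meets every cycle of [f].
    The marks keep their cyclic succession, and the cycles without marks keep their number. *)
Lemma reduce_sys G : graph_sys G f A vx <-> graph_sys G g (fun y => A (h y)) (fun y => vx (h y)).
Proof.
have hin : {in predT &, injective h} by move=> x y' _ _ /h_inj.
split=> [[psi [v1 v2 v3 v4 v5 v6]]|[psi [v1 v2 v3 v4 v5 v6]]].
  have [psi' psi'E] : exists psi' : half G -> Y, forall x, out x -> h (psi' x) = psi x.
    apply: (@fin_all_exists _ (fun _ => Y) (fun x y => out x -> h y = psi x)) => x.
    have [ox|_] := boolP (out x); last by have [y _] := h_sur (psi x); exists y.
    by have [y <-] := h_mark (v2 _ ox); exists y.
  exists psi'; split=> //.
  - by move=> x y ox oy exy; apply: v1 => //; rewrite -!psi'E // exy.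
  - by move=> x ox; rewrite psi'E // v2.
  - by move=> y /v3[x ox exy]; exists x => //; apply: h_inj; rewrite psi'E.
  - by move=> x y ox oy; rewrite v4 // !psi'E.
  - move=> x ox; have [k rk] := v5 x ox.
    rewrite -!psi'E ?out_nxt // in rk.
    exact: (@reach_down _ _ f g h predT _ hin h_stepP A _ k).
  by rewrite v6 reduce_circ.
exists (h \o psi); split=> //=.
- by move=> x y ox oy /h_inj; apply: v1.
- by move=> x Ax; have [y ey] := h_mark Ax; subst x; have [z oz <-] := v3 _ Ax; exists z.
- move=> x ox; have [k [ek Ak]] := v5 x ox; rewrite -ek.
  exact: (@reach_up _ _ f g h predT).
by rewrite v6 reduce_circ.
Qed.

End ReduceSys.

(** * Erasing vertices *)

Lemma out_iter (G : ograph) k (h : half G) : out (iter k (@nxt G) h) = out h.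
Proof. by elim: k => //= k IHk; rewrite out_nxt. Qed.

Lemma edK' (G : ograph) : involutive (@ed G).
Proof. exact: edK. Qed.

Lemma oppK' (G : ograph) : involutive (@opp G).
Proof. exact: oppK. Qed.

Section Erase.
Variables (G G' : ograph) (X : finType) (f : X -> X) (A A' : pred X) (vx vx' : X -> nat).
Variables (psi : half G -> X) (psi' : half G' -> X).
Hypotheses (f_inj : injective f) (via : graph_via f A vx psi) (via' : graph_via f A' vx' psi').
Hypothesis subA : forall x, A' x -> A x.

(** Points are attached to outgoing half-edges only; an incoming half-edge is handled through its
    opposite, which lies at the same vertex. *)
Definition outward (H : ograph) (h : half H) := if out h then h else opp h.

Lemma out_outward (H : ograph) (h : half H) : out (outward h).
Proof. by rewrite /outward; case: ifP => // oh; rewrite out_opp oh. Qed.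

Lemma atv_outward (H : ograph) (h : half H) : atv (outward h) = atv h.
Proof. by rewrite /outward; case: ifP => // _; rewrite atv_opp. Qed.

Lemma outward_opp (H : ograph) (h : half H) : outward (opp h) = outward h.
Proof. by rewrite /outward out_opp; case: ifP => [/negPf|/negbFE] ->; rewrite ?oppK'. Qed.

Lemma outward_out (H : ograph) (h : half H) : out h -> outward h = h.
Proof. by rewrite /outward => ->. Qed.

Lemma outward_inj (H : ograph) (h h' : half H) : out h = out h' -> outward h = outward h' -> h = h'.
Proof. by rewrite /outward => ->; case: ifP => // _ /(can_inj (@oppK' H)). Qed.

Lemma psi_outward_inj (h1 h2 : half G) :
  out h1 = out h2 -> psi (outward h1) = psi (outward h2) -> h1 = h2.
Proof. by move=> eo /(via_inj via) e; apply: outward_inj => //; apply: e; apply: out_outward. Qed.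

Lemma psi'_outward_inj (h1 h2 : half G') :
  out h1 = out h2 -> psi' (outward h1) = psi' (outward h2) -> h1 = h2.
Proof. by move=> eo /(via_inj via') e; apply: outward_inj => //; apply: e; apply: out_outward. Qed.

Lemma erase_half : exists e : half G' -> half G,
  (forall h, out (e h) = out h) /\ (forall h, psi (outward (e h)) = psi' (outward h)).
Proof.
pose P (h : half G') (h0 : half G) := out h0 = out h /\ psi (outward h0) = psi' (outward h).
have [h|e eP] := @fin_all_exists _ (fun _ => half G) P.
  have [h0 o0 e0] := via_sur via (subA (via_mark via' (out_outward h))).
  exists (if out h then h0 else opp h0); rewrite /P -e0; case: ifP => oh.
    by rewrite o0 outward_out.
  by rewrite out_opp o0 outward_opp outward_out.
by exists e; split=> h; case: (eP h).
Qed.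

Variable e : half G' -> half G.
Hypothesis out_e : forall h, out (e h) = out h.
Hypothesis psi_e : forall h, psi (outward (e h)) = psi' (outward h).

Lemma erase_inj : injective e.
Proof.
move=> h h' ee; apply: psi'_outward_inj; first by rewrite -!out_e ee.
by rewrite -!psi_e ee.
Qed.

Lemma erase_opp h : e (opp h) = opp (e h).
Proof.
by apply: psi_outward_inj; [rewrite out_e !out_opp out_e | rewrite psi_e !outward_opp psi_e].
Qed.

Lemma erase_codom h : (h \in codom e) = A' (psi (outward h)).
Proof.
apply/codomP/idP => [[h' ->]|Ah].
  by rewrite psi_e; apply: (via_mark via'); apply: out_outward.
have [h' oh' eh'] := via_sur via' Ah.
exists (if out h then h' else opp h'); apply: psi_outward_inj.
  by rewrite out_e; case: ifP => _; rewrite ?out_opp oh'.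
by rewrite psi_e -eh'; case: ifP; rewrite ?outward_opp outward_out.
Qed.

Let A_im x : A x -> exists2 h, out h & psi h = x.
Proof. exact: via_sur via x. Qed.

Let step h : out h ->
  exists k, reach f [pred x | [exists z, out z && (psi z == x)]] (psi h) k (psi (nxt h)).
Proof.
move=> oh; have [k [ek Ak]] := via_nxt via oh; exists k; split=> // i /Ak.
by apply: contra => /existsP[z /andP[oz /eqP <-]]; apply: (via_mark via).
Qed.

Let Pnxt (h : half G) : out h -> out (nxt h).
Proof. by rewrite out_nxt. Qed.

Lemma erase_nxt h : out h -> exists k, e (nxt h) = iter k.+1 (@nxt G) (e h) /\
  forall i, i < k -> iter i.+1 (@nxt G) (e h) \notin codom e.
Proof.
move=> oh; have [k rk] := via_nxt via' oh.
have oe : out (e h) by rewrite out_e.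
have oen : out (e (nxt h)) by rewrite out_e out_nxt.
have A'im x : A' x -> exists2 h, out h & psi h = x by move/subA/A_im.
have ea u : out u -> psi (e u) = psi' u.
  by move=> ou; have := psi_e u; rewrite !outward_out ?out_e.
rewrite -!ea ?out_nxt // in rk.
have [j [ej Aj]] := reach_down Pnxt (via_inj via) step oe oen A'im rk.
exists j; split=> // i ij; rewrite erase_codom outward_out ?out_iter //.
exact: Aj.
Qed.

Lemma erase_ed h : exists k, e (ed h) = ed (iter k (@nxt G) (e h)) /\
  forall i, i < k -> ed (iter i (@nxt G) (e h)) \notin codom e.
Proof.
have codom_opp u : (opp u \in codom e) = (u \in codom e) by rewrite !erase_codom outward_opp.
case oh : (out h).
  have [k [ek Ak]] := erase_nxt oh; exists k; split.
    by apply: (can_inj (@oppK' G)); rewrite -erase_opp -[RHS]/(iter k.+1 (@nxt G) (e h)).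
  by move=> i /Ak; rewrite iterS {1}/nxt codom_opp.
(* From an incoming half-edge [nxt] runs against the orientation, so the run that starts at the
   other end of the edge is read in reverse. *)
have oh' : out (ed h) by rewrite out_ed oh.
have [k [ek Ak]] := erase_nxt oh'; set u := e (ed h) in ek Ak *.
have ek' : e h = ed (iter k (@nxt G) u).
  by apply: (can_inj (@oppK' G)); rewrite -erase_opp -[RHS]/(iter k.+1 (@nxt G) u) -ek /nxt edK'.
have back j : j <= k -> iter j (@nxt G) (e h) = ed (iter (k - j) (@nxt G) u).
  elim: j => [|j IHj] jk; first by rewrite subn0.
  have nb v : nxt (ed (nxt v)) = ed v :> half G by rewrite /nxt edK' oppK'.
  rewrite iterS IHj 1?ltnW //; have -> : k - j = (k - j.+1).+1 by lia.
  by rewrite iterS nb.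
exists k; split; first by rewrite back // subnn /= edK'.
move=> i ik; rewrite back 1?ltnW // edK'.
have -> : k - i = (k - i.+1).+1 by lia.
by apply: Ak; lia.
Qed.

(** A cycle without marks of [A'] either has no marks of [A], and is an old circle, or loses all its
    marks, and comes from a component that runs through erased vertices only. *)
Lemma erase_circ : ncirc G' = ncirc G +
  fcard (@nxt G) [pred h | out h && [forall h', fconnect (@nxt G) h h' ==> ~~ A' (psi h')]].
Proof.
have con h h' : out h -> out h' -> fconnect (@nxt G) h h' = fconnect f (psi h) (psi h').
  exact: (h_connect Pnxt (via_inj via) step).
have con_out h h' : fconnect (@nxt G) h h' -> out h = out h'.
  by move/iter_findex <-; rewrite out_iter.
rewrite (via_circ via') (via_circ via) (@fcard_split _ f (no_mark f A)); last first.
  move=> x /forallP nx; apply/forallP => y; apply/implyP => xy.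
  by have := nx y; rewrite xy; apply: contra => /subA.
congr addn.
apply: (@fcard_corr _ _ f (@nxt G) _ _ psi) => //; first exact: nxt_inj.
- move=> x y xy /andP[nx nAx]; rewrite /= (no_mark_closed xy nx) /=.
  apply: contra nAx; apply: no_mark_closed; by rewrite fconnect_sym.
- move=> h h' hh' /andP[oh /forallP nh]; rewrite /= -(con_out _ _ hh') oh /=.
  apply/forallP => h2; apply/implyP => hh2; have := nh h2.
  by rewrite (connect_trans hh' hh2).
- move=> h /andP[oh /forallP nh]; apply/andP; split.
    apply/forallP => x; apply/implyP => hx; apply/negP => A'x.
    have [h' oh' eh'] := A_im (subA A'x); have := nh h'.
    by rewrite con // eh' hx A'x.
  apply/negP => /forallP/(_ (psi h)); rewrite connect0 /=.
  by rewrite (via_mark via oh).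
- move=> x /andP[/forallP nx]; rewrite negb_forall => /existsP[y].
  rewrite negb_imply negbK => /andP[xy Ay]; have [h oh eh] := A_im Ay.
  exists h; last by rewrite eh.
  rewrite /= oh; apply/forallP => h'; apply/implyP => hh'.
  have oh' : out h' by rewrite -(con_out _ _ hh').
  have := nx (psi h'); rewrite (connect_trans xy) // -eh -con //.
by move=> h h' /andP[oh _] /andP[oh' _]; apply: con.
Qed.

End Erase.

Lemma atv_ex (G : framed4) (v : vert G) : exists h : half G, atv h = v.
Proof.
have : 0 < #|[set h | atv h == v]| by rewrite deg4.
by case/card_gt0P => h; rewrite inE => /eqP <-; exists h.
Qed.

Section ErasedVertices.
Variables (G G' : ograph) (X : finType) (f : X -> X) (A A' : pred X) (vx vx' : X -> nat).
Variables (psi : half G -> X) (psi' : half G' -> X) (S : {set vert G}).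
Hypotheses (f_inj : injective f) (via : graph_via f A vx psi) (via' : graph_via f A' vx' psi').
Hypothesis subA : forall x, A' x -> A x.
Hypothesis vx_eq : forall x y, A' x -> A' y -> (vx x == vx y) = (vx' x == vx' y).
Hypothesis S_A : forall h, out h -> (atv h \in S) = ~~ A' (psi h).

(** Erasing vertices amounts to forgetting marks on an unchanged permutation; this is how the first
    two Reidemeister moves are recognized. *)
Lemma graph_erased : erased S G'.
Proof.
have [e [out_e psi_e]] := erase_half via via' subA.
have eI := erase_inj via' out_e psi_e; have eO := erase_opp via out_e psi_e.
have eC := erase_codom via via' out_e psi_e.
have eE := erase_ed via via' subA out_e psi_e.
have eN := erase_circ f_inj via via' subA.
have S_codom h : (h \in codom e) = (atv h \notin S).
  by rewrite eC -atv_outward S_A ?negbK // out_outward.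
have at_eq h h' : (atv (e h) == atv (e h')) = (atv h == atv h').
  rewrite -!(atv_outward (e _)) -(atv_outward h) -(atv_outward h').
  rewrite (via_at via) ?inE ?(via_at via') ?inE ?out_outward //.
  all: try exact: out_outward.
  rewrite !psi_e; apply: vx_eq; apply: (via_mark via'); exact: out_outward.
(* The map on vertices is defined through a half-edge chosen at each vertex; [at_eq] makes the
   choice immaterial. *)
have [rep repP] : exists rep : vert G' -> half G', forall v, atv (rep v) = v.
  exact: (@fin_all_exists _ (fun _ => half G') (fun v h => atv h = v) (@atv_ex G')).
exists e, (fun v => atv (e (rep v))); split=> //.
- split=> //.
  + by move=> v v' /eqP; rewrite at_eq !repP => /eqP.
  + move=> v; apply/codomP/idP => [[v' ->]|]; rewrite inE -?S_codom ?codom_f // => vS.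
    have [h eh] := atv_ex v; subst v; move: vS; rewrite -S_codom => /codomP[h' ->].
    by exists (atv h'); apply/eqP; rewrite at_eq repP.
- by split=> // h; apply/eqP; rewrite at_eq repP.
- move=> h; have [k [ek Ak]] := eE h; exists k; split=> // i /Ak.
  by rewrite S_codom negbK.
rewrite eN; congr addn; apply: eq_n_comp_r => h; rewrite !inE; apply: andb_id2l => oh.
apply: eq_forallb => h'; case hh' : (fconnect _ _ _) => //=; rewrite S_A //.
by rewrite -(iter_findex hh') out_iter.
Qed.

End ErasedVertices.

(** In both graphs the edge at a half-edge is the run up to the first vertex outside [S], so the two
    lengths [k1] and [k2] agree. *)
Lemma erased_uniq (G G1 G2 : ograph) (S : {set vert G}) :
  erased S G1 -> erased S G2 -> ograph_iso G1 G2.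
Proof.
move=> [f1 [g1 [[f1I g1I f1C g1C] [ga1 fo1 out1] ed1 n1]]].
move=> [f2 [g2 [[f2I g2I f2C g2C] [ga2 fo2 out2] ed2 n2]]].
have [F FP] : exists F : half G1 -> half G2, forall h, f2 (F h) = f1 h.
  apply: (@fin_all_exists _ (fun _ => half G2) (fun h h' => f2 h' = f1 h)) => h.
  have : f1 h \in codom f2 by rewrite f2C -f1C codom_f.
  by case/codomP => h' ->; exists h'.
have [gg ggP] : exists gg : vert G1 -> vert G2, forall v, g2 (gg v) = g1 v.
  apply: (@fin_all_exists _ (fun _ => vert G2) (fun h h' => g2 h' = g1 h)) => h.
  have : g1 h \in codom g2 by rewrite g2C -g1C codom_f.
  by case/codomP => h' ->; exists h'.
exists F, gg; split.
- apply: inj_card_bij; first by move=> h h' e; apply: f1I; rewrite -!FP e.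
  rewrite -(card_codom f2I) -(card_codom f1I); apply/eq_leq/eq_card => h.
  by rewrite f1C f2C.
- apply: inj_card_bij; first by move=> h h' e; apply: g1I; rewrite -!ggP e.
  rewrite -(card_codom g2I) -(card_codom g1I); apply/eq_leq/eq_card => h.
  by rewrite g1C g2C.
- split=> h.
  + by apply: g2I; rewrite ggP ga2 FP ga1.
  + apply: f2I; rewrite FP; have [k1 [e1 S1]] := ed1 h; have [k2 [e2 S2]] := ed2 (F h).
    rewrite FP in e2 S2.
    have nS1 : atv (f1 (ed h)) \notin S by have := codom_f f1 (ed h); rewrite f1C.
    have nS2 : atv (f2 (ed (F h))) \notin S by have := codom_f f2 (ed (F h)); rewrite f2C.
    rewrite e1 e2; congr (ed (iter _ _ _)).
    case: (ltngtP k2 k1) => // [/S1|/S2].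
      by rewrite -e2 (negPf nS2).
    by rewrite -e1 (negPf nS1).
  + by apply: f2I; rewrite fo2 !FP fo1.
  by rewrite -out2 FP out1.
by rewrite n1 n2.
Qed.

(** With nothing to erase every run has length 0 and no component becomes a circle. Isomorphisms are
    thus a special case of erasing. *)
Lemma erased0_iso (G G' : ograph) : @erased G set0 G' -> ograph_iso G' G.
Proof.
move=> [f [g [[fI gI fC gC] [ga fo oo] ee nn]]]; exists f, g; split.
- apply: inj_card_bij => //; rewrite -(card_codom fI); apply/eq_leq/eq_card => h.
  by rewrite fC !inE.
- apply: inj_card_bij => //; rewrite -(card_codom gI); apply/eq_leq/eq_card => h.
  by rewrite gC !inE.
- split=> // h; have [[|k] [-> Sk]] := ee h => //.
  by have := Sk 0 isT; rewrite inE.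
rewrite nn [X in _ + X](_ : _ = 0) ?addn0 //.
rewrite /n_comp_mem eq_card0 // => h; rewrite !inE; apply/negP => /and3P[_ _ /forallP/(_ h)].
by rewrite connect0 inE.
Qed.

Lemma graph_sys_iso (G G' : ograph) (X : finType) (f : X -> X) (A : pred X) (vx : X -> nat) :
  injective f -> graph_sys G f A vx -> graph_sys G' f A vx -> ograph_iso G' G.
Proof.
move=> fI [psi v] [psi' v']; apply: erased0_iso.
by apply: (graph_erased fI v v') => // h oh; rewrite inE (via_mark v oh).
Qed.

Lemma ograph_iso_sym (G G' : ograph) : ograph_iso G G' -> ograph_iso G' G.
Proof.
move=> [f [g [[f' fK f'K] [g' gK g'K] [ha he ho hu] hn]]]; exists f', g'; split.
- by exists f.
- by exists g.
- split=> h.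
  + by apply: (can_inj gK); rewrite -ha f'K g'K.
  + by apply: (can_inj fK); rewrite -he !f'K.
  + by apply: (can_inj fK); rewrite -ho !f'K.
  by rewrite -hu f'K.
by rewrite hn.
Qed.

Lemma iso_graph_sys (G G' : ograph) (X : finType) (f : X -> X) (A : pred X) (vx : X -> nat) :
  ograph_iso G G' -> graph_sys G f A vx -> graph_sys G' f A vx.
Proof.
move/ograph_iso_sym => [F [g [Fb gb [ha he ho hu] hn]]] [psi [v1 v2 v3 v4 v5 v6]].
have [F' FK F'K] := Fb.
have nx h : nxt (F h) = F (nxt h) by rewrite /nxt he ho.
have ou h : (F h \in out) = (h \in out) by apply: hu.
exists (psi \o F); split=> /=.
- by move=> h h' oh oh' /v1 e; apply: (can_inj FK); apply: e; rewrite ou.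
- by move=> h oh; apply: v2; rewrite hu.
- by move=> x /v3[h oh <-]; exists (F' h); rewrite ?F'K // -hu F'K.
- move=> h h' oh oh'; rewrite -v4 ?ou // !ha; apply/esym/inj_eq/(bij_inj gb).
- by move=> h oh; rewrite -nx; apply: v5; rewrite hu.
by rewrite -hn.
Qed.
(** * Graphs of chord words *)

(* The closure of a chord word with [m] levels: the strand [t] is followed
   through the levels [0 .. m], then joined to the top of the strand [p t]. *)
Definition fall (m : nat) (T : finType) (p : T -> T) (x : 'I_m.+1 * T) : 'I_m.+1 * T :=
  (ordS x.1, if x.1 == m :> nat then p x.2 else x.2).

Lemma fall_inj m (T : finType) (p : T -> T) : injective p -> injective (@fall m T p).
Proof.
move=> p_inj x y e; have e1 : x.1 = y.1 by apply: (can_inj (@ordSK _)); exact: (congr1 fst e).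
have := congr1 snd e; rewrite /= e1; case: x y e1 {e} => [q t] [q' t'] /= -> .
by case: eqP => _ => [/p_inj|] ->.
Qed.

Lemma pair_eq_inord m (T : Type) (x y : 'I_m.+1 * T) : x.1 = y.1 :> nat -> x.2 = y.2 -> x = y.
Proof. by case: x y => [q t] [q' t'] /= /val_inj -> ->. Qed.

Lemma iter_fall m (T : finType) (p : T -> T) i (x : 'I_m.+1 * T) :
  x.1 + i <= m -> iter i (fall p) x = (inord (x.1 + i), x.2).
Proof.
elim: i => [|i IHi] xi; first by rewrite addn0 inord_val -surjective_pairing.
rewrite iterS IHi; last by lia.
apply: pair_eq_inord; rewrite /fall /= ?inordK; try lia.
  by rewrite modn_small; lia.
by case: eqP => //; lia.
Qed.

Lemma iter_fall_wrap m (T : finType) (p : T -> T) i (x : 'I_m.+1 * T) :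
  m < x.1 + i <= m.*2.+1 -> iter i (fall p) x = (inord (x.1 + i - m.+1), p x.2).
Proof.
move=> xi; have xm := ltn_ord x.1.
have -> : i = (x.1 + i - m.+1) + (m - x.1).+1 by lia.
rewrite iterD iterS (@iter_fall _ _ _ (m - x.1)) ?subnKC //; try lia.
have -> : fall p (inord m : 'I_m.+1, x.2) = (ord0, p x.2).
  by apply: pair_eq_inord; rewrite /fall /= inordK // ?modnn ?eqxx.
rewrite iter_fall /=; last by lia.
by congr (inord _, _); lia.
Qed.

Definition graph_lev (G : ograph) (m : nat) (T : finType) (p : T -> T)
    (A : nat -> T -> bool) (vx : nat -> T -> nat) : Prop :=
  graph_sys G (@fall m T p) (fun x => A x.1 x.2) (fun x => vx x.1 x.2).

Lemma graph_lev_ext G m (T : finType) (p : T -> T) (A A' : nat -> T -> bool) (vx vx' : nat -> T -> nat) :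
  (forall q t, q <= m -> A q t = A' q t) ->
  (forall q t q' t', q <= m -> q' <= m -> A q t -> A q' t' ->
     (vx q t == vx q' t') = (vx' q t == vx' q' t')) ->
  graph_lev G m p A vx <-> graph_lev G m p A' vx'.
Proof.
move=> eA ev; split; apply: graph_sys_ext => [[q t]|[q t] [q' t']] /=;
  have qm (r : 'I_m.+1) : r <= m by [rewrite -ltnS]; rewrite ?eA // => ? ?.
  by rewrite -ev // eA.
by rewrite ev // eA.
Qed.

(** The levels that are kept may differ from strand to strand; [lam t] enumerates those of [t] from
    top to bottom. *)
Lemma level_reduce G m m' (T : finType) (p : T -> T) (A : nat -> T -> bool) (vx : nat -> T -> nat) (lam : T -> nat -> nat) :
  injective p -> (forall t q, q <= m' -> lam t q <= m) ->
  (forall t q q', q < q' -> q' <= m' -> lam t q < lam t q') ->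
  (forall q t, q <= m -> A q t -> exists2 q', q' <= m' & lam t q' = q) ->
  graph_lev G m p A vx <->
  graph_lev G m' p (fun q t => A (lam t q) t) (fun q t => vx (lam t q) t).
Proof.
move=> p_inj lam_m lam_lt lam_A.
pose h (y : 'I_m'.+1 * T) : 'I_m.+1 * T := (inord (lam y.2 y.1), y.2).
have h1 y : (h y).1 = lam y.2 y.1 :> nat.
  by rewrite /h /= inordK // ltnS lam_m // -ltnS.
have lam_inj t q q' : q <= m' -> q' <= m' -> lam t q = lam t q' -> q = q'.
  move=> qm qm' e; case: (ltngtP q q') => // lt.
    by have := lam_lt t q q' lt qm'; rewrite e ltnn.
  by have := lam_lt t q' q lt qm; rewrite e ltnn.
have lam_le t q q' : lam t q < lam t q' -> q <= m' -> q' <= m' -> q < q'.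
  move=> lt qm qm'; case: (ltngtP q q') => // [gt|e]; last by rewrite e ltnn in lt.
  by have := lam_lt t q' q gt qm; lia.
(* The dropped points lie between two consecutive kept levels of a strand, after its last one or
   before its first one. *)
have gap1 y q t : (lam t q < y < lam t q.+1) -> q < m' -> forall z : 'I_m.+1 * T,
    z.1 = y :> nat -> z.2 = t -> z \notin codom h.
  move=> /andP[y1 y2] qm z z1 z2; apply/codomP => -[x ez].
  have ex : lam t x.1 = y by rewrite -z1 ez h1 -z2 ez.
  have xm : x.1 <= m' by rewrite -ltnS.
  have := lam_le t q x.1; have := lam_le t x.1 q.+1; rewrite ex; lia.
have gap2 y t : lam t m' < y -> forall z : 'I_m.+1 * T,
    z.1 = y :> nat -> z.2 = t -> z \notin codom h.
  move=> y1 z z1 z2; apply/codomP => -[x ez].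
  have ex : lam t x.1 = y by rewrite -z1 ez h1 -z2 ez.
  have xm : x.1 <= m' by rewrite -ltnS.
  have := lam_le t m' x.1; rewrite ex; lia.
have gap3 y t : y < lam t 0 -> forall z : 'I_m.+1 * T,
    z.1 = y :> nat -> z.2 = t -> z \notin codom h.
  move=> y1 z z1 z2; apply/codomP => -[x ez].
  have ex : lam t x.1 = y by rewrite -z1 ez h1 -z2 ez.
  have xm : x.1 <= m' by rewrite -ltnS.
  have := lam_le t x.1 0; rewrite ex; lia.
have hY (x : 'I_m'.+1 * T) : x.1 <= m' by rewrite -ltnS.
have hX (x : 'I_m.+1 * T) : x.1 <= m by rewrite -ltnS.
rewrite /graph_lev (@reduce_sys _ _ (@fall m T p) (@fall m' T p) h) //.
- have := @graph_lev_ext G m' T p (fun q t => A (inord (lam t q) : 'I_m.+1) t) (fun q t => A (lam t q) t)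
    (fun q t => vx (inord (lam t q) : 'I_m.+1) t) (fun q t => vx (lam t q) t).
  by apply => [q t qm|q t q' t' qm qm' _ _]; rewrite !inordK // ltnS lam_m.
- exact: fall_inj.
- exact: fall_inj.
- move=> x y e; apply: pair_eq_inord; last by have := congr1 snd e.
  have e2 : x.2 = y.2 by have := congr1 snd e.
  by have := congr1 (fun z => val z.1) e; rewrite /= !h1 -e2; apply: lam_inj.
- move=> x Ax; have [q' qm' eq] := lam_A _ _ (hX x) Ax.
  exists (inord q', x.2); apply: pair_eq_inord; rewrite // h1 /= inordK //.
- move=> [q t]; exists (ord0, p t).
  have qm : q <= m by rewrite -ltnS.
  have le0 := lam_m (p t) 0 isT.
  have <- : iter (m - q + (lam (p t) 0).+1) (fall p) (q, t) = h (ord0, p t).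
    rewrite iter_fall_wrap /=; last by lia.
    by apply: pair_eq_inord; rewrite // h1 /= inordK; lia.
  exact: fconnect_iter.
move=> [q t]; have qm := hY (q, t); have hy := lam_m t q qm.
have h1' : (h (q, t)).1 = lam t q :> nat by rewrite h1.
have le1 := lam_m (p t) 0 isT.
case: (ltngtP q m') qm => // [qm|eqm] /= _.
  have efy : fall p (q, t) = (inord q.+1, t).
    by rewrite -[LHS]/(iter 1 (fall p) (q, t)) iter_fall addn1.
  have lt1 := lam_lt t q q.+1 (ltnSn _) qm.
  have le2 := lam_m t q.+1 qm.
  exists (lam t q.+1 - lam t q).-1; split.
    rewrite iter_fall h1'; last by lia.
    apply: pair_eq_inord; rewrite ?efy ?h1 //= ?inordK ?ltnS //; lia.
  move=> i ik; rewrite iter_fall h1'; last by lia.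
  apply: (@gap1 (lam t q + i.+1) q t) => //; first by lia.
  by rewrite inordK; lia.
have efy : fall p (q, t) = (ord0, p t).
  rewrite -[LHS]/(iter 1 (fall p) (q, t)) iter_fall_wrap /= eqm; last by lia.
  by apply: pair_eq_inord => //=; rewrite addn1 subnn inordK.
rewrite eqm in hy h1'; exists (m - lam t m' + lam (p t) 0); split.
  rewrite iter_fall_wrap h1'; last by lia.
  by apply: pair_eq_inord; rewrite ?efy ?h1 //= ?inordK ?ltnS //; lia.
move=> i ik; case: (leqP (lam t m' + i.+1) m) => im.
  rewrite iter_fall h1' //; apply: (@gap2 (lam t m' + i.+1) t) => //; first by lia.
  by rewrite inordK; lia.
rewrite iter_fall_wrap h1'; last by lia.
apply: (@gap3 (lam t m' + i.+1 - m.+1) (p t)) => //; first by lia.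
by rewrite inordK; lia.
Qed.

(** Two words with the same crossings on different levels become comparable once every strand has
    lost a level at which it does not cross. *)
Lemma level_bump G m (T : finType) (p : T -> T) (A : nat -> T -> bool) (vx : nat -> T -> nat) (k : T -> nat) :
  injective p -> (forall t, k t <= m.+1) -> (forall t, ~~ A (k t) t) ->
  graph_lev G m.+1 p A vx <->
  graph_lev G m p (fun q t => A (bump (k t) q) t) (fun q t => vx (bump (k t) q) t).
Proof.
move=> p_inj km kA; apply: (@level_reduce G m.+1 m T p A vx (fun t => bump (k t))) => //.
- by move=> t q; rewrite /bump; lia.
- by move=> t q q'; rewrite /bump; lia.
move=> q t qm Aqt; have nq : q != k t by apply: contraTneq Aqt => ->.
by exists (unbump (k t) q); [have := km t; rewrite /unbump; lia | rewrite unbumpKcond (negPf nq)].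
Qed.

(* When every strand has a single level that may be marked, the levels can be
   forgotten. *)
Lemma level_single G m (T : finType) (p : T -> T) (A : nat -> T -> bool) (vx : nat -> T -> nat) (lev : T -> nat) :
  injective p -> (forall t, lev t <= m) -> (forall q t, q <= m -> A q t -> q = lev t) ->
  graph_lev G m p A vx <->
  graph_sys G p (fun t => A (lev t) t) (fun t => vx (lev t) t).
Proof.
move=> p_inj lev_m lev_A.
rewrite (@level_reduce G m 0 T p A vx (fun t q => lev t + q)) //; first last.
- by move=> q t qm /(lev_A _ _ qm) ->; exists 0; rewrite ?addn0.
- by move=> t q q'; lia.
- by move=> t q; rewrite leqn0 => /eqP ->; rewrite addn0.
rewrite /graph_lev (@reduce_sys _ _ (@fall 0 T p) p (fun t => (ord0, t))) //=.
- by split; apply: graph_sys_ext => [t|t t' _ _]; rewrite !addn0.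
- exact: fall_inj.
- by move=> t t' [].
- by move=> [q t] _; exists t; rewrite [q]ord1.
- by move=> [q t]; exists t; rewrite [q]ord1.
move=> t; exists 0; split=> //=; apply: pair_eq_inord => //=.
Qed.

(** The cycles are reparametrized by [fall] itself, which takes the last level of a strand to the
    top of its successor. *)
Lemma level_rot G m (T : finType) (p : T -> T) (A : nat -> T -> bool) (vx : nat -> T -> nat) : injective p ->
  graph_lev G m p A vx <->
  graph_lev G m p (fun q t => if q == m then A 0 (p t) else A q.+1 t)
                  (fun q t => if q == m then vx 0 (p t) else vx q.+1 t).
Proof.
move=> p_inj; have fI := @fall_inj m T p p_inj.
have fE (x : 'I_m.+1) : x.+1 %% m.+1 = if x == m :> nat then 0 else x.+1.
  by case: eqP => [->|nx]; rewrite ?modnn // modn_small //; have := ltn_ord x; lia.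
have bij (x : 'I_m.+1 * T) : exists y : 'I_m.+1 * T, fall p y = x by exists (invF fI x); apply: f_invF.
rewrite /graph_lev (@reduce_sys _ _ (@fall m T p) (@fall m T p) (@fall m T p)) //=.
- split; apply: graph_sys_ext => [x|x y _ _] /=; rewrite !fE.
  + by case: (x.1 =P m :> nat).
  + by case: (x.1 =P m :> nat); case: (y.1 =P m :> nat).
  + by case: (x.1 =P m :> nat).
  by case: (x.1 =P m :> nat); case: (y.1 =P m :> nat).
- by move=> x; exists x; apply: fconnect1.
by move=> y; exists 0.
Qed.

Section LevelCut.
Variables (m c : nat) (T : finType) (p : T -> T) (s : T).
Hypothesis p_inj : injective p.
Hypothesis cm : c <= m.

Definition cut_level (q : nat) (t : T) : option T :=
  if t == s then (if q < c then Some s else None) else Some t.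

(** Each part of the cut strand has its own [m.+1] levels; on the upper part those from [c] on are
    free of marks, on the lower part those before [c]. Without them the two parts fit together to
    one strand. *)
Lemma level_cut G (A : nat -> option T -> bool) (vx : nat -> option T -> nat) : (forall q, c <= q -> ~~ A q (Some s)) -> (forall q, q < c -> ~~ A q None) ->
  graph_lev G m (cut_nx s p) A vx <->
  graph_lev G m p (fun q t => A q (cut_level q t)) (fun q t => vx q (cut_level q t)).
Proof.
move=> As AN; pose h (y : 'I_m.+1 * T) : 'I_m.+1 * option T := (y.1, cut_level y.1 y.2).
have gapS (z : 'I_m.+1 * option T) : z.2 = Some s -> c <= z.1 -> z \notin codom h.
  move=> z2 zc; apply/codomP => -[x ez]; move: z2 zc; rewrite ez /= /cut_level.
  by case: (eqVneq x.2 s) => [_|ns [es]]; [case: ltnP | rewrite es eqxx in ns].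
have gapN (z : 'I_m.+1 * option T) : z.2 = None -> z.1 < c -> z \notin codom h.
  move=> z2 zc; apply/codomP => -[x ez]; move: z2 zc; rewrite ez /= /cut_level.
  by case: (eqVneq x.2 s) => // _; case: ltnP.
have hX (x : 'I_m.+1 * T) : x.1 <= m by rewrite -ltnS.
have hXo (x : 'I_m.+1 * option T) : x.1 <= m by rewrite -ltnS.
have p'_inj := @cut_nx_inj T s p p_inj.
have down_s (q : 'I_m.+1) : iter m.+1 (fall (cut_nx s p)) (q, Some s) = (q, None).
  have qm : q <= m by rewrite -ltnS.
  rewrite iter_fall_wrap /=; last by lia.
  by apply: pair_eq_inord; rewrite /= ?eqxx // inordK; lia.
have in_h (x : 'I_m.+1 * option T) : (x.2 = Some s -> x.1 < c) -> (x.2 = None -> c <= x.1) ->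
    exists y, h y = x.
  case: x => q [t|] /= h1 h2; last first.
    by exists (q, s); rewrite /h /= /cut_level eqxx ltnNge h2.
  exists (q, t); rewrite /h /= /cut_level; case: (eqVneq t s) => [es|] //.
  by rewrite h1 es.
rewrite /graph_lev (@reduce_sys _ _ (fall (cut_nx s p)) (@fall m T p) h) //.
- exact: fall_inj.
- exact: fall_inj.
- move=> x y e; have e1 : x.1 = y.1 := congr1 fst e.
  have := congr1 snd e; rewrite /= e1 /cut_level; case: x y e1 {e} => [q t] [q' t'] /= ->.
  case: (eqVneq t s) => [->|nt]; case: (eqVneq t' s) => [->|nt'] //; last by case=> ->.
    by case: ltnP => // _ [est]; rewrite est eqxx in nt'.
  by case: ltnP => // _ [est]; rewrite est eqxx in nt.
- move=> x Ax; apply: in_h => ex; rewrite ex in Ax.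
    by rewrite ltnNge; apply: contraTN Ax => /As.
  by rewrite leqNgt; apply: contraTN Ax => /AN.
- move=> [q [t|]].
    have [qc|cq] := boolP ((t == s) ==> (q < c)).
      have [||y ey] := in_h (q, Some t) => //=; last by exists y; rewrite ey.
      by case=> et; rewrite et eqxx in qc.
    move: cq; rewrite negb_imply -leqNgt => /andP[/eqP-> cq].
    have [||y ey] := in_h (q, None) => //; exists y; rewrite ey -down_s.
    exact: fconnect_iter.
  have [qc|cq] := ltnP q c; last by have [||y ey] := in_h (q, None) => //; exists y; rewrite ey.
  have [||y ey] := in_h (inord c, None) => //=; first by rewrite inordK.
  exists y; rewrite ey.
  have <- : iter (c - q) (fall (cut_nx s p)) (q, None) = (inord c, None).
    by rewrite iter_fall /= ?subnKC //; lia.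
  exact: fconnect_iter.
move=> [q t]; pose z := fall (cut_nx s p) (h (q, t)).
have [ez|[z2 z1 ehf]] : z = h (fall p (q, t)) \/
    [/\ z.2 = Some s, z.1 = c :> nat & h (fall p (q, t)) = (z.1, None)].
- rewrite /z /h /fall /= /cut_level /=.
  have qm : q <= m by rewrite -ltnS.
  have [eqm|nqm] := eqVneq (q : nat) m.
    rewrite eqm modnn; rewrite eqm in qm.
    have -> : (if t == s then if m < c then Some s else None else Some t) =
              (if t == s then None else Some t) by rewrite ltnNge cm.
    have -> : cut_nx s p (if t == s then None else Some t) = Some (p t).
      by case: (eqVneq t s) => [->|nt] //=; rewrite (negPf nt).
    case: (eqVneq (p t) s) => [ept|npt]; last by left.
    have [c0|c0] := posnP c; last by left; rewrite ept.
    by right; rewrite c0 ept.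
  rewrite modn_small; last by lia.
  case: (eqVneq t s) => [_|nt]; last by left.
  have [qc|cq] := ltnP q c; last by left; rewrite ifN // -leqNgt; lia.
  case: (ltngtP q.+1 c) qc => // [lt|ec] _; first by left.
  by right.
- by exists 0; split.
(* The points skipped are the levels from [c] to [m] of [Some s] and those from 0 to [c.-1] of
   [None]. *)
exists m.+1; rewrite ehf; split; first by rewrite iterSr -/z [z]surjective_pairing z2 down_s.
move=> i im; rewrite iterSr -/z; have [ci|ci] := leqP (c + i) m.
  by rewrite iter_fall z1 //; apply: gapS; [exact: z2 | rewrite inordK; lia].
rewrite iter_fall_wrap z1; last by lia.
by apply: gapN; [rewrite -[LHS]/(cut_nx s p z.2) z2 /= eqxx | rewrite inordK; lia].
Qed.

End LevelCut.

(** Trivial chords give no marks, since virtual crossings are not vertices. *)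
Definition on_chord (T : eqType) (c : T * T) (t : T) : bool :=
  (c.1 != c.2) && ((t == c.1) || (t == c.2)).

Definition mark_at (T : eqType) (l : seq (T * T)) (q : nat) (t : T) : bool :=
  if onth l q is Some c then on_chord c t else false.

(** The levels run from 0 to [size l], so that the last one carries no chord, as in [cpoint]. *)
Definition word_graph (G : ograph) (T : finType) (l : seq (T * T)) (p : T -> T) : Prop :=
  graph_lev G (size l) p (mark_at l) (fun q _ => q).

Definition data_graph (G : ograph) (D : data) : Prop := word_graph G (dchords D) (nx D).

Lemma mark_at_cat (T : eqType) (u v : seq (T * T)) q t :
  mark_at (u ++ v) q t = if q < size u then mark_at u q t else mark_at v (q - size u) t.
Proof. by rewrite /mark_at onth_cat; case: ifP. Qed.

Lemma mark_at_lt (T : eqType) (l : seq (T * T)) q t : mark_at l q t -> q < size l.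
Proof. by rewrite /mark_at -onthTE; case: onth. Qed.

Lemma mark_at_map (T T' : eqType) (f : T -> T') (l : seq (T * T)) q t :
  injective f -> mark_at (map (pairmap2 f) l) q (f t) = mark_at l q t.
Proof.
by move=> f_inj; rewrite /mark_at onth_map; case: onth => //= c; rewrite /on_chord /= !(inj_eq f_inj).
Qed.

Lemma mark_at_mid (T : eqType) (u w v : seq (T * T)) q t : mark_at (u ++ w ++ v) q t =
  if q < size u then mark_at u q t else if q - size u < size w then mark_at w (q - size u) t
  else mark_at v (q - size u - size w) t.
Proof. by rewrite !mark_at_cat. Qed.

Lemma bump_eq h i j : (bump h i == bump h j) = (i == j).
Proof. exact/inj_eq/(can_inj (bumpK h)). Qed.

Lemma word_graph_triv G (T : finType) u a v (p : T -> T) : injective p ->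
  word_graph G (u ++ [:: (a, a)] ++ v) p <-> word_graph G (u ++ v) p.
Proof.
move=> p_inj; rewrite /word_graph.
have -> : size (u ++ [:: (a, a)] ++ v) = (size (u ++ v)).+1 by rewrite !size_cat /=; lia.
rewrite (@level_bump _ _ _ _ _ _ (fun=> size u)) //; last first.
- by move=> t; rewrite mark_at_mid ltnn subnn /= /mark_at /on_chord /= eqxx.
- by move=> _; rewrite size_cat; lia.
apply: graph_lev_ext => [q t _|q t q' t' _ _ _ _]; last exact: bump_eq.
rewrite mark_at_mid mark_at_cat /bump; have [uq|qu] := leqP (size u) q; last by rewrite add0n qu.
by rewrite /= add1n !ifN -?leqNgt; [congr (mark_at v _ t) | |]; rewrite /=; lia.
Qed.

Lemma word_graph_flip G (T : finType) u a b v (p : T -> T) :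
  word_graph G (u ++ [:: (a, b)] ++ v) p <-> word_graph G (u ++ [:: (b, a)] ++ v) p.
Proof.
rewrite /word_graph !size_cat; apply: graph_lev_ext => // q t _.
rewrite !mark_at_mid /=; case: ifP => // _; case: ifP => //; case: (_ - _) => // _.
by rewrite /mark_at /on_chord /= eq_sym orbC.
Qed.

(** Every strand loses one of the two levels at which it does not cross. The same marks remain for
    both words, and the two vertices only exchange their numbers. *)
Lemma word_graph_comm G (T : finType) u a b c d v (p : T -> T) : injective p ->
  uniq [:: a; b; c; d] ->
  word_graph G (u ++ [:: (a, b); (c, d)] ++ v) p <->
  word_graph G (u ++ [:: (c, d); (a, b)] ++ v) p.
Proof.
move=> p_inj U; have /and4P[/and3P[ab ac ad] /andP[bc bd] cd _] :
  [&& [&& a != b, a != c & a != d], (b != c) && (b != d), c != d & true].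
  by move: U; rewrite /= !inE !negb_or.
pose m := size u + (size v).+1.
pose incd t := (t == c) || (t == d).
have inabF t : (t == a) || (t == b) -> incd t = false.
  by case/orP => /eqP ->; rewrite /incd; apply/norP.
have sm x y : size (u ++ [:: x; y] ++ v) = m.+1 by rewrite /m !size_cat /=; lia.
rewrite /word_graph !sm.
rewrite (@level_bump _ _ _ _ _ _ (fun t => size u + ~~ incd t)) //; last first.
- move=> t; rewrite mark_at_mid ltnNge leq_addr /= addKn.
  case icd : (incd t); rewrite /mark_at /= /on_chord /=; last by rewrite -/(incd t) icd andbF.
  by rewrite [X in _ && X](_ : _ = false) ?andbF //; apply/negP => /inabF; rewrite icd.
- by move=> t; rewrite /m; case: (~~ _) => /=; lia.
rewrite (@level_bump _ _ _ _ (mark_at (u ++ [:: (c, d); (a, b)] ++ v)) _ (fun t => size u + incd t)) //; last first.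
- move=> t; rewrite mark_at_mid ltnNge leq_addr /= addKn.
  case icd : (incd t); rewrite /mark_at /= /on_chord /=; last by rewrite -/(incd t) icd andbF.
  by rewrite [X in _ && X](_ : _ = false) ?andbF //; apply/negP => /inabF; rewrite icd.
- by move=> t; rewrite /m; case: (incd _) => /=; lia.
apply: graph_lev_ext => [q t _|q t q' t' _ _ _ _]; last first.
  by rewrite /bump; case: (incd t); case: (incd t') => /=; lia.
have [qu|uq] := ltnP q (size u).
  have bq (e : bool) : bump (size u + e) q = q by rewrite /bump; lia.
  by rewrite !bq !mark_at_mid qu.
have [uq'|qu] := ltnP (size u) q.
  have bq (e : bool) : bump (size u + e) q = q.+1 by rewrite /bump; lia.
  rewrite !bq !mark_at_mid; have -> : q.+1 < size u = false by lia.
  by have -> : q.+1 - size u = (q - size u).-1.+2 by lia.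
have -> : q = size u by lia.
have bq (e : bool) : bump (size u + e) (size u) = size u + ~~ e by case: e; rewrite /bump; lia.
by rewrite !bq !mark_at_mid negbK !ltnNge !leq_addr /= !addKn; case: (incd t).
Qed.

(** Once the unmarked last level is dropped from both words, they differ by [level_rot]. *)
Lemma word_graph_rot G (T : finType) a b l (p : T -> T) : injective p ->
  word_graph G ((p a, p b) :: l) p <-> word_graph G (l ++ [:: (a, b)]) p.
Proof.
move=> p_inj; rewrite /word_graph size_cat addn1 /=.
rewrite (@level_bump _ _ _ _ _ _ (fun=> (size l).+1)) //; last first.
  by move=> t; apply/negP => /mark_at_lt /=; rewrite ltnn.
rewrite (@level_bump _ _ _ _ (mark_at (l ++ _)) _ (fun=> (size l).+1)) //; last first.
  by move=> t; apply/negP => /mark_at_lt; rewrite size_cat addn1 ltnn.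
have bq q : q <= size l -> bump (size l).+1 q = q by rewrite /bump; lia.
rewrite level_rot //; apply: graph_lev_ext => [q t ql|q t q' t' ql ql' _ _].
  rewrite mark_at_cat; have [->|nq] := eqVneq q (size l).
    by rewrite !bq // ltnn subnn /mark_at /= /on_chord /= !(inj_eq p_inj).
  have ql1 : q < size l by lia.
  by rewrite !bq // ql1.
rewrite /bump; do 2![case: ifP => ?]; lia.
Qed.

Lemma word_graph_iso G (T T' : finType) (f : T -> T') l (p : T -> T) (p' : T' -> T') :
  bijective f -> injective p -> injective p' -> (forall t, p' (f t) = f (p t)) ->
  word_graph G (map (pairmap2 f) l) p' <-> word_graph G l p.
Proof.
move=> f_bij p_inj p'_inj fp; have f_inj := bij_inj f_bij; have [g fK gK] := f_bij.
rewrite /word_graph size_map /graph_lev.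
rewrite (@reduce_sys _ _ (fall p') (fall p) (fun x => (x.1, f x.2))).
- split; apply: graph_sys_ext => //= x; by rewrite mark_at_map.
- exact: fall_inj.
- exact: fall_inj.
- by move=> [q t] [q' t'] /= e; have /= -> := congr1 fst e; have /f_inj /= -> := congr1 snd e.
- by move=> [q t] _; exists (q, g t); rewrite /= gK.
- by move=> [q t]; exists (q, g t); rewrite /= gK.
by move=> [q t]; exists 0; split => //=; rewrite /fall /=; congr (_, _); case: ifP.
Qed.

Lemma word_graph_cut G (T : finType) s l1 l2 (p : T -> T) : injective p ->
  word_graph G (cut_chords s l1 [::] l2) (cut_nx s p) <-> word_graph G (l1 ++ l2) p.
Proof.
move=> p_inj; rewrite /word_graph /cut_chords /=.
have cl_inj : injective (cut_lab s).
  by move=> x y; rewrite /cut_lab; case: (eqVneq x s) => [->|_]; case: (eqVneq y s) => [->|_] // [].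
have -> : size ([seq pairmap2 Some i | i <- l1] ++ [seq pairmap2 (cut_lab s) i | i <- l2]) = size (l1 ++ l2).
  by rewrite !size_cat !size_map.
have mS q x : mark_at [seq pairmap2 Some i | i <- l1] q x = if x is Some t then mark_at l1 q t else false.
  case: x => [t|]; first by apply: mark_at_map => ? ? [].
  by rewrite /mark_at onth_map; case: onth => //= c; rewrite /on_chord /= andbF.
have mN q : mark_at [seq pairmap2 (cut_lab s) i | i <- l2] q (Some s) = false.
  rewrite /mark_at onth_map; case: onth => //= c; rewrite /on_chord /= /cut_lab.
  have ns x : (Some s == (if x == s then None else Some x)) = false.
    by case: (eqVneq x s) => // nx; apply: contraNF nx => /eqP[->].
  by rewrite !ns andbF.
rewrite (@level_cut (size (l1 ++ l2)) (size l1)) //; first last.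
- by move=> q ql; rewrite mark_at_cat size_map ql mS.
- by move=> q ql; rewrite mark_at_cat size_map ltnNge ql /= mN.
- by rewrite size_cat leq_addr.
apply: graph_lev_ext => [q t _|//].
rewrite !mark_at_cat size_map /cut_level; case: ltnP => ql; first by rewrite mS; case: eqVneq => [->|].
by rewrite -[if t == s then _ else _]/(cut_lab s t) mark_at_map.
Qed.

Lemma word_graph_nontriv G (T : finType) l (p : T -> T) : injective p ->
  word_graph G l p <-> word_graph G (nontriv l) p.
Proof.
move=> p_inj; suff gen u : word_graph G (u ++ l) p <-> word_graph G (u ++ nontriv l) p by apply: (gen [::]).
elim: l u => [|c l IHl] u //=.
have [ec|nc] /= := eqVneq c.1 c.2; last by have := IHl (rcons u c); rewrite -!cats1 -!catA.
rewrite -IHl; case: c ec => a b /= <-; exact: (word_graph_triv G u a l p_inj).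
Qed.

(** * Braid closures as graphs of chord words *)

Lemma chords_lt n w : in_fB n w -> all (fun c => (c.1 < n) && (c.2 < n)) (chords w).
Proof.
elim: w => //= g w IHw /andP[gn fw]; apply/andP; split; first by case: g gn => i /=; lia.
rewrite all_map; apply: sub_all (IHw fw) => c /= /andP[c1 c2].
by rewrite !swap_pos_lt // c1.
Qed.

Lemma onth_chords w q : onth (chords w) q =
  omap (fun g => pairmap2 (track (take q w)) (gen_chord g)) (onth w q).
Proof.
elim: w q => [|g w IHw] [|q] //=; first by case: (gen_chord g).
by rewrite onth_map IHw; case: onth.
Qed.

Lemma labeled_chords n (T : finType) (e : T -> nat) l : labeling n e ->
  all (fun c => (c.1 < n) && (c.2 < n)) l -> exists l', l = map (pairmap2 e) l'.
Proof.
move=> le; elim: l => [|[a b] l IHl] /=; first by exists [::].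
case/andP=> /andP[/(labeling_surj le)[t <-] /(labeling_surj le)[u <-]] /IHl[l' ->].
by exists ((t, u) :: l').
Qed.

(** The outgoing half-edges of the closure are its flat points, and [first_hit] is a run of [down]
    to the next flat point. *)
Lemma closure_sys n (b : braid n) :
  graph_sys (braid_closure b) (@down n b) (flat_point (b := b)) (fun x => x.1 : nat).
Proof.
have dI : injective (@down n b) by apply: can_inj (@downK n b).
exists (fun h : chalf b => val h.1); split=> /=.
- by move=> [x a] [y c] /=; rewrite !unfold_in /= => -> -> /val_inj ->.
- by move=> [x a] _; apply: valP.
- by move=> x Ax; exists (Sub x Ax, true); rewrite ?SubK.
- by move=> [x a] [y c] _ _; rewrite -val_eqE.
- move=> [x a] /= ->; rewrite /nxt /= /copp /ced /= val_insubd first_hit_in ?(valP x) //.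
  have [k [-> _ Ak]] := first_hitP dI (valP x); by exists k.
by [].
Qed.

Lemma closure_data_graph n (b : braid n) D : braid_rep b D -> data_graph (braid_closure b) D.
Proof.
case: D => T l p p_inj T0 [e /= le [fw cw tw]]; set w := bword b in fw cw tw.
have [e_inj e_lt cardT] := le.
(* [l'] has a chord for every letter, the virtual ones included, so that its levels are those of the
   word; [l] agrees with it only up to trivial chords. *)
have [l' el'] := labeled_chords le (chords_lt fw).
have enl : nontriv l' = nontriv l.
  by apply: (map_pairmap2_inj e_inj); rewrite -cw el' nontriv_map.
rewrite /data_graph /= word_graph_nontriv // -enl -word_graph_nontriv //.
have sl' : size l' = size w by rewrite -(size_map (pairmap2 e)) -el' size_chords.
rewrite /word_graph sl' /graph_lev.
have tlt q t : track (rev (take q w)) (e t) < n.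
  rewrite track_lt ?e_lt // in_fB_rev.
  by move: fw; rewrite -{1}(cat_take_drop q w) in_fB_cat => /andP[].
(* The position of the strand [t] just above the crossing [q]. *)
pose h (x : 'I_(size w).+1 * T) : cpoint b := (x.1, Ordinal (tlt x.1 x.2)).
have h_inj : injective h.
  move=> [q t] [q' t'] eh; have eq : q = q' := congr1 fst eh; subst q'.
  by have /(congr1 val) /= /track_inj /e_inj -> := congr1 snd eh.
have h_bij : bijective h.
  by apply: inj_card_bij h_inj _; rewrite !card_prod !card_ord cardT.
have [g hK gK] := h_bij.
have dI : injective (@down n b) by apply: can_inj (@downK n b).
have h_down x : h (fall p x) = down (h x).
  case: x => q t; have qw : q <= size w by rewrite -ltnS.
  apply/eqP; rewrite xpair_eqE eqxx /=; apply/eqP/val_inj => /=.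
  rewrite /cross -/w; have [lt|ge|eqw] := ltngtP q (size w); [|by rewrite ltnNge qw in ge|].
    have [d ed] : exists d, onth w q = Some d.
      by move: lt; rewrite -onthTE; case: onth => // d _; exists d.
    rewrite ed modn_small ?ltnS // (take_nth d) // rev_rcons /= (onth_nth d _ _ _ ed).
    have dn : (idx d).+1 < n by have /(all_nthP d)/(_ q lt) := fw; rewrite (onth_nth d _ _ _ ed).
    by rewrite val_insubd swap_pos_lt // tlt.
  rewrite eqw modnn take0 /= onth_default // /= take_size.
  by rewrite -(tw t) track_revK.
have h_mark x : flat_point (h x) = mark_at l' x.1 x.2.
  case: x => q t; rewrite /flat_point /mark_at /= -/w.
  have := onth_chords w q; rewrite el' onth_map; case: (onth w q) => [d|]; last by case: onth.
  case: (onth l' q) => //= -[c1 c2] [e1 e2]; rewrite /on_chord /=.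
  rewrite -!(inj_eq e_inj) e1 e2; set r := take q w.
  have er i : (e t == track r i) = (track (rev r) (e t) == i).
    apply/eqP/eqP => [->|<-]; [exact: track_revK | by rewrite track_revVK].
  case: d {e1 e2} => i /=; last by rewrite eqxx.
  by rewrite !er (inj_eq (@track_inj _)) neq_ltn ltnSn.
have H := closure_sys b.
rewrite (@reduce_sys _ _ (@down n b) (@fall (size w) T p) h) in H => //.
- by move: H; apply: graph_sys_ext => x; rewrite ?h_mark.
- exact: fall_inj.
- by move=> x _; exists (g x); rewrite gK.
- by move=> x; exists (g x); rewrite gK.
by move=> x; exists 0; split => //=; rewrite h_down.
Qed.
(** * Reidemeister moves on marked permutations *)

Section ReidSys.
Variables (G G' : ograph) (X : finType) (f : X -> X) (A : pred X) (vx : X -> nat).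
Hypothesis f_inj : injective f.

Lemma via_reach psi (h h' : half G) x y k : graph_via f A vx psi -> out h ->
  psi h = x -> reach f A x k y -> A y -> psi (nxt h) = y.
Proof.
move=> via oh ex rxy Ay; have [j rj] := via_nxt via oh; rewrite ex in rj.
by apply: (reach_uniq rj rxy) => //; apply: (via_mark via); rewrite out_nxt.
Qed.

Lemma atv_nxt (h : half G) : atv (nxt h) = atv (ed h).
Proof. exact: atv_opp. Qed.

Section Erasing.
Variables (A' : pred X) (vx' : X -> nat).
Hypothesis vx_eq : forall x y, A' x -> A' y -> (vx x == vx y) = (vx' x == vx' y).

Lemma reid1_sys x y k : graph_sys G f A vx -> graph_sys G' f A' vx' ->
  A x -> A y -> x != y -> vx x = vx y -> reach f A x k y ->
  (forall z, A' z = A z && (vx z != vx x)) -> reid1 G G'.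
Proof.
move=> [psi via] [psi' via'] Ax Ay nxy exy rxy eA'.
have [h oh ex] := via_sur via Ax; have on : out (nxt h) by rewrite out_nxt.
have ey := via_reach h via oh ex rxy Ay.
exists h; split.
- by apply/eqP; rewrite -atv_nxt (via_at via) // ex ey exy.
- by apply: contra nxy => /eqP e; rewrite -ex -ey /nxt e oppK'.
apply: (graph_erased f_inj via via') => // [z|h' oh']; first by rewrite eA' => /andP[].
by rewrite inE (via_at via) // eA' (via_mark via oh') ex negbK.
Qed.

Lemma reid2_sys x1 y1 k1 x2 y2 k2 : graph_sys G f A vx -> graph_sys G' f A' vx' ->
  A x1 -> A y1 -> A x2 -> A y2 -> reach f A x1 k1 y1 -> reach f A x2 k2 y2 ->
  vx x1 != vx y1 ->
  ([/\ vx x2 = vx x1, vx y2 = vx y1, x2 != x1 & y2 != y1] \/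
   [/\ vx x2 = vx y1, vx y2 = vx x1, x2 != y1 & y2 != x1]) ->
  (forall z, A' z = [&& A z, vx z != vx x1 & vx z != vx y1]) -> reid2 G G'.
Proof.
move=> [psi via] [psi' via'] Ax1 Ay1 Ax2 Ay2 r1 r2 nv ends eA'.
have [h1 oh1 ex1] := via_sur via Ax1; have on1 : out (nxt h1) by rewrite out_nxt.
have ey1 := via_reach h1 via oh1 ex1 r1 Ay1.
have [h2 oh2 ex2] := via_sur via Ax2; have on2 : out (nxt h2) by rewrite out_nxt.
have ey2 := via_reach h2 via oh2 ex2 r2 Ay2.
have nE (h : half G) : opp (ed h) = nxt h by [].
have oI (h h' : half G) : out h -> ~~ out h' -> h != h' by move=> oh; apply: contra => /eqP <-.
have era : erased [set atv h1; atv (ed h1)] G'.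
  apply: (graph_erased f_inj via via') => // [z|h oh]; first by rewrite eA' => /andP[].
  by rewrite !inE -atv_nxt !(via_at via) // eA' (via_mark via oh) ex1 ey1 /= negb_and !negbK.
have nv1 : atv (ed h1) != atv h1 by rewrite -atv_nxt (via_at via) // ex1 ey1 eq_sym.
(* The two arcs pass through the bigon in the same direction or in opposite ones. In the second case
   the half-edge of the second arc at the vertex of [h1] is the incoming one, [ed h2]. *)
case: ends => [[e1 e2 n1 n2]|[e1 e2 n1 n2]].
  exists h1, h2; split=> //.
  - by apply/eqP; rewrite (via_at via) // ex1 ex2 e1.
  - by apply/eqP; rewrite -!atv_nxt (via_at via) // ey1 ey2 e2.
  split.
  - by apply: contra n1 => /eqP e; rewrite -ex1 -ex2 e.
  - by apply: oI; rewrite // out_opp oh1.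
  by rewrite nE eq_sym; apply: oI; rewrite // out_ed oh2.
exists h1, (ed h2); split=> //.
- by apply/eqP; rewrite -atv_nxt (via_at via) // ey2 ex1 e2.
- by apply/eqP; rewrite edK' -atv_nxt (via_at via) // ey1 ex2 e1.
split.
- by rewrite eq_sym; apply: oI; rewrite // out_ed oh2.
- by apply: contra n2 => /eqP e; rewrite -ex1 -ey2 /nxt e oppK'.
by rewrite edK' nE; apply: contra n1 => /eqP e; rewrite -ex2 -ey1 e.
Qed.

End Erasing.

(* [fl] exchanges the two ends of the three arcs of the triangle. *)
Lemma reid3_sys vx' (fl : X -> X) x1 y1 k1 x2 y2 k2 x3 y3 k3 :
  graph_sys G f A vx -> graph_sys G' f A vx' ->
  all A [:: x1; y1; x2; y2; x3; y3] -> uniq [:: x1; y1; x2; y2; x3; y3] ->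
  [/\ reach f A x1 k1 y1, reach f A x2 k2 y2 & reach f A x3 k3 y3] ->
  [/\ vx x2 = vx x1, vx x3 = vx y1 & vx y3 = vx y2] ->
  [/\ vx x1 != vx y1, vx y1 != vx y2 & vx y2 != vx x1] ->
  [/\ fl x1 = y1, fl x2 = y2 & fl x3 = y3] -> involutive fl ->
  (forall z, z \notin [:: x1; y1; x2; y2; x3; y3] -> fl z = z) ->
  (forall z z', A z -> A z' -> (vx' z == vx' z') = (vx (fl z) == vx (fl z'))) ->
  reid3 G G'.
Proof.
move=> [psi via] [psi' via'] /and5P[Ax1 Ay1 Ax2 Ay2 /and3P[Ax3 Ay3 _]] U [r1 r2 r3]
  [v1 v2 v3] [n1 n2 n3] [f1 f2 f3] flK fl_id vx'E.
have [f1' f2' f3'] : [/\ fl y1 = x1, fl y2 = x2 & fl y3 = x3] by rewrite -f1 -f2 -f3 !flK.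
have flA z : A z -> A (fl z).
  have [|nz] := boolP (z \in [:: x1; y1; x2; y2; x3; y3]); last by rewrite fl_id.
  rewrite !inE => /or4P[/eqP->|/eqP->|/eqP->|/or3P[]/eqP->] _;
    by rewrite ?f1 ?f2 ?f3 ?f1' ?f2' ?f3'.
have [h1 oh1 ex1] := via_sur via Ax1; have on1 : out (nxt h1) by rewrite out_nxt.
have ey1 := via_reach h1 via oh1 ex1 r1 Ay1.
have [h2 oh2 ex2] := via_sur via Ax2; have on2 : out (nxt h2) by rewrite out_nxt.
have ey2 := via_reach h2 via oh2 ex2 r2 Ay2.
have [h3 oh3 ex3] := via_sur via Ax3; have on3 : out (nxt h3) by rewrite out_nxt.
have ey3 := via_reach h3 via oh3 ex3 r3 Ay3.
have oI (h h' : half G) : out h -> ~~ out h' -> h == h' = false.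
  by move=> oh; apply: contraNF => /eqP <-.
have oE (h h' : half G) : out h -> out h' -> (h == h') = (psi h == psi h').
  by move=> oh oh'; apply/eqP/eqP => [->//|/(via_inj via)]; apply.
have atE (h h' : half G) : out h -> out h' -> vx (psi h) = vx (psi h') -> atv h = atv h'.
  by move=> oh oh' e; apply/eqP; rewrite (via_at via) // e.
have atN (h h' : half G) : out h -> out h' -> vx (psi h) != vx (psi h') -> atv h != atv h'.
  by move=> oh oh' e; rewrite (via_at via).
(* The triangle is walked along the first and the third arc and back along the second, against its
   orientation. *)
exists h1, h3, (ed h2); split.
- split; first by rewrite -atv_nxt; apply: atE; rewrite // ey1 ex3 v2.
    by rewrite -!atv_nxt; apply: atE; rewrite // ey3 ey2.
  by rewrite edK'; apply: atE; rewrite // ex1 ex2.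
- split; first by apply: atN; rewrite // ex1 ex3 v2.
    by rewrite -atv_nxt; apply: atN; rewrite // ex3 ey2 v2.
  by rewrite -atv_nxt; apply: atN; rewrite // ey2 ex1.
- split.
  + rewrite -[opp _]/(nxt h1) oE // ex3 ey1; move: U; rewrite /= !inE !negb_or.
    by case/and5P => _ /and4P[_ _ + _] _ _ _; rewrite eq_sym.
  + by rewrite -[opp _]/(nxt h3) eq_sym oI // out_ed oh2.
  by rewrite edK' oI // out_opp oh2.
pose T := [set h1; h3; ed h2; ed h1; ed h3; ed (ed h2)].
have eT h : (h \in T) = if out h then h \in [:: h1; h2; h3] else opp h \in [:: nxt h1; nxt h2; nxt h3].
  rewrite !inE edK' /nxt !(inj_eq (can_inj (@oppK' G))); case: ifP => oh.
    rewrite ![h == ed _]oI ?out_ed ?oh1 ?oh2 ?oh3 //.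
    by case: (h == h1); case: (h == h2); case: (h == h3).
  have nh u : out u -> h == u = false by move=> ou; rewrite eq_sym oI // oh.
  rewrite !(nh h1, nh h2, nh h3) //.
  by case: (h == _); case: (h == _); case: (h == _).
have flip_opp h : flip_atv T (opp h) = flip_atv T h.
  rewrite /flip_atv oppK' atv_opp; case hT: (h \in T); case oT: (opp h \in T) => //.
  suff : false by []; move: hT oT; rewrite !eT out_opp oppK'; case: ifP => oh /=.
    rewrite !inE !oE // ex1 ex2 ex3 ey1 ey2 ey3.
    by case/or3P=> /eqP e1 /or3P[]/eqP e2; move: U; rewrite /= !inE -e1 -e2 !eqxx /= ?orbT /= ?andbF.
  have oo : out (opp h) by rewrite out_opp oh.
  rewrite !inE !oE // ex1 ex2 ex3 ey1 ey2 ey3.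
  by case/or3P=> /eqP e1 /or3P[]/eqP e2; move: U; rewrite /= !inE -e1 -e2 !eqxx /= ?orbT /= ?andbF.
have flip_out h : out h -> exists2 h', out h' & psi h' = fl (psi h) /\ flip_atv T h = atv h'.
  move=> oh; rewrite /flip_atv !eT out_opp oh /= oppK'.
  have [|nx] := boolP (h \in _).
    rewrite !inE => /or3P[]/eqP->.
    - by exists (nxt h1); rewrite // ey1 ex1 f1 atv_nxt.
    - by exists (nxt h2); rewrite // ey2 ex2 f2 atv_nxt.
    by exists (nxt h3); rewrite // ey3 ex3 f3 atv_nxt.
  have [|ny] := boolP (h \in _).
    rewrite !inE => /or3P[]/eqP->.
    - by exists h1; rewrite // ey1 ex1 f1' /nxt oppK' edK'.
    - by exists h2; rewrite // ey2 ex2 f2' /nxt oppK' edK'.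
    by exists h3; rewrite // ey3 ex3 f3' /nxt oppK' edK'.
  exists h => //; split=> //; rewrite fl_id //; move: nx ny.
  rewrite !inE !oE // ex1 ex2 ex3 ey1 ey2 ey3 !negb_or => /and3P[-> -> ->] /and3P[-> -> ->] //.
have flip_ex h : exists2 h', out h' & psi h' = fl (psi (outward h)) /\ flip_atv T h = atv h'.
  have [h' oh' [e1 e2]] := flip_out _ (out_outward h); exists h' => //; split=> //.
  by rewrite -e2 /outward; case: ifP => // _; rewrite flip_opp.
(* The marks are the same for both graphs, so the comparison made for erasing, with nothing erased,
   matches the half-edges; only the vertices differ. *)
have [F [outF psiF]] := erase_half via' via (fun z Az => Az).
have FI := erase_inj via outF psiF; have FO := erase_opp via' outF psiF.
have FC := erase_codom via' via outF psiF.
have FE := erase_ed via' via (fun z Az => Az) outF psiF.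
have F_sur h : h \in codom F by rewrite FC (via_mark via') ?out_outward.
have F_bij : bijective F.
  by apply: inj_card_bij => //; rewrite -(card_codom FI); apply/subset_leq_card/subsetP => h _.
have at_eq h h' : (atv (F h) == atv (F h')) = (flip_atv T h == flip_atv T h').
  have [u ou [eu ->]] := flip_ex h; have [u' ou' [eu' ->]] := flip_ex h'.
  rewrite -!(atv_outward (F _)) (via_at via') ?(via_at via) //; try exact: out_outward.
  by rewrite !psiF eu eu' vx'E //; apply: (via_mark via); apply: out_outward.
have [rep repP] : exists rep : vert G -> half G, forall v, flip_atv T (rep v) = v.
  apply: (@fin_all_exists _ (fun _ => half G) (fun v h => flip_atv T h = v)) => v.
  have [h <-] := atv_ex v; rewrite -(atv_outward h); move: (out_outward h).
  move: (outward h) => {}h oh; have [u ou eu] := via_sur via (flA _ (via_mark via oh)).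
  have [u' ou' [eu' fu]] := flip_out u ou; exists u; rewrite fu; congr atv.
  by apply: (via_inj via) => //; rewrite eu' eu flK.
exists F, (fun v => atv (F (rep v))); split=> //.
- exists (fun v' => flip_atv T (odflt h1 [pick h | atv (F h) == v'])) => [v|v'].
    case: pickP => [h|/(_ (rep v))]; last by rewrite eqxx.
    by rewrite at_eq => /eqP /= ->; rewrite repP.
  apply/eqP; case: pickP => [h /eqP <-|no] /=; first by rewrite at_eq repP.
  have [h' eh'] := atv_ex v'; have /codomP[h e] := F_sur h'.
  by have := no h; rewrite -e eh' eqxx.
- split=> // h; first by apply/eqP; rewrite at_eq repP.
  have [[|k] [-> nk]] := FE h => //; by have := nk 0 isT; rewrite F_sur.
by rewrite (via_circ via) (via_circ via').
Qed.

End ReidSys.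

(** * Soundness of the moves of chord words *)

Lemma iso_isotopic (G G' : ograph) : ograph_iso G G' -> isotopic G G'.
Proof. by move=> i; apply: rst_step; apply: FreeIso. Qed.

Lemma word_graph_iso_eq (G G' : ograph) (T : finType) l (p : T -> T) : injective p ->
  word_graph G l p -> word_graph G' l p -> ograph_iso G G'.
Proof. by move=> p_inj g g'; apply: graph_sys_iso g' g; apply: fall_inj. Qed.

Lemma iso_word_graph (G G' : ograph) (T : finType) l (p : T -> T) :
  ograph_iso G G' -> word_graph G l p -> word_graph G' l p.
Proof. exact: iso_graph_sys. Qed.

Lemma fall_inord m (T : finType) (p : T -> T) i t : i < m ->
  fall p (inord i : 'I_m.+1, t) = (inord i.+1, t).
Proof.
move=> im; rewrite -[LHS]/(iter 1 (fall p) _) iter_fall /= ?inordK ?addn1 //; lia.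
Qed.

Lemma inord_pair_eq m (T : eqType) i j (t u : T) : i <= m -> j <= m ->
  ((inord i : 'I_m.+1, t) == (inord j, u)) = (i == j) && (t == u).
Proof. by move=> im jm; rewrite xpair_eqE -val_eqE /= !inordK. Qed.

Lemma square_reid2 (G G' : ograph) (T : finType) u a b v (p : T -> T) : injective p -> a != b ->
  word_graph G (u ++ [:: (a, b); (a, b)] ++ v) p -> word_graph G' (u ++ v) p -> reid2 G G'.
Proof.
move=> p_inj ab g g'; set i := size u.
(* Two trivial chords give the shorter word the same levels, so that both graphs live on the same
   permutation. *)
have {}g' : word_graph G' (u ++ [:: (a, a); (a, a)] ++ v) p.
  by apply/(word_graph_triv G' u a ((a, a) :: v) p_inj)/(word_graph_triv G' u a v p_inj).
pose m := i + (size v).+2.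
have sm x y : size (u ++ [:: x; y] ++ v) = m by rewrite !size_cat.
rewrite /word_graph /graph_lev !sm in g g'.
have im : i.+1 < m by rewrite /m; lia.
have mk x y d t : d < 2 -> mark_at (u ++ [:: x; y] ++ v) (i + d) t = mark_at [:: x; y] d t.
  by move=> d2; rewrite mark_at_mid ltnNge leq_addr /= addKn d2.
have {}mk x y d t : d < 2 ->
    mark_at (u ++ [:: x; y] ++ v) (inord (i + d) : 'I_m.+1) t = mark_at [:: x; y] d t.
  by move=> d2; rewrite inordK ?mk //; lia.
have mk0 x y t := mk x y 0 t isT; have mk1 x y t := mk x y 1 t isT.
rewrite addn0 in mk0; rewrite addn1 in mk1.
have ab' : b == a = false by rewrite eq_sym (negPf ab).
apply: (@reid2_sys G G' _ _ _ _ (fall_inj p_inj) _ _ _ (inord i, a) (inord i.+1, a) 0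
  (inord i, b) (inord i.+1, b) 0 g g') => //=; rewrite ?mk0 ?mk1 /mark_at /= /on_chord /= ?ab ?eqxx ?orbT //.
- by split; rewrite //= fall_inord //; lia.
- by split; rewrite //= fall_inord //; lia.
- by rewrite !inordK; lia.
- by left; split; rewrite // inord_pair_eq ?ab' ?andbF //; lia.
move=> [q t] /=; rewrite !inordK; try lia.
rewrite !onth_cat -/i; case: ltnP => qi.
  by have [-> ->] : (q == i :> nat) = false /\ (q == i.+1 :> nat) = false by [lia]; rewrite /= andbT.
case: (ltngtP q i) qi => // [qi|->] _; last by rewrite subnn /= eqxx andbF.
have -> : q - i = (q - i).-1.+1 by lia.
case: (ltngtP (q : nat) i.+1) => [||->]; first by lia.
  move=> q1; have -> : (q - i).-1 = (q - i).-2.+1 by lia.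
  by rewrite /= !andbT.
by rewrite subSnn /= eqxx !andbF.
Qed.

Section CutReach.
Variables (T : finType) (p : T -> T) (s : T) (l1 l2 : seq (T * T)) (lc : seq (option T * option T)).
Let l := cut_chords s l1 lc l2.
Let m := size l.

Lemma cut_chords_upper q : size l1 <= q -> size l1 + size lc <= q -> ~~ mark_at l q (Some s).
Proof.
move=> q1 q2; rewrite mark_at_mid size_map ltnNge q1 /= ltnNge leq_subRL // q2 /=.
rewrite /mark_at onth_map; case: onth => //= c; rewrite /on_chord /= /cut_lab.
have ns x : (Some s == (if x == s then None else Some x)) = false.
  by case: (eqVneq x s) => // nx; apply: contraNF nx => /eqP[->].
by rewrite !ns andbF.
Qed.

Lemma cut_chords_lower q : q < size l1 -> ~~ mark_at l q None.
Proof.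
move=> q1; rewrite mark_at_mid size_map q1 /mark_at onth_map; case: onth => //= c.
by rewrite /on_chord /= andbF.
Qed.

(** The run follows the rest of the upper part, the closing arc and the beginning of the lower part.
    This is the loop made by a flat L-move and one side of the bigon made by a threaded one. *)
Lemma cut_reach q1 q2 : q1 < m -> q2 <= q1 ->
  (forall q, q1 < q -> ~~ mark_at l q (Some s)) -> (forall q, q < q2 -> ~~ mark_at l q None) ->
  reach (fall (cut_nx s p)) (fun x : 'I_m.+1 * option T => mark_at l x.1 x.2)
    (inord q1, Some s) (m - q1 + q2) (inord q2, None).
Proof.
move=> qm q21 ms mN; split.
  rewrite iter_fall_wrap /=; last by rewrite inordK; lia.
  by rewrite eqxx inordK; [congr (inord _, _); lia | lia].
have q1K : (inord q1 : 'I_m.+1) = q1 :> nat by rewrite inordK //; lia.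
move=> i im; have [le|gt] := leqP (q1 + i.+1) m.
  rewrite iter_fall /= q1K //; rewrite inordK; [by apply: ms; lia | lia].
rewrite iter_fall_wrap /= q1K; last by lia.
by rewrite eqxx inordK; [apply: mN; lia | lia].
Qed.

End CutReach.

Lemma size_cut_chords (T : finType) (s : T) l1 lc l2 :
  size (cut_chords s l1 lc l2) = size l1 + (size lc + size l2).
Proof. by rewrite /cut_chords !size_cat !size_map. Qed.

Lemma flat_reid1 (G G' : ograph) (T : finType) s l1 l2 (p : T -> T) : injective p ->
  word_graph G (cut_chords s l1 [:: (Some s, None)] l2) (cut_nx s p) ->
  word_graph G' (l1 ++ l2) p -> reid1 G G'.
Proof.
move=> p_inj; set i := size l1.
have cI := @cut_nx_inj T s p p_inj.
rewrite -(word_graph_cut _ s) // /cut_chords /= => g.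
rewrite -(word_graph_triv _ _ None) // => g'.
pose m := i + (size l2).+1.
have sm x : size (map (pairmap2 Some) l1 ++ [:: x] ++ map (pairmap2 (cut_lab s)) l2) = m.
  by rewrite !size_cat !size_map.
rewrite /word_graph /graph_lev !sm in g g'.
have im : i < m by rewrite /m; lia.
have := @cut_reach T p s l1 l2 [:: (Some s, None)] i i.
rewrite size_cut_chords -/i add1n -/m => /(_ im (leqnn _)) rch.
have mk x z : mark_at (map (pairmap2 Some) l1 ++ [:: x] ++ map (pairmap2 (cut_lab s)) l2)
    (inord i : 'I_m.+1) z = on_chord x z.
  by rewrite inordK ?mark_at_mid ?size_map ?ltnn ?subnn //; lia.
apply: (@reid1_sys G G' _ _ _ _ (fall_inj cI) _ _ _ (inord i, Some s) (inord i, None) _ g g')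
  => //=; rewrite ?mk /on_chord /= ?eqxx ?orbT //.
- by rewrite xpair_eqE andbF.
- apply: rch => q qi; last exact: cut_chords_lower.
  by apply: cut_chords_upper; rewrite /= -/i; lia.
move=> [q t] /=; rewrite inordK; last by lia.
rewrite !mark_at_cat !size_map -/i; have [qi|qi] := ltnP q i.
  by rewrite (ltn_eqF qi) andbT.
have [->|nq] := eqVneq (q : nat) i; first by rewrite subnn /mark_at /= /on_chord /= andbF.
have -> : q - i = (q - i).-1.+1 by lia.
by rewrite andbT.
Qed.

(** The bigon is antiparallel: the thread descends from level [i] to [i.+1], while the cut strand
    goes from level [i.+1] of its upper part around to level [i] of its lower part. *)
Lemma threaded_reid2 (G G' : ograph) (T : finType) s t l1 l2 (p : T -> T) : injective p -> t != s ->
  word_graph G (cut_chords s l1 [:: (Some t, None); (Some s, Some t)] l2) (cut_nx s p) ->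
  word_graph G' (l1 ++ l2) p -> reid2 G G'.
Proof.
move=> p_inj ts; set i := size l1.
have cI := @cut_nx_inj T s p p_inj.
rewrite -(word_graph_cut _ s) // /cut_chords /= => g g'.
have {}g' : word_graph G' (map (pairmap2 Some) l1 ++ [:: (None, None); (None, None)] ++
    map (pairmap2 (cut_lab s)) l2) (cut_nx s p).
  by apply/(word_graph_triv G' _ None (_ :: _) cI)/(word_graph_triv G' _ None _ cI).
pose m := i + (size l2).+2.
have sm x y : size (map (pairmap2 Some) l1 ++ [:: x; y] ++ map (pairmap2 (cut_lab s)) l2) = m.
  by rewrite !size_cat !size_map.
rewrite /word_graph /graph_lev !sm in g g'.
have im : i.+1 < m by rewrite /m; lia.
have := @cut_reach T p s l1 l2 [:: (Some t, None); (Some s, Some t)] i.+1 i.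
rewrite size_cut_chords -/i -[X in reach (@fall X _ _)]/(i + _) addSn add1n -/m.
move=> /(_ im (leqnSn _)) rch.
have mk x y d z : d < 2 -> mark_at (map (pairmap2 Some) l1 ++ [:: x; y] ++ map (pairmap2 (cut_lab s)) l2)
    (inord (i + d) : 'I_m.+1) z = mark_at [:: x; y] d z.
  move=> d2; rewrite inordK; last by lia.
  by rewrite mark_at_mid size_map ltnNge leq_addr /= addKn d2.
have mk0 x y z := mk x y 0 z isT; have mk1 x y z := mk x y 1 z isT.
rewrite addn0 in mk0; rewrite addn1 in mk1.
have st : (Some s == Some t) = false by apply: contraNF ts => /eqP[->].
apply: (@reid2_sys G G' _ _ _ _ (fall_inj cI) _ _ _ (inord i, Some t) (inord i.+1, Some t) 0
  (inord i.+1, Some s) (inord i, None) _ g g') => //=;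
  rewrite ?mk0 ?mk1 /mark_at /= /on_chord /= ?st ?eqxx ?orbT //.
- by split; rewrite //= fall_inord //; lia.
- apply: rch => q qi; last exact: cut_chords_lower.
  by apply: cut_chords_upper; rewrite /= -/i; lia.
- by rewrite !inordK; lia.
- by right; split; rewrite // inord_pair_eq ?st ?andbF //; lia.
move=> [q z] /=; rewrite !inordK; try lia.
rewrite !onth_cat !size_map -/i; case: ltnP => qi.
  by have [-> ->] : (q == i :> nat) = false /\ (q == i.+1 :> nat) = false by [lia]; rewrite /= andbT.
case: (ltngtP q i) qi => // [qi|->] _; last by rewrite subnn /= andbF.
have -> : q - i = (q - i).-1.+1 by lia.
case: (ltngtP (q : nat) i.+1) => [||->]; first by lia.
  move=> q1; have -> : (q - i).-1 = (q - i).-2.+1 by lia.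
  by rewrite /= !andbT.
by rewrite subSnn /= !andbF.
Qed.

(* After removing from each strand of the triangle the level where it does not
   cross, the three strands meet on two levels and only the vertices differ. *)
Lemma triangle_reid3 (G G' : ograph) (T : finType) u a b c v (p : T -> T) : injective p ->
  uniq [:: a; b; c] ->
  word_graph G (u ++ [:: (a, b); (a, c); (b, c)] ++ v) p ->
  word_graph G' (u ++ [:: (b, c); (a, c); (a, b)] ++ v) p -> reid3 G G'.
Proof.
move=> p_inj U; have /and3P[ab ac bc] : [&& a != b, a != c & b != c].
  by move: U; rewrite /= !inE !negb_or andbT -andbA.
set i := size u; pose m := i + (size v).+2.
have sm x y z : size (u ++ [:: x; y; z] ++ v) = m.+1 by rewrite !size_cat /= addnS.
(* The chord that [a] misses is [(b, c)], the last one in the first word and the first one in the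
   second; [b] misses the middle chord in both, and [c] misses [(a, b)]. *)
pose k t := if t == a then i.+2 else if t == b then i.+1 else i.
pose k' t := if t == a then i else if t == b then i.+1 else i.+2.
have kb1 t : i <= k t <= i.+2 by rewrite /k; clear; do 2?case: ifP => _; lia.
have kb2 t : i <= k' t <= i.+2 by rewrite /k'; clear; do 2?case: ifP => _; lia.
have [ba [ca cb]] : b == a = false /\ c == a = false /\ c == b = false.
  by split; [|split]; apply/negbTE; rewrite eq_sym.
have im : i.+1 < m by rewrite /m; lia.
have im1 : i.+1 <= m by exact: ltnW. have im0S : i < m by exact: im1. have im0 : i <= m by exact: ltnW.
have mid l d t : d < size l -> mark_at (u ++ l ++ v) (i + d) t = mark_at l d t.
  by move=> d3; rewrite mark_at_mid ltnNge leq_addr /= addKn d3.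
have mid0 x y z := mid [:: x; y; z] 0 _ isT; have mid1 x y z := mid [:: x; y; z] 1 _ isT.
have mid2 x y z := mid [:: x; y; z] 2 _ isT.
rewrite addn0 in mid0; rewrite addn1 in mid1; rewrite addn2 in mid2.
rewrite /word_graph !sm (@level_bump _ _ _ _ _ _ k) //; last first.
- move=> t; rewrite /k; case: (eqVneq t a) => [->|na].
    by rewrite mid2 /mark_at /= /on_chord /= bc (negPf ab) (negPf ac).
  case: (eqVneq t b) => [->|nb]; first by rewrite mid1 /mark_at /= /on_chord /= ac ba (negPf bc).
  by rewrite mid0 /mark_at /= /on_chord /= ab (negPf na) (negPf nb).
- by move=> t; rewrite /k; do 2?case: ifP => _; lia.
move=> g; rewrite (@level_bump _ _ _ _ _ _ k') //; last first.
- move=> t; rewrite /k'; case: (eqVneq t a) => [->|na].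
    by rewrite mid0 /mark_at /= /on_chord /= bc (negPf ab) (negPf ac).
  case: (eqVneq t b) => [->|nb]; first by rewrite mid1 /mark_at /= /on_chord /= ac ba (negPf bc).
  by rewrite mid2 /mark_at /= /on_chord /= ab (negPf na) (negPf nb).
- by move=> t; rewrite /k'; do 2?case: ifP => _; lia.
pose abc := [:: a; b; c].
pose A q t := if q < i then mark_at u q t else if q < i.+2 then t \in abc
  else mark_at v (q - i.+2) t.
have bumpS h q : h <= q -> bump h q = q.+1 by rewrite /bump => ->.
have bumpF h q : q < h -> bump h q = q by move=> qh; rewrite /bump leqNgt qh.
have AE q t : mark_at (u ++ [:: (a, b); (a, c); (b, c)] ++ v) (bump (k t) q) t = A q t.
  have /andP[klo khi] := kb1 t.
  rewrite /A; case: ltnP => qi.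
    by rewrite bumpF ?(leq_trans qi) // mark_at_cat -/i qi.
  case: ltnP => qi2; last first.
    rewrite bumpS ?(leq_trans khi) //.
    rewrite mark_at_mid -/i /= [q.+1 < i]ltnNge (leq_trans qi) //=.
    have -> : q.+1 - i < 3 = false by lia.
    by congr (mark_at v _ t); lia.
  have {qi qi2}: q = i \/ q = i.+1 by lia.
  rewrite /abc !inE /k; case: (eqVneq t a) => [->|na].
    by case=> ->; rewrite bumpF // ?mid0 ?mid1 /mark_at /= /on_chord /= ?ab ?ac eqxx.
  case: (eqVneq t b) => [->|nb].
    by case=> ->; [rewrite bumpF // mid0 | rewrite bumpS // mid2];
      rewrite /mark_at /= /on_chord /= ?ab ?bc ?eqxx ?orbT.
  by case=> ->; rewrite bumpS // ?mid1 ?mid2 /mark_at /= /on_chord /= ?ac ?bc ?(negPf na) ?(negPf nb).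
have AE' q t : mark_at (u ++ [:: (b, c); (a, c); (a, b)] ++ v) (bump (k' t) q) t = A q t.
  have /andP[klo khi] := kb2 t.
  rewrite /A; case: ltnP => qi.
    by rewrite bumpF ?(leq_trans qi) // mark_at_cat -/i qi.
  case: ltnP => qi2; last first.
    rewrite bumpS ?(leq_trans khi) //.
    rewrite mark_at_mid -/i /= [q.+1 < i]ltnNge (leq_trans qi) //=.
    have -> : q.+1 - i < 3 = false by lia.
    by congr (mark_at v _ t); lia.
  have {qi qi2}: q = i \/ q = i.+1 by lia.
  rewrite /abc !inE /k'; case: (eqVneq t a) => [->|na].
    by case=> ->; rewrite bumpS // ?mid1 ?mid2 /mark_at /= /on_chord /= ?ab ?ac ?eqxx.
  case: (eqVneq t b) => [->|nb].
    by case=> ->; [rewrite bumpF // mid0 | rewrite bumpS // mid2];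
      rewrite /mark_at /= /on_chord /= ?ab ?bc ?eqxx ?orbT.
  by case=> ->; rewrite bumpF // ?mid0 ?mid1 /mark_at /= /on_chord /= ?ac ?bc ?(negPf na) ?(negPf nb).
rewrite (@graph_lev_ext _ _ _ _ _ A _ (fun q t => bump (k t) q)) // in g.
rewrite (@graph_lev_ext _ _ _ _ _ A _ (fun q t => bump (k' t) q)) // => g'.
(* On the three strands the two levels that are left, [i] and [i.+1], are exchanged. *)
pose flq (q : nat) (t : T) : nat := if t \in abc then (if q == i then i.+1 else if q == i.+1 then i else q) else q.
have flqK (q : nat) (t : T) : flq (flq q t) t = q.
  rewrite /flq; case: (t \in abc) => //; have ni : i.+1 == i = false by rewrite gtn_eqF.
  have [->|n1] := eqVneq q i; first by rewrite ni !eqxx.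
  have [->|n2] := eqVneq q i.+1; first by rewrite eqxx.
  by rewrite (negPf n1) (negPf n2).
have flq_le (q : nat) (t : T) : q <= m -> flq q t <= m.
  by rewrite /flq; do 3?case: ifP => // _.
pose fl (x : 'I_m.+1 * T) : 'I_m.+1 * T := (inord (flq x.1 x.2), x.2).
have fl1 x : (fl x).1 = flq x.1 x.2 :> nat by rewrite /= inordK // ltnS flq_le // -ltnS.
have flE q t : q <= m -> fl (inord q, t) = (inord (flq q t), t).
  by move=> qm; rewrite /fl /= inordK.
have iK : (inord i : 'I_m.+1) = i :> nat by rewrite inordK.
have i1K : (inord i.+1 : 'I_m.+1) = i.+1 :> nat by rewrite inordK.
have marki t : t \in abc -> A (inord i : 'I_m.+1) t.
  by move=> tabc; rewrite iK /A ltnn ltnS leqnSn.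
have marki1 t : t \in abc -> A (inord i.+1 : 'I_m.+1) t.
  by move=> tabc; rewrite i1K /A ltnNge leqnSn ltnSn.
have [inA inB inC] : [/\ a \in abc, b \in abc & c \in abc] by rewrite !inE !eqxx !orbT.
have step t : fall p (inord i : 'I_m.+1, t) = (inord i.+1, t) by apply: fall_inord.
have ip00 t t' : ((inord i : 'I_m.+1, t) == (inord i, t')) = (t == t').
  by rewrite inord_pair_eq ?eqxx.
have ip11 t t' : ((inord i.+1 : 'I_m.+1, t) == (inord i.+1, t')) = (t == t').
  by rewrite inord_pair_eq ?eqxx.
have ip01 t t' : ((inord i : 'I_m.+1, t) == (inord i.+1, t')) = false.
  by rewrite inord_pair_eq ?ltn_eqF.
have ip10 t t' : ((inord i.+1 : 'I_m.+1, t) == (inord i, t')) = false.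
  by rewrite inord_pair_eq ?gtn_eqF.
have ipE := (ip00, ip11, ip01, ip10).
have kE : [/\ k a = i.+2, k b = i.+1 & k c = i] by rewrite /k !eqxx ba ca cb.
have [ka kb kc] := kE.
apply: (@reid3_sys G G' _ _ _ _ _ fl (inord i, a) (inord i.+1, a) 0
  (inord i, b) (inord i.+1, b) 0 (inord i, c) (inord i.+1, c) 0 g g').
- by rewrite /= !marki // !marki1.
- by rewrite /= !inE !ipE (negPf ab) (negPf ac) (negPf bc).
- by split; split => //=; rewrite step.
- by rewrite /= ?iK ?i1K ?ka ?kb ?kc; split; rewrite /bump; clear; lia.
- by rewrite /= ?iK ?i1K ?ka ?kb ?kc; split; rewrite /bump; clear; lia.
- by split; rewrite flE // /flq ?inA ?inB ?inC eqxx.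
- move=> x; apply: pair_eq_inord => //=.
  by rewrite inordK; [rewrite fl1 flqK | rewrite ltnS flq_le // -ltnS].
- move=> [q t] nz; apply: pair_eq_inord; rewrite // fl1 /= /flq.
  case: ifP => // tabc; case: eqP => [eq|nq].
    case/negP: nz; rewrite -(inord_val q) eq !inE !ipE.
    by move: tabc; rewrite !inE => /or3P[] ->; rewrite ?orbT.
  case: eqP => // eq; case/negP: nz; rewrite -(inord_val q) eq !inE !ipE.
  by move: tabc; rewrite !inE => /or3P[] ->; rewrite ?orbT.
(* As vertices, [(a, b)] and [(b, c)] have the numbers [i] and [i.+2] in the first word and the
   reverse in the second; [(a, c)] keeps [i.+1]. *)
pose tau q := if q == i.+2 then i else if q == i then i.+2 else q.
have tauK : involutive tau.
  by move=> q; rewrite /tau; clear; do 4?case: eqP; lia.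
have ii1 : i.+1 == i = false by rewrite gtn_eqF.
have ii2 : i.+1 == i.+2 = false by rewrite ltn_eqF.
have i02 : i == i.+2 = false by rewrite ltn_eqF // ltnW.
have tauE (q : nat) t : A q t -> bump (k' t) q = tau (bump (k t) (flq q t)).
  have /andP[klo khi] := kb1 t; have /andP[klo' khi'] := kb2 t.
  have [qi|iq] := ltnP q i.
    have -> : flq q t = q by rewrite /flq (ltn_eqF qi) (ltn_eqF (leqW qi)) if_same.
    rewrite !bumpF ?(leq_trans qi) // /tau.
    by rewrite (ltn_eqF qi) (ltn_eqF (leqW (leqW qi))).
  have [qi2|iq2] := ltnP q i.+2; last first.
    have -> : flq q t = q by rewrite /flq !gtn_eqF ?if_same // ltnW.
    rewrite !bumpS ?(leq_trans _ iq2) // /tau.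
    by rewrite !gtn_eqF // leqW.
  rewrite /A ltnNge iq /= qi2 => tabc.
  have /orP[/eqP->|/eqP->] : (q == i :> nat) || (q == i.+1 :> nat) by move: iq qi2; clear; lia.
    rewrite /flq tabc eqxx; move: tabc; rewrite !inE => /or3P[]/eqP->;
      rewrite ?ka ?kb ?kc /k' ?eqxx ?ba ?ca ?cb.
    - by rewrite bumpS // bumpF // /tau ii2 ii1.
    - by rewrite bumpF // bumpS // /tau eqxx.
    by rewrite bumpF // ?bumpS // /tau eqxx.
  rewrite /flq tabc ii1 eqxx; move: tabc; rewrite !inE => /or3P[]/eqP->;
    rewrite ?ka ?kb ?kc /k' ?eqxx ?ba ?ca ?cb.
  - by rewrite bumpS // bumpF // /tau eqxx i02.
  - by rewrite bumpS // bumpF // /tau eqxx i02.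
  by rewrite bumpF // bumpS // /tau ii2 ii1.
move=> [q t] [q' t'] /= Az Az'; rewrite !tauE // (inj_eq (can_inj tauK)).
by rewrite !inordK ?ltnS ?flq_le // -ltnS.
Qed.

Lemma dstep_isotopic D D' (G G' : ograph) :
  dstep D D' -> data_graph G D -> data_graph G' D' -> isotopic G G'.
Proof.
case=> {D D'} [[T l p pI T0] [T' l' p' pI' T0'] f f_bij /= el ep|T u l l' v p pI T0 ll'|T a b l p pI T0|T l1 l2 p pI T0 s lc hlc];
  rewrite /data_graph /= => g g'.
- rewrite el in g'; move/(word_graph_iso _ _ f_bij pI pI' ep): g' => g'.
  by apply: iso_isotopic; apply: word_graph_iso_eq g g'.
- case: ll' g g' => [a|a b|a b|a b c d U|a b c U] g g'.
  + by apply: iso_isotopic; move/(word_graph_triv _ _ _ _ pI): g => g; apply: word_graph_iso_eq g g'.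
  + by apply: iso_isotopic; move/word_graph_flip: g => g; apply: word_graph_iso_eq g g'.
  + have [eab|nab] := eqVneq a b; last first.
      by apply: rst_step; apply: FreeR2; apply: square_reid2 g g'.
    apply: iso_isotopic; move: g g'; rewrite eab => g g'.
    move/(word_graph_triv _ u b ((b, b) :: v) pI): g => /(word_graph_triv _ u b v pI) g.
    exact: word_graph_iso_eq g g'.
  + by apply: iso_isotopic; move/(word_graph_comm _ _ _ pI U): g => g; apply: word_graph_iso_eq g g'.
  by apply: rst_step; apply: FreeR3; apply: triangle_reid3 U g g'.
- by apply: iso_isotopic; move/(word_graph_rot _ _ _ _ pI): g => g; apply: word_graph_iso_eq g g'.
apply: rst_sym; case: hlc g' => [|| t ts] g'.
- by apply: iso_isotopic; move/(word_graph_cut _ _ _ _ pI): g' => g'; apply: word_graph_iso_eq g' g.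
- by apply: rst_step; apply: FreeR1; apply: flat_reid1 g' g.
by apply: rst_step; apply: FreeR2; apply: threaded_reid2 g' g.
Qed.

Lemma data_graph_ex D : exists G, data_graph G D.
Proof. by have [n [b rb]] := braid_rep_ex D; exists (braid_closure b); exact: closure_data_graph rb. Qed.

Lemma deq_isotopic D D' (G G' : ograph) :
  deq D D' -> data_graph G D -> data_graph G' D' -> isotopic G G'.
Proof.
move=> DD'; elim: DD' G G' => {D D'} [D D' s|D|D D' _ IH|D1 D2 D3 _ IH1 _ IH2] G G' g g'.
- exact: dstep_isotopic s g g'.
- by apply: iso_isotopic; apply: word_graph_iso_eq g g'; apply: nx_inj.
- by apply: rst_sym; apply: IH.
by have [H h] := data_graph_ex D2; apply: rst_trans (IH1 _ _ g h) (IH2 _ _ h g').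
Qed.

(** * Braid moves give equivalent chord words *)

Lemma deq_refl D : deq D D. Proof. exact: rst_refl. Qed.
Lemma deq_sym D D' : deq D D' -> deq D' D. Proof. exact: rst_sym. Qed.
Lemma deq_trans D2 D1 D3 : deq D1 D2 -> deq D2 D3 -> deq D1 D3. Proof. exact: rst_trans. Qed.
Lemma deq_step D D' : dstep D D' -> deq D D'. Proof. exact: rst_step. Qed.

Lemma deq_local (T : finType) u l l' v (p : T -> T) (pI : injective p) T0 : chord_rel l l' ->
  deq (@Data T (u ++ l ++ v) p pI T0) (@Data T (u ++ l' ++ v) p pI T0).
Proof. by move=> ll'; apply: deq_step; apply: DLocal. Qed.

Lemma deq_ext (T : finType) l l' (p p' : T -> T) (pI : injective p) (pI' : injective p') T0 T0' :
  l = l' -> p =1 p' -> deq (@Data T l p pI T0) (@Data T l' p' pI' T0').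
Proof.
move=> -> ep; apply: deq_step.
apply: (@DIso (@Data T l' p pI T0) (@Data T l' p' pI' T0') (fun t : T => t)) => //=; first by exists id.
by rewrite -[LHS]map_id; apply: eq_map; case.
Qed.

Lemma deq_nontriv_ctx (T : finType) u l (p : T -> T) (pI : injective p) T0 :
  deq (@Data T (u ++ l) p pI T0) (@Data T (u ++ nontriv l) p pI T0).
Proof.
elim: l u => [|[a b] l IHl] u /=; first exact: deq_refl.
have [/= <-|nab] := eqVneq a b; last by have := IHl (rcons u (a, b)); rewrite -!cats1 -!catA.
apply: deq_trans (IHl u); have := deq_local u l pI T0 (ChordTriv a); by [].
Qed.

Lemma deq_nontriv (T : finType) l l' (p : T -> T) (pI : injective p) T0 :
  nontriv l = nontriv l' -> deq (@Data T l p pI T0) (@Data T l' p pI T0).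
Proof.
move=> e; apply: deq_trans (deq_nontriv_ctx [::] l pI T0) _.
by rewrite e; apply/deq_sym/(deq_nontriv_ctx [::]).
Qed.

(** Labels with the same top position are identified; the chord words then differ by trivial chords
    only. *)
Lemma rep_deq n (b : braid n) D D' : braid_rep b D -> braid_rep b D' -> deq D D'.
Proof.
case: D D' => [T l p pI T0] [T' l' p' pI' T0'] [e /= le [_ ce te]] [e' /= le' [_ ce' te']].
have [e_inj e_lt cT] := le; have [e'_inj e'_lt cT'] := le'.
have [f fE] : exists f : T -> T', forall t, e' (f t) = e t.
  apply: (@fin_all_exists _ (fun=> T') (fun t t' => e' t' = e t)) => t.
  exact: labeling_surj le' (e_lt t).
have f_inj : injective f by move=> t u eq; apply: e_inj; rewrite -!fE eq.
have f_bij : bijective f by apply: inj_card_bij; rewrite // cT cT'.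
pose D2 := @Data T' (map (pairmap2 f) l) p' pI' T0'.
apply: (@deq_trans D2).
  apply: deq_step; apply: (@DIso (@Data T l p pI T0) D2 f) => //= t; apply: e'_inj.
  by apply: (@track_inj b); rewrite te' !fE te.
apply: deq_nontriv; apply: (map_pairmap2_inj e'_inj); rewrite -ce' ce nontriv_map //.
by rewrite map_pairmap2_comp; apply: eq_map; apply: eq_pairmap2.
Qed.

Section BraidData.
Variables (n : nat) (n0 : 0 < n).

Definition ord_label (j : nat) : 'I_n := insubd (Ordinal n0) j.

Lemma ord_labelK j : j < n -> ord_label j = j :> nat.
Proof. by move=> jn; rewrite val_insubd jn. Qed.

Lemma val_labeling : labeling n (fun t : 'I_n => val t).
Proof. by split; [exact: val_inj | exact: ltn_ord | exact: card_ord]. Qed.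

Lemma ord_card : 0 < #|'I_n|. Proof. by rewrite card_ord. Qed.

Lemma val_chords l : all (fun c => (c.1 < n) && (c.2 < n)) l ->
  map (pairmap2 val) (map (pairmap2 ord_label) l) = l.
Proof.
elim: l => //= [[a b] l IHl] /andP[/andP[an bn] /IHl ->].
by rewrite /pairmap2 /= !ord_labelK.
Qed.

Definition braid_nx (w : seq gen) (t : 'I_n) : 'I_n := ord_label (track (rev w) t).

Lemma braid_nxE w t : in_fB n w -> braid_nx w t = track (rev w) t :> nat.
Proof. by move=> fw; rewrite ord_labelK // track_lt ?in_fB_rev. Qed.

Lemma braid_nx_inj w : in_fB n w -> injective (braid_nx w).
Proof.
by move=> fw t u /(congr1 val) /=; rewrite !braid_nxE // => /track_inj /val_inj.
Qed.

Lemma val_realizes w : in_fB n w ->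
  realizes n (fun t : 'I_n => val t) (map (pairmap2 ord_label) (chords w))
    ((fun t : 'I_n => val t) \o braid_nx w) w.
Proof.
move=> fw; split=> // [|t]; last by rewrite /= braid_nxE // track_revVK.
by rewrite -nontriv_map ?val_chords ?chords_lt //; apply: val_inj.
Qed.

Lemma fB_step_deq w w' (fw : in_fB n w) (fw' : in_fB n w') : fB_step n w w' ->
  deq (@Data _ (map (pairmap2 ord_label) (chords w)) _ (braid_nx_inj fw) ord_card)
      (@Data _ (map (pairmap2 ord_label) (chords w')) _ (braid_nx_inj fw') ord_card).
Proof.
move=> s; have st : fB_eq n w w' by apply: rst_step.
have et : braid_nx w =1 braid_nx w'.
  move=> t; congr ord_label; apply: (@track_inj w).
  by rewrite track_revVK (fB_track st) track_revVK.
apply: (@deq_trans (@Data _ (map (pairmap2 ord_label) (chords w')) _ (braid_nx_inj fw) ord_card)); last first.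
  exact: deq_ext.
move: (braid_nx_inj fw); move: (braid_nx w) => p pI {et}.
case: s fw st => u v l r lr fw st.
have elr : track l =1 track r by apply: fB_track; apply: fB_rel_eq lr.
move: fw; rewrite !in_fB_cat => /and3P[fu fl fv].
rewrite !chords_cat !map_cat !map_pairmap2_comp.
set U := map _ (chords u).
(* Both sides of the relation permute the strands in the same way, so the chords of [v] do not
   change. *)
have -> : [seq pairmap2 ((ord_label \o track u) \o track r) i | i <- chords v] =
   [seq pairmap2 ((ord_label \o track u) \o track l) i | i <- chords v].
  by apply: eq_map; apply: eq_pairmap2 => j /=; rewrite elr.
set V := map _ (chords v).
pose eta j := ord_label (track u j).
have eta_inj i j : i < n -> j < n -> (eta i == eta j) = (i == j).
  move=> hi hj; rewrite -val_eqE /= !ord_labelK ?track_lt //.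
  exact: inj_eq (@track_inj u) _ _.
rewrite -[ord_label \o track u]/eta.
have nt x y : nontriv x = nontriv y ->
    deq (@Data _ (U ++ x ++ V) p pI ord_card) (@Data _ (U ++ y ++ V) p pI ord_card).
  by move=> e; apply: deq_nontriv; rewrite !nontriv_cat e.
case: lr fl {elr st} => [i j hi hj fij|i j hi hj fij|i j hi hj fij|i hi|i hi|i hi|i hi|i hi|i hi] fl /=.
- have [s1 s2 s3 s4] : [/\ swap_pos i j = j, swap_pos i j.+1 = j.+1, swap_pos j i = i & swap_pos j i.+1 = i.+1].
    by split; case: swap_posP; move: fij; rewrite /far; lia.
  rewrite /pairmap2 /= s1 s2 s3 s4; apply: (@deq_local _ U [:: _; _] [:: _; _] V); apply: ChordComm.
  rewrite /= !inE !eta_inj; try by [lia]; move: fij; rewrite /far; lia.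
- by apply: (nt [:: _; _] [:: _; _]); rewrite /nontriv /= !eqxx.
- have [s1 s2] : swap_pos i j = j /\ swap_pos i j.+1 = j.+1.
    by split; case: swap_posP; move: fij; rewrite /far; lia.
  by apply: (nt [:: _; _] [:: _; _]); rewrite /pairmap2 /= s1 s2 /nontriv /= !eqxx.
- have [s1 s2 s3 s4] : [/\ swap_pos i i = i.+1, swap_pos i i.+1 = i, swap_pos i i.+2 = i.+2 & swap_pos i.+1 i = i].
    by split; case: swap_posP; lia.
  have [s5 s6] : swap_pos i.+1 i.+1 = i.+2 /\ swap_pos i.+1 i.+2 = i.+1.
    by split; case: swap_posP; lia.
  rewrite /pairmap2 /= !(s1, s2, s3, s4, s5, s6); apply: (@deq_local _ U [:: _; _; _] [:: _; _; _] V); apply: ChordTriangle.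
  by rewrite /= !inE !eta_inj; lia.
- by apply: (nt [:: _; _; _] [:: _; _; _]); rewrite /nontriv /= !eqxx.
- have [s1 s2 s3 s4] : [/\ swap_pos i i = i.+1, swap_pos i i.+1 = i, swap_pos i i.+2 = i.+2 & swap_pos i.+1 i = i].
    by split; case: swap_posP; lia.
  have [s5 s6] : swap_pos i.+1 i.+1 = i.+2 /\ swap_pos i.+1 i.+2 = i.+1.
    by split; case: swap_posP; lia.
  by apply: (nt [:: _; _; _] [:: _; _; _]); rewrite /pairmap2 /= !(s1, s2, s3, s4, s5, s6) /nontriv /= !eqxx.
- by apply: (nt [:: _; _] [::]); rewrite /nontriv /= !eqxx.
- have [s1 s2] : swap_pos i i = i.+1 /\ swap_pos i i.+1 = i by split; case: swap_posP; lia.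
  (* The first crossing exchanges the two strands, so the second chord reads [(b, a)] and has to be
     flipped. *)
  rewrite /pairmap2 /= s1 s2; set a := eta i; set b := eta i.+1.
  apply: (@deq_trans (@Data _ (U ++ [:: (a, b); (a, b)] ++ V) p pI ord_card)).
    by have := deq_local (U ++ [:: (a, b)]) V pI ord_card (ChordFlip b a); rewrite -!catA.
  exact: (deq_local U V pI ord_card (ChordSquare a b)).
have [s1 s2] : swap_pos i i = i.+1 /\ swap_pos i i.+1 = i by split; case: swap_posP; lia.
rewrite /pairmap2 /= s1 s2; set a := eta i; set b := eta i.+1.
apply: (@deq_trans (@Data _ (U ++ [:: (a, b)] ++ V) p pI ord_card)).
  by apply: (nt [:: _; _] [:: (a, b)]); rewrite /nontriv /= eqxx.
apply: deq_trans (deq_local U V pI ord_card (ChordFlip a b)) _.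
by apply: (nt [:: (b, a)] [:: _; _]); rewrite /nontriv /= eqxx.
Qed.

Lemma fB_rel_in l r : fB_rel n l r -> in_fB n l /\ in_fB n r.
Proof. by case=> * /=; split; lia. Qed.

Lemma fB_eq_deq w w' : fB_eq n w w' -> in_fB n w = in_fB n w' /\
  forall (fw : in_fB n w) (fw' : in_fB n w'),
  deq (@Data _ (map (pairmap2 ord_label) (chords w)) _ (braid_nx_inj fw) ord_card)
      (@Data _ (map (pairmap2 ord_label) (chords w')) _ (braid_nx_inj fw') ord_card).
Proof.
elim=> {w w'} [w w' s|w|w w' _ [e IH]|w1 w2 w3 _ [e1 IH1] _ [e2 IH2]].
- split; last by move=> fw fw'; apply: fB_step_deq.
  case: s => u v l r /fB_rel_in[hl hr]; by rewrite !in_fB_cat hl hr.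
- by split=> // fw fw'; apply: deq_ext.
- by split=> // fw fw'; apply/deq_sym/IH.
split=> [|fw1 fw3]; first by rewrite e1.
have fw2 : in_fB n w2 by rewrite -e1.
exact: deq_trans (IH1 _ fw2) (IH2 _ _).
Qed.

Lemma val_rep (b : braid n) (fb : in_fB n b) :
  braid_rep b (@Data _ (map (pairmap2 ord_label) (chords b)) _ (braid_nx_inj fb) ord_card).
Proof.
by exists (fun t : 'I_n => val t); [exact: val_labeling | exact: val_realizes].
Qed.

End BraidData.

Lemma braid_in n (b : braid n) : 0 < n /\ in_fB n b.
Proof. by apply/andP; apply: bwordP. Qed.

Lemma realizes_strand n (T : finType) (e f : T -> nat) l w k w' q : in_fB n.+1 w' ->
  virtual_strand w k w' q -> realizes n e l f w ->
  realizes n.+1 (cut_top k e) (map (pairmap2 Some) l) (cut_top q f) w'.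
Proof.
move=> fw' /virtual_strandP[t1 t2 c1] [fw cw tw]; split=> // [|[u|]] //=; last by rewrite t2 tw.
rewrite c1 cw nontriv_map; last by move=> x y [].
by rewrite !map_pairmap2_comp.
Qed.

Lemma cut_swap_lab (T : finType) (s u : T) : cut_swap s (cut_lab s u) = Some u.
Proof. by rewrite /cut_lab; case: (eqVneq u s) => [->|ns] //=; rewrite (negPf ns). Qed.

Lemma L_move_rep n (T : finType) (e f : T -> nat) l1 l2 p (pI : injective p) s w1 w2 w1' w2' k q loc lc :
  labeling n e -> k <= n -> realizes n e l1 f w1 -> realizes n f l2 (e \o p) w2 ->
  virtual_strand w1 k w1' q -> virtual_strand w2 q w2' k -> in_fB n.+1 (w1' ++ loc ++ w2') ->
  realizes n.+1 (cut_top q f) lc (cut_top q f \o cut_swap s) loc ->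
  exists2 e', labeling n.+1 e' & realizes n.+1 e' (cut_chords s l1 lc l2) (e' \o cut_nx s p) (w1' ++ loc ++ w2').
Proof.
move=> le kn r1 r2 v1 v2; rewrite !in_fB_cat => /and3P[fw1 _ fw2] rl.
exists (cut_top k e); first exact: cut_top_labeling.
apply: realizes_cat (realizes_strand fw1 v1 r1) _; apply: realizes_cat rl _.
have := realizes_strand fw2 v2 r2.
rewrite [map _ l2](_ : _ = map (pairmap2 (cut_swap s)) (map (pairmap2 (cut_lab s)) l2)); last first.
  by rewrite map_pairmap2_comp; apply: eq_map; apply: eq_pairmap2 => u; rewrite /= cut_swap_lab.
move/(realizes_comp (can_inj (@cut_swapK _ s))); apply: realizes_ext => // -[u|] //=.
by case: (eqVneq u s).
Qed.

(* The local picture exchanges the cut arc, in position [js] before the new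
   strand is inserted, and the new strand in position [q]. *)
Lemma local_track (T : finType) (f : T -> nat) s q js loc : injective f -> f s = js ->
  (forall i, i <> js -> track loc (bump q i) = bump q i) -> track loc (bump q js) = q ->
  track loc q = bump q js -> forall x, track loc ((cut_top q f \o cut_swap s) x) = cut_top q f x.
Proof.
move=> f_inj fs out e1 e2 [u|] /=; last by rewrite fs.
case: (eqVneq u s) => [->|ns] /=; first by rewrite fs.
by rewrite out // -fs => /f_inj e; rewrite e eqxx in ns.
Qed.

(** [js] is the position of the cut arc. The chords [lcf] of the local picture depend on the
    positions [f] at the level of the cut, because the thread is given as the strand next to the cut
    arc. *)
Lemma L_move_deq n (b : braid n) (b' : braid n.+1) loc q js D D' lcf :
  L_move loc q b b' -> js < n -> 
  (forall i, i <> js -> track loc (bump q i) = bump q i) -> track loc (bump q js) = q ->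
  track loc q = bump q js ->
  (forall (T : finType) (f : T -> nat) s, labeling n f -> f s = js ->
     nontriv (chords loc) = map (pairmap2 (cut_top q f)) (nontriv (lcf T f s))) ->
  (forall (T : finType) (f : T -> nat) s l1 l2 p (pI : injective p) T0, labeling n f -> f s = js ->
     deq (@Data T (l1 ++ l2) p pI T0) (cut_data l1 l2 pI s (lcf T f s))) ->
  braid_rep b D -> braid_rep b' D' -> deq D D'.
Proof.
move=> [w1 [w2 [w1' [w2' [k [eb v1 v2 eb']]]]]] jn out e1 e2 cl dq rb rb'.
have [n0 fb] := braid_in b; have [_ fb'] := braid_in b'.
have [fw1 fw2] : in_fB n w1 /\ in_fB n w2 by apply/andP; rewrite -in_fB_cat -eb.
have le := val_labeling n.
pose ol := ord_label n0; pose f (t : 'I_n) := track (rev w1) t.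
have lf : labeling n f by apply: labeling_track => //; rewrite in_fB_rev.
have [s fs] : exists s, f s = js by apply: labeling_surj lf jn.
have pI := @braid_nx_inj n n0 b fb; set p := braid_nx n0 b in pI.
pose l1 := map (pairmap2 ol) (chords w1); pose l2 := map (pairmap2 (ol \o track w1)) (chords w2).
have r1 : realizes n (fun t : 'I_n => val t) l1 f w1.
  split=> // [|t]; last by rewrite /f track_revVK.
  by rewrite -nontriv_map ?val_chords ?chords_lt //; apply: val_inj.
have r2 : realizes n f l2 ((fun t : 'I_n => val t) \o p) w2.
  split=> // [|t]; last first.
    by apply: (@track_inj w1); rewrite /= -track_cat -eb braid_nxE // /f !track_revVK.
  rewrite -nontriv_map; last by case: lf.
  congr nontriv; rewrite map_pairmap2_comp -[LHS]map_id; apply/eq_in_map => -[i j] ij.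
  have /andP[ii jj] := allP (chords_lt fw2) _ ij.
  by rewrite /pairmap2 /= /f !ord_labelK ?track_lt // !track_revK.
(* Followed upwards from the new lower endpoint, the strand reaches the top in the position of an
   old strand, which is at most [n]; since [track] respects the bound [n.+1], so does [k]. *)
have kn : k <= n.
  have := track_lt k fb'; rewrite eb' !track_cat; case: (virtual_strandP v2) => -> _ _.
  rewrite e2; case: (virtual_strandP v1) => _ -> _ /esym; rewrite ltnS => ->.
  rewrite -ltnS; have lt := track_lt js fw1; rewrite jn in lt.
  by rewrite /bump; lia.
have rl : realizes n.+1 (cut_top q f) (lcf _ f s) (cut_top q f \o cut_swap s) loc.
  split; [|exact: cl|by apply: (local_track _ fs) => //; case: lf].
  by move: fb'; rewrite eb' !in_fB_cat => /and3P[].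
have [|e' le' re'] := L_move_rep pI le kn r1 r2 v1 v2 _ rl; first by rewrite -eb'.
apply: (@deq_trans (@Data _ (l1 ++ l2) p pI (ord_card n0))).
  apply: rep_deq rb _; exists (fun t : 'I_n => val t) => //=.
  by rewrite eb; apply: realizes_cat r1 r2.
apply: deq_trans (dq _ _ _ l1 l2 p pI _ lf fs) _.
by apply: rep_deq rb'; exists e'; rewrite // eb'.
Qed.

Lemma deq_cut (T : finType) l1 l2 p (pI : injective p) T0 (s : T) lc : cut_local s lc ->
  deq (@Data T (l1 ++ l2) p pI T0) (cut_data l1 l2 pI s lc).
Proof. by move=> hlc; apply: deq_step; apply: DCut. Qed.

Lemma braid_move_deq x y D D' : braid_move x y ->
  braid_rep (projT2 x) D -> braid_rep (projT2 y) D' -> deq D D'.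
Proof.
case=> {x y} /= [n b b' e|n b b' i hi eb'|n b b' j hj L|n b b' j hj L|n b b' j hj L|n b b' j hj L] rb rb'.
- have [n0 fb] := braid_in b; have [_ fb'] := braid_in b'.
  apply: deq_trans (rep_deq rb (@val_rep n n0 b fb)) _; apply: deq_trans (rep_deq (@val_rep n n0 b' fb') rb').
  exact: (fB_eq_deq n0 e).2.
- have [n0 fb] := braid_in b; have [_ fb'] := braid_in b'.
  apply: deq_trans (rep_deq rb (@val_rep n n0 b fb)) _; apply: deq_sym.
  set l := map _ _; set pI := @braid_nx_inj n n0 b fb; set T0 := ord_card n0; set p := braid_nx n0 b in pI *.
  (* The strands that end in positions [i] and [i.+1]; their successors begin there. In the new word
     each strand is named by its position just below the first crossing, whence the labeling by
     [swap_pos i]. *)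
  pose u := ord_label n0 (track b i); pose v := ord_label n0 (track b i.+1).
  have pE j : j < n -> p (ord_label n0 (track b j)) = j :> nat.
    by move=> jn; rewrite braid_nxE // ord_labelK ?track_lt // track_revK.
  pose D2 := @Data _ ((p v, p u) :: l ++ [:: (u, v)]) p pI T0.
  have fS : in_fB n [:: Zet i] by rewrite /= hi.
  apply: (@deq_trans D2).
    apply: rep_deq rb' _; exists (swap_pos i \o (fun t : 'I_n => val t)).
      exact: (labeling_track fS (val_labeling n)).
    rewrite eb' -cats1 -[Sig i :: _]/([:: Sig i] ++ _).
    apply: (@realizes_cat _ _ _ (fun t : 'I_n => val t) _ [:: (p v, p u)]).
      split; rewrite /= ?hi //; first last.
      rewrite /nontriv /= (inj_eq pI) -val_eqE /= !ord_labelK ?track_lt //; try by lia.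
      rewrite (inj_eq (@track_inj b)) ltn_eqF // gtn_eqF //= /pairmap2 /= /u /v !pE; try by lia.
      by congr [:: (_, _)]; case: swap_posP; lia.
    apply: (@realizes_cat _ _ _ ((fun t : 'I_n => val t) \o p)); first exact: val_realizes.
    split; rewrite /= ?hi //; first last.
      by move=> t; rewrite swap_posK.
    rewrite /nontriv /= -val_eqE /= !ord_labelK ?track_lt //; try by lia.
    by rewrite (inj_eq (@track_inj b)) !ltn_eqF //= /pairmap2 /= /u /v !pE //; lia.
  apply: (@deq_trans (@Data _ ((p u, p v) :: l ++ [:: (u, v)]) p pI T0)).
    exact: (deq_local [::] (l ++ [:: (u, v)]) pI T0 (ChordFlip (p v) (p u))).
  apply: (@deq_trans (@Data _ (l ++ [:: (u, v); (u, v)] ++ [::]) p pI T0)); last first.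
    by apply: deq_trans (deq_local l [::] pI T0 (ChordSquare u v)) _; rewrite !cats0; apply: deq_refl.
  (* The first chord rotates to the end, where it forms a square with the chord of the last
     crossing. *)
  rewrite -[l ++ _ ++ _]/(l ++ [:: (u, v)] ++ [:: (u, v)]) catA.
  by apply: deq_step; apply: DRot.
- apply: (L_move_deq (lcf := fun _ _ _ => [::]) L hj) rb rb'.
  + by move=> i ij; rewrite /= /bump; case: swap_posP; lia.
  + by rewrite /= /bump; case: swap_posP; lia.
  + by rewrite /= /bump; case: swap_posP; lia.
  + by move=> *; rewrite /= /nontriv /= eqxx.
  by move=> T f s l1 l2 p pI T0 _ _; apply: deq_cut; apply: CutVirtual.
- apply: (L_move_deq (lcf := fun _ _ s => [:: (Some s, None)]) L hj) rb rb'.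
  + by move=> i ij; rewrite /= /bump; case: swap_posP; lia.
  + by rewrite /= /bump; case: swap_posP; lia.
  + by rewrite /= /bump; case: swap_posP; lia.
  + move=> T f s _ fs; rewrite /nontriv /= ltn_eqF //= /pairmap2 /= fs.
    by congr [:: (_, _)]; rewrite /bump; lia.
  by move=> T f s l1 l2 p pI T0 _ _; apply: deq_cut; apply: CutFlat.
- pose th (T : finType) (f : T -> nat) (s : T) := odflt s [pick t | f t == j.+1].
  have thE (T : finType) (f : T -> nat) s : labeling n f -> f (th T f s) = j.+1.
    move=> lf; rewrite /th; case: pickP => [t /eqP //|]; have [t <-] := labeling_surj lf hj.
    by move/(_ t); rewrite eqxx.
  have thN (T : finType) (f : T -> nat) s : labeling n f -> f s = j -> th T f s != s.
    by move=> lf fs; apply/eqP => e; have := thE _ f s lf; rewrite e fs; lia.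
  apply: (L_move_deq (lcf := fun T f s => [:: (Some (th T f s), None); (Some s, Some (th T f s))]) L (ltnW hj)) rb rb'.
  + by move=> i ij; rewrite /= /bump; do 3!case: swap_posP; lia.
  + by rewrite /= /bump; do 3!case: swap_posP; lia.
  + by rewrite /= /bump; do 3!case: swap_posP; lia.
  + move=> T f s lf fs; have nst : Some s != Some (th T f s).
      by rewrite eq_sym; apply: contra (thN _ f s lf fs) => /eqP[/eqP].
    rewrite /nontriv /= eqxx nst /= ltn_eqF //= !(inj_eq (@swap_pos_inj _)) ltn_eqF //=.
    rewrite /pairmap2 /= fs thE //; congr [:: (_, _); (_, _)]; rewrite /bump; try lia.
      by do 2!case: swap_posP; lia.
    by do 2!case: swap_posP; lia.
  by move=> T f s l1 l2 p pI T0 lf fs; apply: deq_cut; apply: CutThreaded; apply: thN.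
pose th (T : finType) (f : T -> nat) (s : T) := odflt s [pick t | f t == j].
have thE (T : finType) (f : T -> nat) s : labeling n f -> f (th T f s) = j.
  move=> lf; rewrite /th; case: pickP => [t /eqP //|]; have [t <-] := labeling_surj lf (ltnW hj).
  by move/(_ t); rewrite eqxx.
have thN (T : finType) (f : T -> nat) s : labeling n f -> f s = j.+1 -> th T f s != s.
  by move=> lf fs; apply/eqP => e; have := thE _ f s lf; rewrite e fs; lia.
apply: (L_move_deq (lcf := fun T f s => [:: (None, Some (th T f s)); (Some (th T f s), Some s)]) L hj) rb rb'.
- by move=> i ij; rewrite /= /bump; do 3!case: swap_posP; lia.
- by rewrite /= /bump; do 3!case: swap_posP; lia.
- by rewrite /= /bump; do 3!case: swap_posP; lia.
- move=> T f s lf fs; have nst : Some (th T f s) != Some s.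
    by apply: contra (thN _ f s lf fs) => /eqP[/eqP].
  rewrite /nontriv /= eqxx nst /= ltn_eqF //= !(inj_eq (@swap_pos_inj _)) ltn_eqF //=.
  rewrite /pairmap2 /= fs thE //; congr [:: (_, _); (_, _)]; rewrite /bump; try lia.
    by do 2!case: swap_posP; lia.
  by do 2!case: swap_posP; lia.
(* Up to flips the chords of the left threaded picture are those of the right one, with the same
   thread [t]. *)
move=> T f s l1 l2 p pI T0 lf fs; set t := th T f s; have tn : t != s by apply: thN.
apply: deq_trans (deq_cut l1 l2 pI T0 (CutThreaded tn)) _.
rewrite /cut_data /cut_chords.
set L1 := map _ l1; set L2 := map _ l2.
apply: deq_trans (deq_local L1 ((Some s, Some t) :: L2) _ _ (ChordFlip (Some t) None)) _.
have := deq_local (L1 ++ [:: (None, Some t)]) L2 (cut_nx_inj (s := s) pI) (cut_gt0 T) (ChordFlip (Some s) (Some t)).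
by rewrite -!catA.
Qed.

Lemma L_equiv_deq n m (b : braid n) (b' : braid m) D D' : L_equiv b b' ->
  braid_rep b D -> braid_rep b' D' -> deq D D'.
Proof.
have gen x y : clos_refl_sym_trans {n : nat & braid n} braid_move x y ->
    forall D D', braid_rep (projT2 x) D -> braid_rep (projT2 y) D' -> deq D D'.
  elim=> {x y} [x y s|x|x y _ IH|x y z _ IH1 _ IH2] D1 D2 r1 r2.
  - exact: braid_move_deq s r1 r2.
  - exact: rep_deq r1 r2.
  - exact/deq_sym/IH.
  case: y IH1 IH2 => k c IH1 IH2.
  have [k0 fc] := braid_in c; have rc := @val_rep k k0 c fc.
  exact: deq_trans (IH1 _ _ r1 rc) (IH2 _ _ rc r2).
by move=> e rb rb'; apply: (gen _ _ e).
Qed.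

Lemma L_equiv_isotopic n m (b : braid n) (b' : braid m) :
  L_equiv b b' -> isotopic (braid_closure b) (braid_closure b').
Proof.
move=> e; have [n0 fb] := braid_in b; have [m0 fb'] := braid_in b'.
have rb := @val_rep n n0 b fb; have rb' := @val_rep m m0 b' fb'.
exact: deq_isotopic (L_equiv_deq e rb rb') (closure_data_graph rb) (closure_data_graph rb').
Qed.
(** * Merging consecutive strands *)

Definition labels (T : Type) (l : seq (T * T)) : seq T := flatten [seq [:: c.1; c.2] | c <- l].

Lemma labels_cat (T : Type) (u v : seq (T * T)) : labels (u ++ v) = labels u ++ labels v.
Proof. by rewrite /labels map_cat flatten_cat. Qed.

Lemma labels_map (T T' : Type) (f : T -> T') l : labels (map (pairmap2 f) l) = map f (labels l).
Proof. by elim: l => //= c l IHl; rewrite -IHl. Qed.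

Lemma map_labels_eq (T T' : eqType) (f g : T -> T') l :
  {in labels l, f =1 g} -> map (pairmap2 f) l = map (pairmap2 g) l.
Proof.
elim: l => //= -[a b] l IHl fg; rewrite IHl; last by move=> x xl; apply: fg; rewrite !inE xl !orbT.
by rewrite /pairmap2 /= !fg // !inE eqxx ?orbT.
Qed.

Section Merge.
Variables (T : finType) (p : T -> T) (pI : injective p) (T0 : 0 < #|T|) (s : T).
Hypothesis nps : p s != s.

(** The strands [s] and [p s] become one strand, which keeps the name [s]. *)
Definition merge_lab : finType := {t : T | t != p s}.

Definition merge_s : merge_lab := exist _ s (introT (negPP eqP) (fun e : s = p s => negP nps (introT eqP (esym e)))).

Definition merged (t : T) : merge_lab := insubd merge_s t.

Definition merge_nx (u : merge_lab) : merge_lab := merged (p (if val u == s then p s else val u)).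

Lemma val_merge t : t != p s -> val (merged t) = t.
Proof. by move=> nt; rewrite val_insubd nt. Qed.

Lemma merge_ps : merged (p s) = merge_s.
Proof. by apply: val_inj; rewrite val_insubd eqxx. Qed.

Lemma merge_s_eq : merged s = merge_s.
Proof. by apply: val_inj; rewrite val_merge // eq_sym. Qed.

Lemma merge_nxE u : val (merge_nx u) = p (if val u == s then p s else val u).
Proof.
apply: val_merge; rewrite (inj_eq pI); case: ifP => [_|/negbT //]; exact: nps.
Qed.

Lemma merge_nx_inj : injective merge_nx.
Proof.
move=> u v /(congr1 val); rewrite !merge_nxE => /pI e; apply: val_inj; move: e.
by case: eqP => [->|_]; case: eqP => [->|_] // e; [have := valP v | have := valP u]; rewrite /= -?e ?e eqxx.
Qed.

Lemma merge_gt0 : 0 < #|merge_lab|.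
Proof. by apply/card_gt0P; exists merge_s. Qed.

Lemma card_merge : #|merge_lab| < #|T|.
Proof.
rewrite card_sig (@eq_card _ _ (predC1 (p s))) // cardC1 ltn_predL.
exact: T0.
Qed.

(** Cutting the merged strand again gives back the old strands, [p s] being the lower part. *)
Let phi (x : option merge_lab) : T := if x is Some u then val u else p s.

Let phi_bij : bijective phi.
Proof.
exists (fun t => if t == p s then None else Some (merged t)) => [[u|]|t] /=.
- by rewrite (negPf (valP u)); congr Some; apply: val_inj; rewrite val_merge ?(valP u).
- by rewrite eqxx.
by case: (eqVneq t (p s)) => [->|nt] //=; rewrite val_merge.
Qed.

Let phi_nx x : p (phi x) = phi (cut_nx merge_s merge_nx x).
Proof.
case: x => [u|] /=; last by rewrite merge_nxE eqxx.
rewrite -val_eqE /=; case: (eqVneq (val u) s) => [->|nu] //=.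
by rewrite merge_nxE (negPf nu).
Qed.

Let phi_chords l1 lc l2 : s \notin labels l2 -> p s \notin labels l1 ->
  map (pairmap2 phi) (cut_chords merge_s (map (pairmap2 merged) l1) lc (map (pairmap2 merged) l2)) =
  l1 ++ map (pairmap2 phi) lc ++ l2.
Proof.
move=> sl2 xl1; rewrite /cut_chords !map_cat !map_pairmap2_comp; congr (_ ++ (_ ++ _)).
  rewrite -[RHS]map_id; transitivity (map (pairmap2 id) l1); last by apply: eq_map; case.
  apply: map_labels_eq => t tl /=; rewrite val_merge //.
  by apply: contraNneq xl1 => <-.
rewrite -[RHS]map_id; transitivity (map (pairmap2 id) l2); last by apply: eq_map; case.
apply: map_labels_eq => t tl; rewrite /= /cut_lab -val_eqE /=.
have nts : t != s by apply: contraNneq sl2 => <-.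
case: (eqVneq t (p s)) => [->|nt]; first by rewrite merge_ps eqxx.
by rewrite val_merge // (negPf nts) /= val_merge.
Qed.

Lemma deq_merge_cut l1 lc l2 : s \notin labels l2 -> p s \notin labels l1 ->
  deq (@Data T (l1 ++ map (pairmap2 phi) lc ++ l2) p pI T0)
    (cut_data (map (pairmap2 merged) l1) (map (pairmap2 merged) l2) merge_nx_inj merge_s lc).
Proof.
move=> sl2 xl1; apply: deq_sym; apply: deq_step.
apply: (@DIso (cut_data (map (pairmap2 merged) l1) (map (pairmap2 merged) l2) merge_nx_inj merge_s lc)
  (@Data T (l1 ++ map (pairmap2 phi) lc ++ l2) p pI T0) phi) => //=; last by rewrite phi_chords.

Qed.

Lemma deq_merge_local l1 lc l2 : s \notin labels l2 -> p s \notin labels l1 -> cut_local merge_s lc ->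
  deq (@Data T (l1 ++ map (pairmap2 phi) lc ++ l2) p pI T0)
    (@Data merge_lab (map (pairmap2 merged) (l1 ++ l2)) merge_nx merge_nx_inj merge_gt0).
Proof.
move=> sl2 xl1 hlc; apply: deq_trans (deq_merge_cut lc sl2 xl1) _; rewrite map_cat.
exact/deq_sym/deq_cut.
Qed.

(** The crossings of [s] all lie before those of [p s], as they do for the two parts of a strand cut
    between [l1] and [l2]; merging is a virtual L-move read backwards. *)
Lemma deq_merge l1 l2 : s \notin labels l2 -> p s \notin labels l1 ->
  deq (@Data T (l1 ++ l2) p pI T0)
    (@Data merge_lab (map (pairmap2 merged) (l1 ++ l2)) merge_nx merge_nx_inj merge_gt0).
Proof. by move=> sl2 xl1; apply: (deq_merge_local sl2 xl1 (CutVirtual _)). Qed.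

Lemma graph_merge G l1 l2 : s \notin labels l2 -> p s \notin labels l1 ->
  word_graph G (l1 ++ l2) p <-> word_graph G (map (pairmap2 merged) (l1 ++ l2)) merge_nx.
Proof.
move=> sl2 xl1; rewrite map_cat -(word_graph_cut _ merge_s) ?(word_graph_iso G _ phi_bij) //.
- rewrite -(@word_graph_iso G _ _ phi (cut_chords merge_s (map (pairmap2 merged) l1) [::] (map (pairmap2 merged) l2))
    (cut_nx merge_s merge_nx) p) ?phi_chords //; last exact: cut_nx_inj merge_nx_inj.
- exact: merge_nx_inj.
Qed.

Lemma deq_loop l1 l2 : s \notin labels l2 -> p s \notin labels l1 ->
  deq (@Data T (l1 ++ [:: (s, p s)] ++ l2) p pI T0) (@Data T (l1 ++ l2) p pI T0).
Proof.
move=> sl2 xl1; apply: deq_trans (deq_sym (deq_merge sl2 xl1)).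
exact: (deq_merge_local sl2 xl1 (CutFlat _)).
Qed.

Lemma deq_bigon t l1 l2 : s \notin labels l2 -> p s \notin labels l1 -> t != s -> t != p s ->
  deq (@Data T (l1 ++ [:: (t, p s); (s, t)] ++ l2) p pI T0) (@Data T (l1 ++ l2) p pI T0).
Proof.
move=> sl2 xl1 ts tx; apply: deq_trans (deq_sym (deq_merge sl2 xl1)).
have tn : merged t != merge_s by rewrite -val_eqE /= val_merge.
have := deq_merge_local sl2 xl1 (CutThreaded tn).
by rewrite /= /pairmap2 /= val_merge.
Qed.

(** The two words become equal when [s] and [p s] are merged, above the chord in one case and below
    it in the other. *)
Lemma deq_slide y l1 l2 : s \notin labels l2 -> p s \notin labels l1 -> y != s -> y != p s ->
  deq (@Data T (l1 ++ [:: (s, y)] ++ l2) p pI T0) (@Data T (l1 ++ [:: (p s, y)] ++ l2) p pI T0).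
Proof.
move=> sl2 xl1 ys yx; rewrite catA; apply: deq_trans (deq_merge _ _) _ => //.
  by rewrite labels_cat mem_cat (negPf xl1) /= !inE negb_or (negPf nps) eq_sym yx.
apply: deq_trans (deq_sym (deq_merge _ xl1)); last first.
  by rewrite /= !inE !negb_or eq_sym nps eq_sym ys.
by rewrite !map_cat -catA /= /pairmap2 /= merge_ps merge_s_eq; apply: deq_refl.
Qed.

End Merge.

Lemma deq_slide_r (T : finType) (p : T -> T) (pI : injective p) T0 s y l1 l2 : p s != s ->
  s \notin labels l2 -> p s \notin labels l1 -> y != s -> y != p s ->
  deq (@Data T (l1 ++ [:: (y, s)] ++ l2) p pI T0) (@Data T (l1 ++ [:: (y, p s)] ++ l2) p pI T0).
Proof.
move=> nps sl2 xl1 ys yx.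
apply: deq_trans (deq_local _ _ _ _ (ChordFlip y s)) _.
apply: deq_trans (deq_slide _ _ nps sl2 xl1 ys yx) _.
exact: deq_local (ChordFlip _ _).
Qed.

(** * Bigons and triangles in chord words *)

Section Derived.
Variables (T : finType) (p : T -> T) (pI : injective p) (T0 : 0 < #|T|).

Let D l := @Data T l p pI T0.

Let slide a y l1 l2 : p a != a -> a \notin labels l2 -> p a \notin labels l1 -> y != a -> y != p a ->
  deq (D (l1 ++ [:: (a, y)] ++ l2)) (D (l1 ++ [:: (p a, y)] ++ l2)).
Proof. by move=> *; apply: deq_slide. Qed.

Let slide_r a y l1 l2 : p a != a -> a \notin labels l2 -> p a \notin labels l1 -> y != a -> y != p a ->
  deq (D (l1 ++ [:: (y, a)] ++ l2)) (D (l1 ++ [:: (y, p a)] ++ l2)).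
Proof. by move=> *; apply: deq_slide_r. Qed.

Let flip a b l1 l2 : deq (D (l1 ++ [:: (a, b)] ++ l2)) (D (l1 ++ [:: (b, a)] ++ l2)).
Proof. exact/deq_local/ChordFlip. Qed.

(** Both arcs meet the two chords in the same order, so the chords slide to the same pair of strands
    and form a square. *)
Lemma deq_parallel a b l : uniq [:: a; p a; b; p b] -> a \notin labels l -> b \notin labels l ->
  deq (D [:: (a, b), (p a, p b) & l]) (D l).
Proof.
move=> U al bl; have sym (x y : T) : x != y -> y != x by rewrite eq_sym.
move: U; rewrite /= !inE !negb_or => /and4P[/and3P[n1 n2 n3] /andP[n4 n5] n6 _].
have nE := (n1, n2, n3, n4, n5, n6).
have nE' := (sym _ _ n1, sym _ _ n2, sym _ _ n3, sym _ _ n4, sym _ _ n5, sym _ _ n6).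
apply: (@deq_trans (D [:: (a, b), (a, p b) & l])).
  apply: deq_sym; apply: (slide (l1 := [:: (a, b)]) (l2 := l));
  by rewrite /= ?inE ?negb_or ?nE ?nE'.
apply: (@deq_trans (D [:: (a, b), (a, b) & l])); last exact: (deq_local [::] l pI T0 (ChordSquare a b)).
apply: deq_sym; apply: (slide_r (l1 := [:: (a, b)]) (l2 := l));
by rewrite /= ?inE ?negb_or ?nE ?nE'.
Qed.

(** The arcs meet the two chords in opposite orders. Only the first is gathered on one strand, [a],
    and it serves as the thread of a threaded move that cuts the other. *)
Lemma deq_antiparallel a b l : uniq [:: a; p a; b; p b] -> a \notin labels l -> b \notin labels l ->
  deq (D [:: (a, p b), (p a, b) & l]) (D l).
Proof.
move=> U al bl; have sym (x y : T) : x != y -> y != x by rewrite eq_sym.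
move: U; rewrite /= !inE !negb_or => /and4P[/and3P[n1 n2 n3] /andP[n4 n5] n6 _].
have nE := (n1, n2, n3, n4, n5, n6).
have nE' := (sym _ _ n1, sym _ _ n2, sym _ _ n3, sym _ _ n4, sym _ _ n5, sym _ _ n6).
apply: (@deq_trans (D [:: (a, p b), (a, b) & l])).
  apply: deq_sym; apply: (slide (l1 := [:: (a, p b)]) (l2 := l));
  by rewrite /= ?inE ?negb_or ?nE ?nE'.
apply: (@deq_trans (D [:: (a, p b), (b, a) & l])); first exact: (flip _ _ [:: (a, p b)] l).
apply: (deq_bigon pI T0 _ (s := b) (t := a) (l1 := [::]) (l2 := l));
by rewrite /= ?inE ?negb_or ?nE ?nE'.
Qed.

(** Each arc meets its two chords in the order of the list, so all three can be gathered on the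
    single strands [a], [b] and [c], where [ChordTriangle] applies. *)
Lemma deq_acyclic a b c l : uniq [:: a; p a; b; p b; c; p c] ->
  a \notin labels l -> b \notin labels l -> c \notin labels l ->
  deq (D [:: (a, c), (p a, b), (p b, p c) & l]) (D [:: (b, c), (a, p b), (p a, p c) & l]).
Proof.
move=> U al bl cl; have sym (x y : T) : x != y -> y != x by rewrite eq_sym.
move: U; rewrite /= !inE !negb_or => /and5P[/and5P[n1 n2 n3 n4 n5] /and4P[n6 n7 n8 n9]
  /and3P[n10 n11 n12] /andP[n13 n14] /andP[n15 _]].
have nE := (n1, n2, n3, n4, n5, n6, n7, n8, n9, (n10, n11, n12, n13, n14, n15)).
have nE' := (sym _ _ n1, sym _ _ n2, sym _ _ n3, sym _ _ n4, sym _ _ n5, sym _ _ n6, sym _ _ n7, sym _ _ n8,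
  sym _ _ n9, (sym _ _ n10, sym _ _ n11, sym _ _ n12, sym _ _ n13, sym _ _ n14, sym _ _ n15)).
have mid : deq (D [:: (a, c), (p a, b), (p b, p c) & l]) (D [:: (a, c), (a, b), (b, c) & l]).
  apply: (@deq_trans (D [:: (a, c), (a, b), (p b, p c) & l])).
    apply: deq_sym; apply: (slide (l1 := [:: (a, c)]) (l2 := (p b, p c) :: l));
    by rewrite /= ?inE ?negb_or ?nE ?nE'.
  apply: (@deq_trans (D [:: (a, c), (a, b), (b, p c) & l])).
    apply: deq_sym; apply: (slide (l1 := [:: (a, c); (a, b)]) (l2 := l));
    by rewrite /= ?inE ?negb_or ?nE ?nE'.
  apply: deq_sym; apply: (slide_r (l1 := [:: (a, c); (a, b)]) (l2 := l));
  by rewrite /= ?inE ?negb_or ?nE ?nE'.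
have end_ : deq (D [:: (b, c), (a, b), (a, c) & l]) (D [:: (b, c), (a, p b), (p a, p c) & l]).
  apply: (@deq_trans (D [:: (b, c), (a, p b), (a, c) & l])).
    by apply: (slide_r (l1 := [:: (b, c)]) (l2 := (a, c) :: l));
    rewrite /= ?inE ?negb_or ?nE ?nE'.
  apply: (@deq_trans (D [:: (b, c), (a, p b), (a, p c) & l])).
    by apply: (slide_r (l1 := [:: (b, c); (a, p b)]) (l2 := l));
    rewrite /= ?inE ?negb_or ?nE ?nE'.
  by apply: (slide (l1 := [:: (b, c); (a, p b)]) (l2 := l));
  rewrite /= ?inE ?negb_or ?nE ?nE'.
apply: deq_trans mid _; apply: deq_trans end_.
apply: (@deq_trans (D [:: (a, c), (a, b), (c, b) & l])); first exact: (flip _ _ [:: (a, c); (a, b)] l).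
apply: (@deq_trans (D [:: (c, b), (a, b), (a, c) & l])); last exact: (flip _ _ [::] _).
apply: (deq_local [::] l pI T0 (@ChordTriangle _ a c b _)).
by rewrite /= !inE !negb_or ?nE ?nE'.
Qed.

(* The cyclic triangle is reduced to an acyclic one by adding a bigon with the
   strand [c], whose beginning is moved to the empty strand [c0]. *)
Lemma deq_cyclic_spare a b c c0 l : p c0 = c -> uniq [:: c0; a; p a; b; p b; c; p c] ->
  {in [:: c0; a; b; c], forall x, x \notin labels l} ->
  deq (D [:: (a, p c), (p a, b), (p b, c) & l]) (D [:: (b, p c), (a, p b), (c, p a) & l]).
Proof.
move=> pc0 U out; have [c0l al bl cl] : [/\ c0 \notin labels l, a \notin labels l, b \notin labels l & c \notin labels l].
  by split; apply: out; rewrite !inE !eqxx ?orbT.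
have sym (x y : T) : x != y -> y != x by rewrite eq_sym.
move: U; rewrite /= !inE !negb_or => /and5P[/and5P[m1 m2 m3 m4 /andP[m5 m6]] /and5P[n1 n2 n3 n4 n5] /and4P[n6 n7 n8 n9]
  /and3P[n10 n11 n12] /and3P[/andP[n13 n14] n15 _]].
have nE := (n1, n2, n3, n4, n5, n6, n7, n8, n9, (n10, n11, n12, n13, n14, n15), (m1, m2, m3, m4, m5, m6)).
have nE' := (sym _ _ n1, sym _ _ n2, sym _ _ n3, sym _ _ n4, sym _ _ n5, sym _ _ n6, sym _ _ n7, sym _ _ n8,
  sym _ _ n9, (sym _ _ n10, sym _ _ n11, sym _ _ n12, sym _ _ n13, sym _ _ n14, sym _ _ n15),
  (sym _ _ m1, sym _ _ m2, sym _ _ m3, sym _ _ m4, sym _ _ m5, sym _ _ m6)).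
have start : deq (D [:: (a, p c), (p a, b), (p b, c) & l]) (D [:: (a, p c), (a, b), (b, c) & l]).
  apply: (@deq_trans (D [:: (a, p c), (a, b), (p b, c) & l])).
    apply: deq_sym; apply: (slide (l1 := [:: (a, p c)]) (l2 := (p b, c) :: l));
    by rewrite /= ?inE ?negb_or ?nE ?nE'.
  apply: deq_sym; apply: (slide (l1 := [:: (a, p c); (a, b)]) (l2 := l));
  by rewrite /= ?inE ?negb_or ?nE ?nE'.
have nps : p c0 != c0 by rewrite pc0 nE'.
(* The triangle relation needs a chord of [a] and [c] between the other two; it is supplied by a
   bigon with thread [a], whose second chord lies on [c0]. *)
have bigon : deq (D [:: (a, p c), (a, b), (b, c) & l]) (D [:: (a, p c), (a, b), (a, c), (c0, a), (b, c) & l]).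
  apply: deq_sym; have := deq_bigon pI T0 nps (t := a) (l1 := [:: (a, p c); (a, b)]) (l2 := (b, c) :: l).
  by rewrite pc0; apply; rewrite /= ?inE ?negb_or ?nE ?nE'.
have comm1 : deq (D [:: (a, p c), (a, b), (a, c), (c0, a), (b, c) & l]) (D [:: (a, p c), (a, b), (a, c), (b, c), (c0, a) & l]).
  apply: (deq_local [:: (a, p c); (a, b); (a, c)] l pI T0 (@ChordComm _ c0 a b c _)).
  by rewrite /= !inE !negb_or ?nE ?nE'.
have tri : deq (D [:: (a, p c), (a, b), (a, c), (b, c), (c0, a) & l]) (D [:: (a, p c), (b, c), (a, c), (a, b), (c0, a) & l]).
  apply: (deq_local [:: (a, p c)] ((c0, a) :: l) pI T0 (@ChordTriangle _ a b c _)).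
  by rewrite /= !inE !negb_or ?nE ?nE'.
have comm2 : deq (D [:: (a, p c), (b, c), (a, c), (a, b), (c0, a) & l]) (D [:: (b, c), (a, p c), (c, a), (a, b), (c0, a) & l]).
  apply: (@deq_trans (D [:: (b, c), (a, p c), (a, c), (a, b), (c0, a) & l])); last exact: (flip _ _ [:: (b, c); (a, p c)] _).
  apply: (deq_local [::] [:: (a, c), (a, b), (c0, a) & l] pI T0 (@ChordComm _ a (p c) b c _)).
  by rewrite /= !inE !negb_or ?nE ?nE'.
(* The new chord now cancels against the original one of [a] and [p c]. The chord of [c0] and [a]
   remains in their place and is slid to [c] and [p a]. *)
have bigon2 : deq (D [:: (b, c), (a, p c), (c, a), (a, b), (c0, a) & l]) (D [:: (b, c), (a, b), (c0, a) & l]).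
  apply: (deq_bigon pI T0 _ (s := c) (t := a) (l1 := [:: (b, c)]) (l2 := [:: (a, b), (c0, a) & l]));
  by rewrite /= ?inE ?negb_or ?nE ?nE'.
apply: deq_trans start _; apply: deq_trans bigon _; apply: deq_trans comm1 _; apply: deq_trans tri _.
apply: deq_trans comm2 _; apply: deq_trans bigon2 _.
apply: (@deq_trans (D [:: (b, p c), (a, b), (c0, a) & l])).
  by apply: (slide_r (l1 := [::]) (l2 := [:: (a, b), (c0, a) & l]));
  rewrite /= ?inE ?negb_or ?nE ?nE'.
apply: (@deq_trans (D [:: (b, p c), (a, b), (c, a) & l])).
  have := slide (a := c0) (y := a) (l1 := [:: (b, p c); (a, b)]) (l2 := l) nps.
  by rewrite pc0; apply; rewrite /= ?inE ?negb_or ?nE ?nE'.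
apply: (@deq_trans (D [:: (b, p c), (a, p b), (c, a) & l])).
  by apply: (slide_r (l1 := [:: (b, p c)]) (l2 := (c, a) :: l));
  rewrite /= ?inE ?negb_or ?nE ?nE'.
by apply: (slide_r (l1 := [:: (b, p c); (a, p b)]) (l2 := l));
  rewrite /= ?inE ?negb_or ?nE ?nE'.
Qed.

End Derived.

Lemma deq_cyclic (T : finType) (p : T -> T) (pI : injective p) T0 a b c l :
  uniq [:: a; p a; b; p b; c; p c] -> {in [:: a; b; c], forall x, x \notin labels l} ->
  deq (@Data T [:: (a, p c), (p a, b), (p b, c) & l] p pI T0)
      (@Data T [:: (b, p c), (a, p b), (c, p a) & l] p pI T0).
Proof.
move=> U out; have [al bl cl] : [/\ a \notin labels l, b \notin labels l & c \notin labels l].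
  by split; apply: out; rewrite !inE !eqxx ?orbT.
have sym (x y : T) : x != y -> y != x by rewrite eq_sym.
have := U; rewrite /= !inE !negb_or => /and5P[/and5P[n1 n2 n3 n4 n5] /and4P[n6 n7 n8 n9]
  /and3P[n10 n11 n12] /andP[n13 n14] /andP[n15 _]].
have lab_neq x : x != c -> cut_lab c x = Some x by rewrite /cut_lab => /negPf->.
have labc : cut_lab c c = None by rewrite /cut_lab eqxx.
have nxa x : x != c -> cut_nx c p (Some x) = Some (p x) by move=> /negPf nx /=; rewrite nx.
(* Cutting [c] above all its crossings creates the empty strand: [Some c] plays the part of [c0] and
   [None] that of [c]. *)
apply: deq_trans (deq_cut [::] _ pI T0 (CutVirtual c)) _.
apply: deq_trans (deq_sym (deq_cut [::] _ pI T0 (CutVirtual c))).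
rewrite /cut_data /cut_chords /= /pairmap2 /= labc !lab_neq //; try by rewrite eq_sym.
have := @deq_cyclic_spare _ (cut_nx c p) (cut_nx_inj (s := c) pI) (cut_gt0 T) (Some a) (Some b) None (Some c)
  (map (pairmap2 (cut_lab c)) l).
have ec : cut_nx c p (Some c) = None by rewrite /= eqxx.
rewrite (nxa a) // (nxa b) //; apply=> //.
  have nE := (n1, n2, n3, n4, n5, n6, n7, n8, n9, (n10, n11, n12, n13, n14, n15)).
  have nE' := (sym _ _ n1, sym _ _ n2, sym _ _ n3, sym _ _ n4, sym _ _ n5, sym _ _ n6, sym _ _ n7, sym _ _ n8,
    sym _ _ n9, (sym _ _ n10, sym _ _ n11, sym _ _ n12, sym _ _ n13, sym _ _ n14, sym _ _ n15)).
  by rewrite /= !inE !(inj_eq Some_inj) !negb_or /= ?nE ?nE'.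
move=> x; rewrite labels_map !inE => /or4P[]/eqP->; apply/mapP => -[y yl].
- by rewrite /cut_lab; case: eqVneq => // ny [cy]; rewrite cy eqxx in ny.
- by rewrite /cut_lab; case: eqVneq => // ny [ay]; rewrite ay yl in al.
- by rewrite /cut_lab; case: eqVneq => // ny [ay]; rewrite ay yl in bl.
by rewrite /cut_lab; case: eqVneq => // ey _; rewrite -ey yl in cl.
Qed.
(** * Fully cut chord words *)

Lemma mem_labels (T : eqType) (l : seq (T * T)) t :
  reflect (exists2 c, c \in l & (t == c.1) || (t == c.2)) (t \in labels l).
Proof.
apply: (iffP flattenP) => [[s /mapP[c cl ->]]|[c cl tc]].
  by rewrite !inE => tc; exists c.
by exists [:: c.1; c.2]; [apply: map_f | rewrite !inE].
Qed.

Lemma uniq_labels_cons (T : eqType) (c : T * T) l : uniq (labels (c :: l)) =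
  [&& c.1 != c.2, c.1 \notin labels l, c.2 \notin labels l & uniq (labels l)].
Proof. by rewrite /= inE negb_or -!andbA. Qed.

Lemma uniq_labels_nontriv (T : eqType) (l : seq (T * T)) c :
  uniq (labels l) -> c \in l -> c.1 != c.2.
Proof.
elim: l => // d l IHl; rewrite uniq_labels_cons => /and4P[nd _ _ ul].
by rewrite inE => /orP[/eqP->|/(IHl ul)].
Qed.

Section Perm.
Variables (T : finType) (p : T -> T) (pI : injective p) (T0 : 0 < #|T|).
Let D l := @Data T l p pI T0.

Lemma deq_move u l c v : uniq (labels (c :: l)) -> deq (D (u ++ l ++ c :: v)) (D (u ++ c :: l ++ v)).
Proof.
elim: l u => [|d l IHl] u U; first exact: deq_refl.
have := U; rewrite !uniq_labels_cons /= !inE !negb_or.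
case/and4P=> nc /and3P[c1 c2 c1l] /and3P[c3 c4 c2l] /and4P[nd _ _ ul].
have Ucl : uniq (labels (c :: l)) by rewrite uniq_labels_cons nc c1l c2l ul.
apply: (@deq_trans (D (u ++ [:: d; c] ++ l ++ v))).
  by have := IHl (rcons u d) Ucl; rewrite -!cats1 -!catA.
apply: (deq_local (l := [:: d; c]) (l' := [:: c; d]) u (l ++ v) pI T0); case: c d nc c1 c2 c3 c4 nd {IHl U Ucl c1l c2l} => [a b] [x y] /= *.
by apply: ChordComm; rewrite /= !inE !negb_or; do ?[apply/andP; split] => //; rewrite eq_sym.
Qed.

(** Since no label repeats, any chord can be brought to the front; only the unordered pairs
    matter. *)
Lemma deq_perm u l l' : uniq (labels l) -> uniq (labels l') -> labels l =i labels l' ->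
  (forall c, c \in l -> (c \in l') || ((c.2, c.1) \in l')) -> deq (D (u ++ l)) (D (u ++ l')).
Proof.
elim: l u l' => [|c l IHl] u l' ul ul' el ll'.
  by case: l' el {ul' ll'} => [|d l'] el; [exact: deq_refl | have := el d.1; rewrite /= inE eqxx].
have [d [dl' ed]] : exists d, d \in l' /\ (d = c \/ d = (c.2, c.1)).
  by have /orP[] := ll' c (mem_head _ _); [exists c | exists (c.2, c.1)]; split=> //; [left | right].
have labd x : (x == d.1) || (x == d.2) = (x == c.1) || (x == c.2).
  by case: ed => -> //=; rewrite orbC.
case/splitPr: dl' ul' el ll' => l1 l2 ul' el ll'.
have perm1 : perm_eq (labels (l1 ++ d :: l2)) (labels (d :: l1 ++ l2)).
  by rewrite -[d :: _]cat1s -[d :: l1 ++ l2]cat1s !labels_cat perm_catCA.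
have ud : uniq (labels (d :: l1 ++ l2)) by rewrite -(perm_uniq perm1).
have ud1 : uniq (labels (d :: l1)) by move: ud; rewrite -cat_cons labels_cat cat_uniq => /andP[].
apply: deq_sym; apply: deq_trans (deq_move u l2 ud1) _.
apply: (@deq_trans (D (u ++ c :: l1 ++ l2))).
  case: ed => ->; first exact: deq_refl.
  by case: (c) => a b; exact: (deq_local u (l1 ++ l2) pI T0 (ChordFlip b a)).
apply: deq_sym; suff: deq (D (rcons u c ++ l)) (D (rcons u c ++ l1 ++ l2)) by rewrite -cats1 -!catA.
have := ul; rewrite uniq_labels_cons => /and4P[_ c1l c2l ul1].
move: (ud); rewrite uniq_labels_cons => /and4P[_ d1l d2l ul12].
apply: IHl => // [x|e eL].
  have := el x; rewrite (perm_mem perm1) /= !inE !orbA labd -!orbA.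
  have [->|nx1] /= := eqVneq x c.1.
    move=> _; rewrite (negPf c1l); apply/esym/negbTE.
    by have := labd c.1; rewrite eqxx => /orP[]/eqP->.
  have [->|nx2] //= := eqVneq x c.2.
  move=> _; rewrite (negPf c2l); apply/esym/negbTE.
  by have := labd c.2; rewrite eqxx orbT => /orP[]/eqP->.
have eL' : e \in c :: l by rewrite inE eL orbT.
have e1l : e.1 \in labels l by apply/mem_labels; exists e; rewrite ?eqxx.
have nd e' : (e'.1 == e.1) || (e'.2 == e.1) -> e' != d.
  move=> ee; apply/eqP => ed'; subst e'.
  have : (e.1 == d.1) || (e.1 == d.2) by rewrite ![e.1 == _]eq_sym.
  by rewrite labd => /orP[]/eqP ee1; rewrite ee1 ?(negPf c1l) ?(negPf c2l) in e1l.
have := ll' e eL'; rewrite !mem_cat !inE !(negPf (nd _ _)) ?eqxx ?orbT //.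
Qed.

End Perm.

(* [l0] is already cut; the two strands of the next chord are cut below it. *)
Lemma cut_form_aux d (T : finType) l0 l (p : T -> T) (pI : injective p) T0 : size l <= d ->
  uniq (labels l0) -> {in labels l0, forall t, t \notin labels l} -> {in l, forall c, c.1 != c.2} ->
  exists (T' : finType) l' (p' : T' -> T') (pI' : injective p') T0',
  [/\ deq (@Data T (l0 ++ l) p pI T0) (@Data T' l' p' pI' T0'), uniq (labels l') &
    forall G, word_graph G (l0 ++ l) p -> word_graph G l' p'].
Proof.
elim: d T l0 l p pI T0 => [|d IHd] T l0 [|[a b] l] p pI T0 //=; try by
  move=> _ u0 _ _; exists T, l0, p, pI, T0; rewrite cats0; split=> //; exact: deq_refl.
move=> ld u0 dis nt.
have nab : a != b by apply: (nt (a, b)); rewrite mem_head.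
have al0 : a \notin labels l0 by apply/negP => /dis; rewrite inE eqxx.
have bl0 : b \notin labels l0 by apply/negP => /dis; rewrite !inE eqxx orbT.
pose q := cut_nx a p; pose qI : injective q := cut_nx_inj (s := a) pI.
pose r := cut_nx (Some b) q; pose rI : injective r := cut_nx_inj (s := Some b) qI.
pose l1 := map (pairmap2 Some) (l0 ++ [:: (a, b)]).
pose l2 := map (pairmap2 (cut_lab a)) l.
have cutI (U : finType) (s : U) : injective (cut_lab s).
  by move=> x y; rewrite /cut_lab; case: (eqVneq x s) => [->|_]; case: (eqVneq y s) => [->|_] // [].
have [||x|c|T' [l' [p' [pI' [T0' [e ul' gl']]]]]] := IHd _ (map (pairmap2 Some) l1)
  (map (pairmap2 (cut_lab (Some b))) l2) r rI (cut_gt0 _).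
- by rewrite !size_map.
- rewrite /l1 !labels_map !map_inj_uniq; try by move=> ? ? [].
  by rewrite labels_cat cat_uniq u0 /= (negPf al0) (negPf bl0) /= inE nab.
- rewrite /l1 !labels_map => /mapP[_ /mapP[u + ->] ->].
  rewrite labels_cat mem_cat /= !inE => ul0.
  apply/mapP => -[y + ey]; move=> /mapP[z zl ez]; move: ey; rewrite ez /cut_lab.
  case: (eqVneq z a) => [_|nza] //; case: (eqVneq _ (Some b)) => // nzb [euz]; subst z.
  have nub : u != b by apply: contra nzb => /eqP->.
  move: ul0; rewrite (negPf nza) (negPf nub) !orbF => /dis.
  by rewrite !inE (negPf nza) (negPf nub) zl.
- case/mapP => _ /mapP[c' cl ->] -> /=; rewrite !(inj_eq (cutI _ _)).
  by apply: nt; rewrite inE cl orbT.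
have e1 : deq (@Data T (l0 ++ (a, b) :: l) p pI T0) (@Data _ (l1 ++ l2) q qI (cut_gt0 T)).
  have el : l0 ++ (a, b) :: l = (l0 ++ [:: (a, b)]) ++ l by rewrite -catA.
  rewrite el; exact: (@deq_cut _ (l0 ++ [:: (a, b)]) l p pI T0 a [::] (CutVirtual a)).
have e2 : deq (@Data _ (l1 ++ l2) q qI (cut_gt0 T)) (@Data T' l' p' pI' T0').
  exact: deq_trans (@deq_cut _ l1 l2 q qI (cut_gt0 T) (Some b) [::] (CutVirtual _)) e.
exists T', l', p', pI', T0'; split=> //; first exact: deq_trans e1 e2.
move=> G g; apply: gl'; apply/(word_graph_cut _ (Some b)) => //.
by apply/(word_graph_cut _ a) => //; rewrite -catA.
Qed.

Lemma cut_form (T : finType) l (p : T -> T) (pI : injective p) T0 :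
  exists (T' : finType) l' (p' : T' -> T') (pI' : injective p') T0',
  [/\ deq (@Data T l p pI T0) (@Data T' l' p' pI' T0'), uniq (labels l') &
    forall G, word_graph G l p -> word_graph G l' p'].
Proof.
have [//|//|c|T' [l' [p' [pI' [T0' [e ul' gl']]]]]] := @cut_form_aux _ T [::] (nontriv l) p pI T0 (leqnn _).
  by rewrite mem_filter => /andP[].
exists T', l', p', pI', T0'; split=> //; first by apply: deq_trans e; apply: deq_nontriv; rewrite nontriv_id.
by move=> G /(word_graph_nontriv _ _ pI); apply: gl'.
Qed.

(* Empty strands are merged into the following ones. *)
Lemma full_form_aux d (T : finType) l (p : T -> T) (pI : injective p) T0 : #|T| <= d -> uniq (labels l) ->
  exists (T' : finType) l' (p' : T' -> T') (pI' : injective p') T0',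
  [/\ deq (@Data T l p pI T0) (@Data T' l' p' pI' T0'), uniq (labels l'),
    forall t, t \notin labels l' -> p' t = t & forall G, word_graph G l p -> word_graph G l' p'].
Proof.
elim: d T l p pI T0 => [|d IHd] T l p pI T0 Td ul; first by move: Td; rewrite leqNgt T0.
have [/existsP[s /andP[sl nps]]|/existsPn fix_] := boolP [exists s, (s \notin labels l) && (p s != s)]; last first.
  exists T, l, p, pI, T0; split=> //; first exact: deq_refl.
  by move=> t tl; have := fix_ t; rewrite tl negbK => /eqP.
pose mI : injective (merge_nx nps) := merge_nx_inj pI (nps := nps).
have [||T' [l' [p' [pI' [T0' [e ul' fx gl']]]]]] := IHd _ (map (pairmap2 (merged nps)) l) _ mI (merge_gt0 nps).
- by rewrite -ltnS; apply: leq_trans Td; exact: card_merge.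
- rewrite labels_map map_inj_in_uniq // => x y xl yl /(congr1 val) /=.
  have ns z : z \in labels l -> z != s by move=> zl; apply: contraNneq sl => <-.
  have [->|nx_] := eqVneq x (p s); have [->|ny] := eqVneq y (p s) => //.
  + by rewrite merge_ps val_merge //= => es; have := ns _ yl; rewrite -es eqxx.
  + by rewrite merge_ps val_merge //= => es; have := ns _ xl; rewrite es eqxx.
  by rewrite !val_merge.
exists T', l', p', pI', T0'; split=> //.
  by apply: deq_trans e; apply: (@deq_merge _ _ _ _ _ _ [::] l).
by move=> G /(@graph_merge _ _ pI _ nps G [::] l sl isT); apply: gl'.
Qed.

Lemma full_form (T : finType) l (p : T -> T) (pI : injective p) T0 :
  exists (T' : finType) l' (p' : T' -> T') (pI' : injective p') T0',
  [/\ deq (@Data T l p pI T0) (@Data T' l' p' pI' T0'), uniq (labels l'),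
    forall t, t \notin labels l' -> p' t = t & forall G, word_graph G l p -> word_graph G l' p'].
Proof.
have [T1 [l1 [p1 [pI1 [T01 [e1 u1 g1]]]]]] := cut_form l pI T0.
have [T' [l' [p' [pI' [T0' [e ul' fx gl']]]]]] := full_form_aux pI1 T01 (leqnn _) u1.
exists T', l', p', pI', T0'; split=> // [|G /g1]; last exact: gl'.
exact: deq_trans e1 e.
Qed.
(** * The fully cut chord word of a graph *)

(** If no label repeats, the only level at which [t] may be marked. A strand without crossings gets
    [size l], the unmarked last level. *)
Definition level_of (T : eqType) (l : seq (T * T)) (t : T) : nat := find (fun c => on_chord c t) l.

Section LevelOf.
Variables (T : eqType) (l : seq (T * T)).
Hypothesis ul : uniq (labels l).

Lemma has_on_chord t : has (fun c => on_chord c t) l = (t \in labels l).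
Proof.
apply/hasP/mem_labels => -[c cl tc]; exists c => //; first by case/andP: tc.
by rewrite /on_chord tc (uniq_labels_nontriv ul cl).
Qed.

Lemma mark_level_of t : mark_at l (level_of l t) t = (t \in labels l).
Proof.
rewrite -has_on_chord /mark_at /level_of; elim: l => //= c l' IHl.
by case: ifP => /= [->|].
Qed.

Lemma mark_level q t : mark_at l q t -> q = level_of l t.
Proof.
rewrite /level_of; elim: l ul q => [|c l' IHl] u [|q] //=.
  by rewrite /mark_at /= => ->.
move: u; rewrite uniq_labels_cons => /and4P[_ c1 c2 u'] m.
have tl' : t \in labels l'.
  move: m; rewrite /mark_at /=; case e: (onth l' q) => [c'|//] /andP[_ tc].
  by apply/mem_labels; exists c' => //; apply/onthP; exists q.
have -> : on_chord c t = false.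
  by apply/negbTE/nandP; right; apply/norP; split; apply: contraTneq tl' => ->.
by congr S; apply: IHl.
Qed.

Lemma level_of_eq t u : t \in labels l -> u \in labels l -> (level_of l t == level_of l u) =
  has (fun c => on_chord c t && on_chord c u) l.
Proof.
move=> tl ul'; apply/eqP/hasP => [e|[c cl /andP[ct cu]]].
  have := mark_level_of t; have := mark_level_of u; rewrite -e /mark_at ul' tl.
  case e1: (onth l _) => [c|//] cu ct; exists c; last by rewrite ct.
  by apply/onthP; exists (level_of l t).
have /onthP[q eq] := cl.
have mt : mark_at l q t by rewrite /mark_at eq.
have mu : mark_at l q u by rewrite /mark_at eq.
by rewrite -(mark_level mt) -(mark_level mu).
Qed.

End LevelOf.

(** With at most one crossing per strand the levels can be forgotten: the strands themselves are the
    points, permuted by [p]. *)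
Lemma single_graph G (T : finType) l (p : T -> T) : injective p -> uniq (labels l) ->
  word_graph G l p <-> graph_sys G p (fun t => t \in labels l) (level_of l).
Proof.
move=> pI ul; rewrite /word_graph (@level_single _ _ _ _ _ _ (level_of l)) //.
- by split; apply: graph_sys_ext => //= t; rewrite mark_level_of.
- by move=> t; apply: find_size.
by move=> q t _; apply: mark_level.
Qed.

Lemma out_at (G : ograph) (h1 h2 h : half G) : out h1 -> out h2 -> out h -> h1 != h2 ->
  atv h2 = atv h1 -> atv h = atv h1 -> (h == h1) || (h == h2).
Proof.
move=> o1 o2 o n12 e2 e; apply: contraTT isT => /norP[n1 n2].
have oI (x y : half G) : out x -> out y -> (x == opp y) = false.
  by move=> ox oy; apply/eqP => exy; move: ox; rewrite exy out_opp oy.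
(* A third outgoing half-edge would make five half-edges at the vertex, together with two opposite
   ones. *)
have u5 : uniq [:: h1; h2; h; opp h1; opp h2].
  rewrite /= !inE !(inj_eq (can_inj (@oppK' G))) !oI // (negPf n12).
  by rewrite (eq_sym h1 h) (eq_sym h2 h) (negPf n1) (negPf n2).
have le5 : 5 <= #|[set x | atv x == atv h1]|.
  rewrite cardE; apply: (uniq_leq_size u5) => x; rewrite mem_enum !inE.
  by case/or4P => [|||/orP[]] /eqP->; rewrite ?atv_opp ?e2 ?e eqxx.
by rewrite deg4 in le5.
Qed.

Lemma out_pair_ex (G : ograph) (v : vert G) : exists c : half G * half G,
  [/\ out c.1, out c.2, c.1 != c.2, atv c.1 = v & atv c.2 = v].
Proof.
have [h0 eh0] := atv_ex v; pose h1 := outward h0.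
have o1 : out h1 := out_outward h0.
have a1 : atv h1 = v by rewrite atv_outward.
have /existsP[h /and3P[/eqP ah n1 n2]] : [exists h, [&& atv h == v, h != h1 & h != opp h1]].
  apply: contraTT isT => /existsPn no.
  have := deg4 v; suff : #|[set h | atv h == v]| <= 2 by move=> le2 e4; rewrite e4 in le2.
  apply: (@leq_trans #|[set h1; opp h1]|); last by rewrite cards2; case: (_ != _).
  apply/subset_leq_card/subsetP => h.
  by rewrite !inE => ah; have := no h; rewrite ah /= negb_and !negbK.
exists (h1, outward h); split=> //=; [exact: out_outward | | by rewrite atv_outward].
rewrite /outward; case: ifP => _; first by rewrite eq_sym.
by apply: contra n2 => /eqP ->; rewrite oppK'.
Qed.

Section Std.
Variable G : ograph.

(** One strand for each edge, represented by its outgoing half-edge, and one for each circle without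
    vertices. *)
Definition std_lab : finType := ({h : half G | out h} + 'I_(ncirc G))%type.

Definition half_lab (h : half G) : std_lab := inl (exist _ (outward h) (out_outward h)).

Definition std_nx (x : std_lab) : std_lab :=
  match x with inl h => half_lab (nxt (val h)) | inr i => inr i end.

Lemma half_lab_inj : {in out &, injective half_lab}.
Proof. by move=> h h' oh oh' [] /=; rewrite !outward_out. Qed.

Lemma half_labE (u : {h : half G | out h}) : inl u = half_lab (val u).
Proof. by congr inl; apply: val_inj; rewrite /= outward_out ?(valP u). Qed.

Lemma std_nx_half h : out h -> std_nx (half_lab h) = half_lab (nxt h).
Proof. by move=> oh; rewrite /= outward_out. Qed.

Lemma std_nx_inj : injective std_nx.
Proof.
case=> [u|i]; case=> [v|j] e //.
have /half_lab_inj enx : half_lab (nxt (val u)) = half_lab (nxt (val v)) := e.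
rewrite !half_labE; congr half_lab; apply: (@nxt_inj G); apply: enx.
  exact: etrans (out_nxt _) (valP u).
exact: etrans (out_nxt _) (valP v).
Qed.

Lemma std_gt0 : 0 < #|std_lab|.
Proof.
have := comp_gt0 G; rewrite addn_gt0 => /orP[/card_gt0P[v _]|c0].
  by have [h _] := atv_ex v; apply/card_gt0P; exists (half_lab h).
by apply/card_gt0P; exists (inr (Ordinal c0)).
Qed.

(* The pairs of [L] are the pairs of outgoing half-edges that are identified
   by [alpha]. *)
Definition std_pairs (V : eqType) (alpha : half G -> V) (L : seq (half G * half G)) : Prop :=
  [/\ {in L, forall c, [/\ out c.1, out c.2 & alpha c.1 = alpha c.2]}, uniq (labels L)
    & forall h, out h -> h \in labels L].

Definition std_data (L : seq (half G * half G)) : data :=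
  Data (map (pairmap2 half_lab) L) std_nx_inj std_gt0.

Lemma std_out (V : eqType) (alpha : half G -> V) L h : std_pairs alpha L -> h \in labels L -> out h.
Proof. by case=> L1 _ _ /mem_labels[c /L1[o1 o2 _] /orP[]/eqP->]. Qed.

Lemma std_uniq (V : eqType) (alpha : half G -> V) L : std_pairs alpha L ->
  uniq (labels (map (pairmap2 half_lab) L)).
Proof.
move=> sL; have [_ u _] := sL; rewrite labels_map map_inj_in_uniq // => x y xl yl.
by apply: half_lab_inj; apply: std_out sL _.
Qed.

Lemma std_mem (V : eqType) (alpha : half G -> V) L x : std_pairs alpha L ->
  (x \in labels (map (pairmap2 half_lab) L)) = if x is inl _ then true else false.
Proof.
move=> sL; have [_ _ all_] := sL; rewrite labels_map; case: x => [u|i].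
  by rewrite half_labE; apply: map_f; apply: all_; apply: valP u.
by apply/mapP => -[].
Qed.

Lemma std_circ (V : eqType) (alpha : half G -> V) L : std_pairs alpha L ->
  ncirc G = fcard std_nx (no_mark std_nx (fun t => t \in labels (map (pairmap2 half_lab) L))).
Proof.
move=> sL; have fixi i n : iter n std_nx (inr i) = inr i by elim: n => //= n ->.
have con i y : fconnect std_nx (inr i) y = (y == inr i).
  apply/idP/eqP => [/iter_findex <-|->]; [exact: fixi | exact: connect0].
rewrite /n_comp_mem -[LHS]card_ord -(card_image (f := fun i => inr i : std_lab)) => [|i j [] //].
apply: eq_card => x; apply/imageP/andP => [[i _ ->]|[_ /forallP/(_ x)]].
  split; first by apply/eqP/eqP; rewrite -con connect_root.
  by apply/forallP => y; apply/implyP; rewrite con => /eqP->; rewrite (std_mem _ sL).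
by rewrite connect0 (std_mem _ sL) /=; case: x => // i _; exists i.
Qed.

(** [F] allows a graph with the same half-edges and other vertices, as it arises in the third move;
    [F = id] gives the graph itself. *)
Lemma std_via (G' : ograph) (F : half G -> half G') (F' : half G' -> half G) L :
  cancel F F' -> cancel F' F -> (forall h, ed (F h) = F (ed h)) -> (forall h, opp (F h) = F (opp h)) ->
  (forall h, out (F h) = out h) -> ncirc G' = ncirc G -> std_pairs (fun h => atv (F h)) L ->
  let l := map (pairmap2 half_lab) L in
  graph_via std_nx (fun t => t \in labels l) (level_of l) (half_lab \o F').
Proof.
move=> FK F'K Fed Fopp Fout nG sL l; have ul := std_uniq sL; have [L1 uL L2] := sL.
have F'out h : out (F' h) = out h by rewrite -Fout F'K.
have mem_l h : half_lab h \in labels l by rewrite (std_mem _ sL).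
split=> /=.
- move=> h h' oh oh' /half_lab_inj e; apply: (can_inj F'K); by apply: e; exact: etrans (F'out _) _.
- by move=> h oh; apply: mem_l.
- move=> x; rewrite (std_mem _ sL); case: x => // u _; exists (F (val u)); first by rewrite Fout (valP u).
  by rewrite FK -half_labE.
- move=> h h' oh oh'; rewrite level_of_eq //.
  have o := F'out h; have o' := F'out h'; rewrite (oh : out h) in o; rewrite (oh' : out h') in o'.
  rewrite -{1}(F'K h) -{1}(F'K h').
  move: (F' h) (F' h') o o' => {}h {}h' {}oh {}oh'; apply/eqP/hasP => [e|[c' /mapP[c cL ->]]]; last first.
    have [o1 o2 e12] := L1 c cL.
    have hE x : out x -> on_chord (pairmap2 half_lab c) (half_lab x) -> atv (F x) = atv (F c.1).
      by move=> ox /andP[_ /orP[]/eqP/half_lab_inj ->].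
    by case/andP => /(hE _ oh) -> /(hE _ oh') ->.
  have /mem_labels[c cL hc] := L2 h oh; have [o1 o2 e12] := L1 c cL.
  have n12 := uniq_labels_nontriv uL cL.
  have eh : atv (F h) = atv (F c.1) by case/orP: hc => /eqP->.
  have := @out_at G' (F c.1) (F c.2) (F h'); rewrite !Fout !(inj_eq (can_inj FK)) -e -e12 eh.
  move=> /(_ o1 o2 oh' n12 erefl erefl) hc'.
  exists (pairmap2 half_lab c); first exact: map_f.
  rewrite /on_chord /=; have -> /= : half_lab c.1 != half_lab c.2.
    by apply: contra n12 => /eqP /half_lab_inj ->.
  by apply/andP; split; [case/orP: hc | case/orP: hc'] => /eqP->; rewrite eqxx ?orbT.
- move=> h oh; exists 0; split=> //; rewrite [iter _ _ _]std_nx_half ?F'out //; congr half_lab.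
  by apply: (can_inj FK); rewrite F'K /nxt -Fopp -Fed F'K.
exact: etrans nG (std_circ sL).
Qed.

Lemma std_graph (L : seq (half G * half G)) : std_pairs (@atv G) L ->
  word_graph G (map (pairmap2 half_lab) L) std_nx.
Proof.
move=> sL; apply/single_graph; [exact: std_nx_inj | exact: std_uniq sL |].
by exists (half_lab \o id); apply: (std_via (F := id)).
Qed.

Lemma std_data_eq (L L' : seq (half G * half G)) : std_pairs (@atv G) L -> std_pairs (@atv G) L' ->
  deq (std_data L) (std_data L').
Proof.
move=> sL sL'; apply: (@deq_perm _ _ std_nx_inj std_gt0 [::]).
- exact: std_uniq sL.
- exact: std_uniq sL'.
- by move=> x; rewrite (std_mem _ sL) (std_mem _ sL').
have [L1 uL _] := sL; have [L1' uL' L2'] := sL'.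
move=> _ /mapP[c cL ->]; have [o1 o2 e12] := L1 c cL; have n12 := uniq_labels_nontriv uL cL.
have /mem_labels[d dL cd] := L2' c.1 o1; have [p1 p2 f12] := L1' d dL.
have m12 := uniq_labels_nontriv uL' dL.
have a1 : atv c.1 = atv d.1 by case/orP: cd => /eqP->.
have cd2 := out_at p1 p2 o2 m12 (esym f12) (etrans (esym e12) a1).
have ed : d = c \/ d = (c.2, c.1).
  case: c d n12 cd cd2 {dL m12 a1 o1 o2 e12 p1 p2 f12 cL} => [a b] [x y] /= nab.
  case/orP=> /eqP ea; case/orP=> /eqP eb; subst a b; first [by rewrite eqxx in nab | by left | by right].
by case: ed dL => -> dL; apply/orP; [left | right]; apply: (map_f (pairmap2 half_lab) dL).
Qed.

Lemma std_pairs_ex (sp : seq (half G * half G)) :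
  {in sp, forall c, [/\ out c.1, out c.2, c.1 != c.2 & atv c.1 = atv c.2]} ->
  uniq [seq atv c.1 | c <- sp] -> exists rest, std_pairs (@atv G) (sp ++ rest).
Proof.
move=> spP spU.
have [c cP] := @fin_all_exists _ (fun _ => (half G * half G)%type) _ (@out_pair_ex G).
pose rest := [seq c v | v <- enum (vert G) & v \notin [seq atv c.1 | c <- sp]].
exists rest; set L := sp ++ rest.
have LP : {in L, forall c, [/\ out c.1, out c.2, c.1 != c.2 & atv c.1 = atv c.2]}.
  move=> d; rewrite mem_cat => /orP[/spP //|/mapP[v _ ->]].
  by have [o1 o2 n12 e1 e2] := cP v; split=> //; rewrite e1 e2.
have restV : [seq atv c.1 | c <- rest] = [seq v <- enum (vert G) | v \notin [seq atv c.1 | c <- sp]].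
  rewrite -map_comp -[RHS]map_id; apply: eq_map => v /=.
  by have [] := cP v.
have LU : uniq [seq atv c.1 | c <- L].
  rewrite map_cat cat_uniq spU restV filter_uniq ?enum_uniq // andbT.
  by apply/hasPn => v; rewrite mem_filter => /andP[].
have LV v : v \in [seq atv c.1 | c <- L].
  by rewrite map_cat mem_cat restV mem_filter mem_enum; case: (v \in _).
split.
- by move=> d /LP[].
- elim: (L) LP LU => // d L' IHL LP /andP[dL' LU]; rewrite uniq_labels_cons.
  have [o1 o2 n12 e12] := LP d (mem_head _ _).
  have notin x : atv x = atv d.1 -> x \notin labels L'.
    move=> ex; apply/negP => /mem_labels[d' d'L xd'].
    have [_ _ _ e'] := LP d' (mem_behead (s := d :: L') d'L).
    case/negP: dL'; apply/mapP; exists d' => //.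
    by rewrite -ex; case/orP: xd' => /eqP->.
  apply/and4P; split=> //; [exact: notin | exact: notin |].
  by apply: IHL => // d' d'L; apply: LP; rewrite inE d'L orbT.
move=> h oh; have /mapP[d dL ed] := LV (atv h); have [o1 o2 n12 e12] := LP d dL.
by apply/mem_labels; exists d => //; apply: (out_at o1 o2 oh n12).
Qed.

(** In the form given by [full_form] a strand carries one crossing or is a closed circle, so the
    strands correspond to the edges and circles of the graph, and the chords to its vertices. *)
Lemma graph_std D L : std_pairs (@atv G) L -> data_graph G D -> deq D (std_data L).
Proof.
case: D => T l p pI T0 sL; rewrite /data_graph /= => g.
have [T' [l' [p' [pI' [T0' [e ul' fx g']]]]]] := full_form l pI T0.
apply: deq_trans e _; move/g'/(single_graph _ pI' ul'): g => {T l p pI T0 g'}.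
move: T' l' p' pI' T0' ul' fx => T l p pI T0 ul fx [psi via].
pose A t := t \in labels l.
(* Empty strands are fixed by [p], so no strand with a crossing is followed by an empty one. *)
have nxA t : A t -> A (p t).
  rewrite /A => At; apply: contraTT At => npt; have := fx _ npt => /pI e.
  by rewrite e in npt.
have psi_nx h : out h -> psi (nxt h) = p (psi h).
  move=> oh; have [k rk] := via_nxt via oh.
  apply: (@reach_uniq _ p A (psi h) k _ 0 _ rk) => //; first by apply: (via_mark via); rewrite out_nxt.
  by apply: nxA; apply: via_mark via _ oh.
have connect_fix t y : t \notin labels l -> fconnect p t y -> y = t.
  by move=> nt /iter_findex <-; elim: findex => //= n ->; apply: fx.
(* The empty strands form cycles of length one without marks, as many as there are circles. *)
pose unl := enum [pred t | t \notin labels l].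
have size_unl : size unl = ncirc G.
  rewrite -cardE (via_circ via) /n_comp_mem; apply: eq_card => t; rewrite !inE.
  apply/idP/andP => [nt|[_ /forallP/(_ t)]]; last by rewrite connect0.
  split; first by apply/eqP/connect_fix => //; apply: connect_root.
  by apply/forallP => y; apply/implyP => /(connect_fix _ _ nt) ->.
have /card_gt0P[t0 _] := T0.
have mem_unl t : (t \in unl) = (t \notin A) by rewrite mem_enum inE.
pose f (x : std_lab) : T :=
  match x with inl u => psi (val u) | inr i => nth t0 unl i end.
have nth_unl (i : 'I_(ncirc G)) : nth t0 unl i \notin A by rewrite -mem_unl mem_nth ?size_unl.
have psiA (u : {h : half G | out h}) : psi (val u) \in A by apply: via_mark via _ (valP u).
have f_inj : injective f.
  case=> [u|i] [v|j] /= e.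
  - by congr inl; apply: val_inj; apply: (via_inj via) => //; [apply: (valP u) | apply: (valP v)].
  - by have := nth_unl j; rewrite -e psiA.
  - by have := nth_unl i; rewrite e psiA.
  congr inr; apply/val_inj/eqP; move/eqP: e; rewrite nth_uniq ?enum_uniq // size_unl; apply: ltn_ord.
have f_sur t : exists x, f x = t.
  have [tA|] := boolP (t \in A); first by have [h oh <-] := via_sur via tA; exists (half_lab h); rewrite /= outward_out.
  rewrite -mem_unl => tu; have lt_t : index t unl < ncirc G by rewrite -size_unl index_mem.
  by exists (inr (Ordinal lt_t)); rewrite /= nth_index.
have [f' f'K] := @fin_all_exists _ (fun _ => std_lab) (fun t x => f x = t) f_sur.
have fE h : out h -> f (half_lab h) = psi h by move=> oh; rewrite /= outward_out.
have [L' outL' lL'] : exists2 L', {in L', forall c : half G * half G, out c.1 /\ out c.2} &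
    l = map (pairmap2 psi) L'.
  have : {subset l <= l} by [].
  elim: {1 3}l => [|c l0 IHl] sub; first by exists [::].
  have [|L' o ->] := IHl; first by move=> d dl; apply: sub; rewrite inE dl orbT.
  have inA t : (t == c.1) || (t == c.2) -> A t.
    by move=> tc; apply/mem_labels; exists c => //; apply: sub; apply: mem_head.
  have [|h1 o1 e1] := via_sur via (inA c.1 _); rewrite ?eqxx //.
  have [|h2 o2 e2] := via_sur via (inA c.2 _); rewrite ?eqxx ?orbT //.
  exists ((h1, h2) :: L') => [d|]; first by rewrite inE => /predU1P[->|/o].
  by rewrite /pairmap2 /= e1 e2; case: (c).
have sL' : std_pairs (@atv G) L'.
  have labL : labels l = map psi (labels L') by rewrite lL' labels_map.
  split.
  - move=> c cL; have [o1 o2] := outL' c cL; split=> //; apply/eqP; rewrite (via_at via) // level_of_eq ?(via_mark via) //.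
    apply/hasP; exists (pairmap2 psi c); first by rewrite [in X in _ \in X]lL'; apply: map_f.
    have n12 : psi c.1 != psi c.2 by apply: (uniq_labels_nontriv (c := pairmap2 psi c) ul); rewrite lL'; apply: map_f.
    by rewrite /on_chord /= n12 !eqxx orbT.
  - by apply: map_uniq (psi) _ _; rewrite -labL.
  move=> h oh; have := via_mark via oh; rewrite /A labL => /mapP[h' h'L e].
  rewrite (via_inj via _ _ e) //; have /mem_labels[c cL hc] := h'L; have [o1 o2] := outL' c cL.
  by case/orP: hc => /eqP->.
apply: deq_trans (std_data_eq sL' sL); apply/deq_sym/deq_step.
apply: (@DIso (std_data L') (@Data T l p pI T0) f).
- by exists f' => [x|t]; [apply: f_inj; rewrite f'K | apply: f'K].
- rewrite /= lL' map_pairmap2_comp; apply: map_labels_eq => h hL; rewrite /= outward_out //.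
  exact: std_out sL' hL.
case=> [u|i] /=; first by rewrite -psi_nx ?(valP u) // outward_out // out_nxt (valP u).
by rewrite fx // nth_unl.
Qed.

End Std.
(** * Isotopic graphs have equivalent chord words *)

(** Both words are equivalent to the fully cut word, which depends on the graph alone. *)
Lemma graph_deq (G : ograph) D D' : data_graph G D -> data_graph G D' -> deq D D'.
Proof.
move=> g g'; have [//|//|L sL] := @std_pairs_ex G [::].
exact: deq_trans (graph_std sL g) (deq_sym (graph_std sL g')).
Qed.

Definition outer_pairs (G : ograph) (sp : seq (half G * half G)) : Prop :=
  {in sp, forall c, [/\ out c.1, out c.2, c.1 != c.2 & atv c.1 = atv c.2]}.

Lemma outer_at (G : ograph) (sp : seq (half G * half G)) h : outer_pairs sp -> out h ->
  (atv h \in [seq atv c.1 | c <- sp]) = (h \in labels sp).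
Proof.
move=> spP oh; apply/mapP/mem_labels => -[c csp hc]; have [o1 o2 n12 e12] := spP c csp; exists c => //.
  exact: out_at o1 o2 oh n12 (esym e12) hc.
by case/orP: hc => /eqP->.
Qed.

Lemma mem_half_labs (G : ograph) (L : seq (half G * half G)) h : {in labels L, forall x, out x} ->
  out h -> (half_lab h \in labels (map (pairmap2 (@half_lab G)) L)) = (h \in labels L).
Proof.
move=> oL oh; rewrite labels_map; apply/mapP/idP => [[x xL e]|]; last by exists h.
by rewrite (half_lab_inj oh (oL x xL) e).
Qed.

(** Some graph of the word [rest] exists and arises by erasing [S]; it is isomorphic to [G'] because
    erasing determines the result. *)
Lemma std_erase (G G' : ograph) (S : {set vert G}) (sp rest : seq (half G * half G)) :
  outer_pairs sp -> S =i [seq atv c.1 | c <- sp] -> std_pairs (@atv G) (sp ++ rest) ->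
  erased S G' -> word_graph G' (map (pairmap2 (@half_lab G)) rest) (@std_nx G).
Proof.
move=> spP eS sL era; set l := map _ rest.
have oL h : h \in labels (sp ++ rest) -> out h by apply: std_out sL.
have oR : {in labels rest, forall h, out h} by move=> h hr; apply: oL; rewrite labels_cat mem_cat hr orbT.
have [L1 uL L2] := sL; have uLl := std_uniq sL.
have ul : uniq (labels l) by move: uLl; rewrite map_cat labels_cat cat_uniq => /and3P[].
have [G'' g''] := data_graph_ex (@Data _ l _ (@std_nx_inj G) (std_gt0 G)).
suff era'' : erased S G'' by apply: iso_word_graph g''; apply: erased_uniq era'' era.
have [psi'' via''] := (single_graph G'' (@std_nx_inj G) ul).1 g''.
have := std_via (G' := G) (F := id) (F' := id) _ _ _ _ _ _ sL; move=> /(_ _ _ _ _ _ _)/=via.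
have subl x : x \in labels l -> x \in labels (map (pairmap2 (@half_lab G)) (sp ++ rest)).
  by rewrite map_cat labels_cat mem_cat => ->; rewrite orbT.
apply: (graph_erased (@std_nx_inj G) (via _ _ _ _ _ _) via'') => //.
- move=> x y xl yl; rewrite !level_of_eq ?subl // map_cat has_cat orb_idl // => /hasP[c csp /andP[cx _]].
  have : uniq (labels (map (pairmap2 (@half_lab G)) sp) ++ labels l) by rewrite -labels_cat -map_cat.
  rewrite cat_uniq => /and3P[_ /hasPn/(_ x xl)/negP[]].
  by apply/mem_labels; exists c => //; case/andP: cx.
move=> h oh; rewrite /= mem_half_labs // eS outer_at //.
have := L2 h oh; move: uL; rewrite labels_cat mem_cat cat_uniq => /and3P[_ /hasPn dis _].
by case: (boolP (h \in labels rest)) => [/dis/negPf -> //|_]; rewrite orbF.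
Qed.

(** The first two moves are reduced to removing the chords [sp] from the front of a fully cut
    word. *)
Lemma erased_deq (G G' : ograph) (S : {set vert G}) (sp : seq (half G * half G)) D D' :
  outer_pairs sp -> uniq [seq atv c.1 | c <- sp] -> S =i [seq atv c.1 | c <- sp] ->
  (forall rest, uniq (labels (map (pairmap2 (@half_lab G)) (sp ++ rest))) ->
     deq (std_data (sp ++ rest)) (std_data rest)) ->
  erased S G' -> data_graph G D -> data_graph G' D' -> deq D D'.
Proof.
move=> spP spU eS e era g g'; have [rest sL] := std_pairs_ex spP spU.
apply: deq_trans (graph_std sL g) _; apply: deq_trans (e rest (std_uniq sL)) _.
by apply: graph_deq g'; apply: (std_erase spP eS sL era).
Qed.

Lemma reid1_deq (G G' : ograph) D D' : reid1 G G' -> data_graph G D -> data_graph G' D' -> deq D D'.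
Proof.
case=> h0 [a0 n0 era0].
(* If [h0] is incoming, the loop is read from the other end of its edge. *)
have [h [oh ah nh era]] : exists h : half G, [/\ out h, atv (ed h) = atv h, ed h != opp h & erased [set atv h] G'].
  have [o|no] := boolP (out h0); first by exists h0.
  exists (ed h0); rewrite out_ed no edK' -a0 in era0 *; split=> //.
  by apply: contra n0 => /eqP e; rewrite {2}e oppK'.
have on : out (nxt h) by rewrite out_nxt.
have hn : h != nxt h by apply: contra nh => /eqP e; rewrite {2}e /nxt oppK'.
apply: (erased_deq (sp := [:: (h, nxt h)])) era => //.
- by move=> c; rewrite inE => /eqP-> /=; rewrite atv_nxt ah.
- by move=> v; rewrite !inE.
move=> rest; rewrite cat1s map_cons uniq_labels_cons => /and4P[n n1 _ _].
have := @deq_loop _ _ (@std_nx_inj G) (std_gt0 G) (half_lab h) _ [::] (map (pairmap2 (@half_lab G)) rest).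
rewrite std_nx_half //; apply=> //; first by rewrite eq_sym.
Qed.

Lemma uniq_front (T : eqType) (s s' l : seq T) : uniq (s ++ l) -> perm_eq s s' ->
  uniq s' /\ {in s', forall x, x \notin l}.
Proof.
rewrite cat_uniq => /and3P[us dis _] ss'; split; first by rewrite -(perm_uniq ss').
by move=> x; rewrite -(perm_mem ss'); apply: contraTN => xl; exact: (hasPn dis).
Qed.

(** The chords at the front list the half-edges vertex by vertex, while the lemmas on chord words
    name them arc by arc. *)
Lemma perm4 (T : eqType) (a b c d : T) : perm_eq [:: a; b; c; d] [:: a; c; b; d].
Proof. by apply/permP => q /=; lia. Qed.
Lemma perm4' (T : eqType) (a b c d : T) : perm_eq [:: a; d; b; c] [:: a; b; c; d].
Proof. by apply/permP => q /=; lia. Qed.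
Lemma perm6 (T : eqType) (a b c d e f : T) : perm_eq [:: a; e; b; c; d; f] [:: a; b; c; d; e; f].
Proof. by apply/permP => q /=; lia. Qed.
Lemma perm6' (T : eqType) (a b c d e f : T) : perm_eq [:: a; f; b; c; d; e] [:: a; b; c; d; e; f].
Proof. by apply/permP => q /=; lia. Qed.

Lemma perm_ends (T : eqType) (a b c d e f : T) : perm_eq [:: a; f; b; c; d; e] [:: a; c; e; b; d; f].
Proof. by apply/permP => q /=; lia. Qed.
Lemma perm_ends' (T : eqType) (a b c d e f : T) : perm_eq [:: a; e; b; c; d; f] [:: a; c; e; b; d; f].
Proof. by apply/permP => q /=; lia. Qed.
Lemma perm_cyc (T : eqType) (a b c d e f : T) : perm_eq [:: a; f; b; c; d; e] [:: c; f; a; d; e; b].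
Proof. by apply/permP => q /=; lia. Qed.
Lemma perm_acyc (T : eqType) (a b c d e f : T) : perm_eq [:: a; e; b; c; d; f] [:: c; e; a; d; b; f].
Proof. by apply/permP => q /=; lia. Qed.

Lemma reid2_deq (G G' : ograph) D D' : reid2 G G' -> data_graph G D -> data_graph G' D' -> deq D D'.
Proof.
case=> k1 [k2 [a1 a2 n0 [m1 m2 m3] era0]].
have [h1 [h2 [oh [ah ad nv] [n1 n2 n3] era]]] : exists h1 h2 : half G, [/\ out h1,
   [/\ atv h2 = atv h1, atv (ed h2) = atv (ed h1) & atv (ed h1) != atv h1],
   [/\ h2 != h1, h2 != opp h1 & ed h2 != opp (ed h1)] & erased [set atv h1; atv (ed h1)] G'].
  have [o|no] := boolP (out k1); first by exists k1, k2.
  exists (ed k1), (ed k2); rewrite out_ed no !edK' eq_sym n0 setUC (inj_eq (can_inj (@edK' G))).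
  by split.
have on1 : out (nxt h1) by rewrite out_nxt.
have [oh2|ih2] := boolP (out h2).
  have on2 : out (nxt h2) by rewrite out_nxt.
  have nn : nxt h1 != nxt h2 by rewrite (inj_eq (@nxt_inj G)) eq_sym.
  apply: (erased_deq (sp := [:: (h1, h2); (nxt h1, nxt h2)])) era => //.
  - by move=> c; rewrite !inE => /orP[]/eqP-> /=; rewrite ?atv_nxt ?ad // eq_sym.
  - by rewrite /= inE atv_nxt eq_sym nv.
  - by move=> v; rewrite !inE atv_nxt.
  move=> rest; rewrite map_cat labels_cat labels_map => u.
  have [U dis] := uniq_front u (perm_map _ (perm4 h1 h2 (nxt h1) (nxt h2))).
  have := @deq_parallel _ _ (@std_nx_inj G) (std_gt0 G) (half_lab h1) (half_lab h2)
    (map (pairmap2 (@half_lab G)) rest).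
  by rewrite !std_nx_half //; apply=> //; apply: dis; rewrite !inE eqxx ?orbT.
pose b := ed h2; have ob : out b by rewrite out_ed ih2.
have on2 : out (nxt b) by rewrite out_nxt.
have nb : nxt b = opp h2 by rewrite /nxt edK'.
have nn : h1 != nxt b by rewrite nb; apply: contra n2 => /eqP->; rewrite oppK'.
have nn' : nxt h1 != b by rewrite eq_sym.
apply: (erased_deq (sp := [:: (h1, nxt b); (nxt h1, b)])) era => //.
- by move=> c; rewrite !inE => /orP[]/eqP-> /=; rewrite ?atv_nxt ?edK' ?ad.
- by rewrite /= inE atv_nxt eq_sym nv.
- by move=> v; rewrite !inE atv_nxt.
move=> rest; rewrite map_cat labels_cat labels_map => u.
have [U dis] := uniq_front u (perm_map _ (perm4' h1 (nxt h1) b (nxt b))).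
have := @deq_antiparallel _ _ (@std_nx_inj G) (std_gt0 G) (half_lab h1) (half_lab b)
  (map (pairmap2 (@half_lab G)) rest).
by rewrite !std_nx_half //; apply=> //; apply: dis; rewrite !inE eqxx ?orbT.
Qed.

(** * The third move on fully cut chord words *)

Section Flip.
Variables (G : ograph) (T : {set half G}) (s : seq (half G)).
Hypothesis os : {in s, forall h, out h}.
Hypothesis TE : forall h, (h \in T) = (h \in s) || (ed h \in s).

Lemma flip_start h : h \in s -> flip_atv T h = atv (nxt h).
Proof. by move=> hs; rewrite /flip_atv TE hs atv_nxt. Qed.

Lemma flip_end h : h \in s -> nxt h \notin s -> flip_atv T (nxt h) = atv h.
Proof.
move=> hs ns; rewrite /flip_atv TE (negPf ns) /=.
have -> : (ed (nxt h) \in s) = false.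
  by apply/negbTE; apply: contraL (os hs) => /os; rewrite out_ed out_nxt.
by rewrite /nxt oppK' TE edK' hs orbT.
Qed.

Lemma flip_off h : out h -> h \notin s -> h \notin map (@nxt G) s -> flip_atv T h = atv h.
Proof.
move=> oh ns nns; rewrite /flip_atv !TE (negPf ns) /=.
have -> : (ed h \in s) = false by apply/negbTE; apply: contraL oh => /os; rewrite out_ed.
have -> : (opp h \in s) = false by apply/negbTE; apply: contraL oh => /os; rewrite out_opp.
case: ifP => //= es; case/negP: nns; apply/mapP; exists (ed (opp h)) => //.
by rewrite /nxt edK' oppK'.
Qed.

Variables (G' : ograph) (f : half G -> half G') (g : vert G -> vert G').
Hypotheses (fb : bijective f) (f_at : forall h, atv (f h) = g (flip_atv T h)).
Hypotheses (f_ed : forall h, ed (f h) = f (ed h)) (f_opp : forall h, opp (f h) = f (opp h)).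
Hypotheses (f_out : forall h, out (f h) = out h) (nG : ncirc G' = ncirc G).

(** The third move keeps the half-edges and [nxt], hence the strands and their successors; only the
    pairs at the three vertices change, from [sp] to [sp']. *)
Lemma flip_deq (sp sp' : seq (half G * half G)) D D' :
  outer_pairs sp -> uniq [seq atv d.1 | d <- sp] ->
  labels sp =i s ++ map (@nxt G) s -> perm_eq (labels sp) (labels sp') ->
  {in sp', forall d, flip_atv T d.1 = flip_atv T d.2} ->
  (forall rest, uniq (labels (map (pairmap2 (@half_lab G)) (sp ++ rest))) ->
     deq (std_data (sp ++ rest)) (std_data (sp' ++ rest))) ->
  data_graph G D -> data_graph G' D' -> deq D D'.
Proof.
move=> spP spU spl spl' spf e gD gD'; have [rest sL] := std_pairs_ex spP spU.
apply: deq_trans (graph_std sL gD) _; apply: deq_trans (e rest (std_uniq sL)) _.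
have [L1 uL L2] := sL; have pL : perm_eq (labels (sp ++ rest)) (labels (sp' ++ rest)).
  by rewrite !labels_cat perm_cat2r.
have dis x : x \in labels rest -> x \notin labels sp.
  by move: uL; rewrite labels_cat cat_uniq => /and3P[_ /hasPn ds _] /ds.
have sL' : std_pairs (fun h => atv (f h)) (sp' ++ rest).
  split; [| by rewrite -(perm_uniq pL) | by move=> h /L2; rewrite (perm_mem pL)].
  move=> d dL; have inL x : (x == d.1) || (x == d.2) -> x \in labels (sp' ++ rest).
    by move=> xd; apply/mem_labels; exists d.
  have o x : (x == d.1) || (x == d.2) -> out x by move=> /inL; rewrite -(perm_mem pL); apply: std_out sL.
  rewrite !o ?eqxx ?orbT //; split=> //; rewrite !f_at; congr g.
  move: dL; rewrite mem_cat => /orP[/spf //|dr].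
  have off x : (x == d.1) || (x == d.2) -> flip_atv T x = atv x.
    move=> xd; have /dis : x \in labels rest by apply/mem_labels; exists d.
    by rewrite spl mem_cat => /norP[]; apply: flip_off; apply: o.
  rewrite !off ?eqxx ?orbT //; have [] := L1 d => //.
  by rewrite mem_cat dr orbT.
apply: graph_deq gD'; have [f' fK f'K] := fb.
apply/single_graph; [exact: std_nx_inj | exact: std_uniq sL' |].
by exists (@half_lab G \o f'); apply: std_via fK f'K f_ed f_opp f_out nG sL'.
Qed.

End Flip.

Definition triangle (G : ograph) (h1 h2 h3 : half G) : Prop :=
  [/\ [/\ atv (ed h1) = atv h2, atv (ed h2) = atv h3 & atv (ed h3) = atv h1],
      [/\ atv h1 != atv h2, atv h2 != atv h3 & atv h3 != atv h1]
    & [/\ h2 != opp (ed h1), h3 != opp (ed h2) & h1 != opp (ed h3)]].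

Lemma triangle_rot (G : ograph) (h1 h2 h3 : half G) : triangle h1 h2 h3 -> triangle h2 h3 h1.
Proof. by case=> -[? ? ?] [? ? ?] [? ? ?]. Qed.

Lemma triangle_rev (G : ograph) (h1 h2 h3 : half G) : triangle h1 h2 h3 -> triangle (ed h3) (ed h2) (ed h1).
Proof.
have sw (x y : half G) : x != opp (ed y) -> ed y != opp (ed (ed x)).
  by apply: contra => /eqP->; rewrite edK' oppK'.
case=> -[e1 e2 e3] [n1 n2 n3] [m1 m2 m3]; split; first by rewrite !edK'.
  by rewrite e1 e2 e3; split; rewrite eq_sym.
by split; apply: sw.
Qed.

(** A walk around the triangle may be reversed and started at any side. Hence there are two cases:
    all sides agree with the orientation, or all but the last. *)
Lemma triangle_out (G : ograph) (h1 h2 h3 : half G) : triangle h1 h2 h3 ->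
  exists a b c : half G, [/\ [/\ out a, out b & out c], triangle a b c \/ triangle a b (ed c)
    & [set h1; h2; h3; ed h1; ed h2; ed h3] = [set a; b; c; ed a; ed b; ed c]].
Proof.
move=> t; have r := triangle_rot t; have rr := triangle_rot r.
have t' := triangle_rev t; have r' := triangle_rot t'; have rr' := triangle_rot r'.
have [o1|o1] := boolP (out h1); have [o2|o2] := boolP (out h2); have [o3|o3] := boolP (out h3).
- by exists h1, h2, h3; split=> //; left.
- by exists h1, h2, (ed h3); rewrite !out_ed ?o3 edK'; split=> //; [right | apply/setP => x; rewrite !inE; lia].
- by exists h3, h1, (ed h2); rewrite !out_ed ?o2 edK'; split=> //; [right | apply/setP => x; rewrite !inE; lia].
- by exists (ed h3), (ed h2), h1; rewrite !out_ed ?o2 ?o3 !edK'; split=> //; [right | apply/setP => x; rewrite !inE; lia].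
- by exists h2, h3, (ed h1); rewrite !out_ed ?o1 edK'; split=> //; [right | apply/setP => x; rewrite !inE; lia].
- by exists (ed h1), (ed h3), h2; rewrite !out_ed ?o1 ?o3 !edK'; split=> //; [right | apply/setP => x; rewrite !inE; lia].
- by exists (ed h2), (ed h1), h3; rewrite !out_ed ?o1 ?o2 !edK'; split=> //; [right | apply/setP => x; rewrite !inE; lia].
by exists (ed h3), (ed h2), (ed h1); rewrite !out_ed ?o1 ?o2 ?o3 !edK'; split=> //; [left | apply/setP => x; rewrite !inE; lia].
Qed.

Lemma reid3_deq (G G' : ograph) D D' : reid3 G G' -> data_graph G D -> data_graph G' D' -> deq D D'.
Proof.
case=> h1 [h2 [h3 [t1 t2 t3 [f [g /= [fb gb [fa fe fo fu] nG]]]]]].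
have [a [b [c [[oa ob oc] abc TE]]]] := triangle_out (And3 t1 t2 t3).
have [ona onb onc] : [/\ out (nxt a), out (nxt b) & out (nxt c)] by rewrite !out_nxt.
pose s := [:: a; b; c]; set T := [set h1; h2; h3; ed h1; ed h2; ed h3] in fa TE.
have os : {in s, forall h, out h} by move=> h; rewrite !inE => /or3P[]/eqP->.
have TE' h : (h \in T) = (h \in s) || (ed h \in s).
  have e x : (ed h == x) = (h == ed x) by rewrite -(inj_eq (can_inj (@edK' G))) edK'.
  by rewrite TE !inE !e -!orbA.
have nat (h h' : half G) : atv h != atv h' -> h != h' by apply: contra => /eqP->.
have [fsa fsb fsc] : [/\ flip_atv T a = atv (nxt a), flip_atv T b = atv (nxt b) & flip_atv T c = atv (nxt c)].
  by split; apply: flip_start TE' _ _; rewrite !inE eqxx ?orbT.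
have fend : [/\ nxt a != a, nxt a != b & nxt a != c] -> [/\ nxt b != a, nxt b != b & nxt b != c] ->
    [/\ nxt c != a, nxt c != b & nxt c != c] ->
    [/\ flip_atv T (nxt a) = atv a, flip_atv T (nxt b) = atv b & flip_atv T (nxt c) = atv c].
  move=> [a1 a2 a3] [b1 b2 b3] [c1 c2 c3].
  by split; apply: flip_end os TE' _ _ _; rewrite !inE ?eqxx ?orbT // !negb_or ?a1 ?a2 ?a3 ?b1 ?b2 ?b3 ?c1 ?c2.
(* In the coherent case the outgoing half-edges at each corner are a side and the continuation of
   the preceding side. *)
case: abc => -[[e1 e2 e3] [n1 n2 n3] [m1 m2 m3]].
  have [||| fea feb fec] := fend; first by split; [apply: nat; rewrite atv_nxt e1 eq_sym | rewrite eq_sym |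
    apply: nat; rewrite atv_nxt e1].
  - by split; [apply: nat; rewrite atv_nxt e2 | apply: nat; rewrite atv_nxt e2 eq_sym | rewrite eq_sym].
  - by split; [rewrite eq_sym | apply: nat; rewrite atv_nxt e3 | apply: nat; rewrite atv_nxt e3 eq_sym].
  apply: (flip_deq os TE' fb fa fe fo fu nG (sp := [:: (a, nxt c); (nxt a, b); (nxt b, c)])
    (sp' := [:: (b, nxt c); (a, nxt b); (c, nxt a)])).
  - by move=> d; rewrite !inE => /or3P[]/eqP-> /=; rewrite ?atv_nxt; split=> //; rewrite eq_sym.
  - by rewrite /= !inE !atv_nxt e1 e2 negb_or n1 n2 eq_sym n3.
  - exact/perm_mem/perm_ends.
  - exact: perm_cyc.
  - by move=> d; rewrite !inE => /or3P[]/eqP-> /=; rewrite ?fsa ?fsb ?fsc ?fea ?feb ?fec atv_nxt.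
  move=> rest; rewrite map_cat labels_cat labels_map => u.
  have [U dis] := uniq_front u (perm_map _ (perm6' a (nxt a) b (nxt b) c (nxt c))).
  have := @deq_cyclic _ _ (@std_nx_inj G) (std_gt0 G) (half_lab a) (half_lab b) (half_lab c)
    (map (pairmap2 (@half_lab G)) rest).
  rewrite !std_nx_half //; apply=> // x; rewrite !inE => /or3P[]/eqP->; apply: dis; by rewrite !inE eqxx ?orbT.
(* Here [a] and [c] start at the same corner, and [b] and [c] end at the same one. *)
rewrite edK' in e3 n2 n3 m3; have nac : a != c by apply: contra n2 => /eqP<-; rewrite e1.
have nbc : b != c by apply: nat; rewrite e3 eq_sym.
have [||| fea feb fec] := fend; first by split; [apply: nat; rewrite atv_nxt e1 eq_sym | rewrite eq_sym |
    apply: nat; rewrite atv_nxt e1 e3 eq_sym].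
- by split; apply: nat; rewrite atv_nxt e2 // ?e3 // eq_sym.
- by split; apply: nat; rewrite atv_nxt ?e3 // eq_sym.
apply: (flip_deq os TE' fb fa fe fo fu nG (sp := [:: (a, c); (nxt a, b); (nxt b, nxt c)])
    (sp' := [:: (b, c); (a, nxt b); (nxt a, nxt c)])).
- move=> d; rewrite !inE => /or3P[]/eqP-> /=; rewrite ?atv_nxt; split=> //; first by rewrite eq_sym.
  by rewrite (inj_eq (@nxt_inj G)).
- by rewrite /= !inE !atv_nxt e1 e2 negb_or n1 n2 eq_sym n3.
- exact/perm_mem/perm_ends'.
- exact: perm_acyc.
- by move=> d; rewrite !inE => /or3P[]/eqP-> /=; rewrite ?fsa ?fsb ?fsc ?fea ?feb ?fec ?atv_nxt.
move=> rest; rewrite map_cat labels_cat labels_map => u.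
have [U dis] := uniq_front u (perm_map _ (perm6 a (nxt a) b (nxt b) c (nxt c))).
have := @deq_acyclic _ _ (@std_nx_inj G) (std_gt0 G) (half_lab a) (half_lab b) (half_lab c)
  (map (pairmap2 (@half_lab G)) rest).
by rewrite !std_nx_half //; apply=> //; apply: dis; rewrite !inE eqxx ?orbT.
Qed.

Lemma free_step_deq (G G' : ograph) D D' : free_step G G' -> data_graph G D -> data_graph G' D' -> deq D D'.
Proof.
case=> [i g g'|r|r|r]; [|exact: reid1_deq r|exact: reid2_deq r|exact: reid3_deq r].
by apply: graph_deq g'; apply: iso_word_graph i g.
Qed.

Lemma graph_data_ex (G : ograph) : exists D, data_graph G D.
Proof. by have [//|//|L sL] := @std_pairs_ex G [::]; exists (std_data L); apply: std_graph sL. Qed.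

Lemma isotopic_deq (G G' : ograph) D D' : isotopic G G' -> data_graph G D -> data_graph G' D' -> deq D D'.
Proof.
move=> i; elim: i D D' => {G G'} [G G' s|G|G G' _ IH|G G1 G' _ IH1 _ IH2] D D' g g'.
- exact: free_step_deq s g g'.
- exact: graph_deq g g'.
- by apply: deq_sym; apply: IH.
by have [D1 g1] := graph_data_ex G1; apply: deq_trans (IH1 _ _ g g1) (IH2 _ _ g1 g').
Qed.

Lemma isotopic_L_equiv n m (b : braid n) (b' : braid m) :
  isotopic (braid_closure b) (braid_closure b') -> L_equiv b b'.
Proof.
move=> i; have [n0 fb] := braid_in b; have [m0 fb'] := braid_in b'.
have rb := @val_rep n n0 b fb; have rb' := @val_rep m m0 b' fb'.
exact: deq_L (isotopic_deq i (closure_data_graph rb) (closure_data_graph rb')) rb rb'.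
Qed.

Theorem theorem3p3 (L1 L2 : ograph) (n m : nat)
    (beta1 : braid n) (beta2 : braid m)
    (closure1 : isotopic (braid_closure beta1) L1)
    (closure2 : isotopic (braid_closure beta2) L2) :
  isotopic L1 L2 <-> L_equiv beta1 beta2.
Proof.
split=> [e|/L_equiv_isotopic e].
  apply: isotopic_L_equiv; apply: rst_trans closure1 _.
  exact: rst_trans e (rst_sym _ _ _ _ closure2).
by apply: rst_trans (rst_sym _ _ _ _ closure1) _; apply: rst_trans e closure2.
Qed.
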